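(* Let $d,M\in\mathbb{N}$ and $\mathcal{D}=[-1,1]^d$. Assume that the vector fields $g^m:\mathcal{D}\to\mathbb{R}^d$, $m\in\{0,1,\ldots,M\}$, are of class $\mathcal{C}^2$ on $\mathcal{D}$ and satisfy, for all $m\in\{0,\ldots,M\}$, $k\in\{1,\ldots,d\}$ and $x\in\mathcal{D}$: if $x_k\in\{-1,1\}$ then $g_k^m(x)=0$. Let $x_0\in\mathcal{D}$ and let $(X(t))_{t\ge 0}$ be the solution of the Itô stochastic differential equation $\mathrm{d}X(t)=g^0(X(t))\,\mathrm{d}t+\sum_{m=1}^M g^m(X(t))\,\mathrm{d}B^m(t)$, $X(0)=x_0$. Assume that the integrator $\Phi:\mathbb{R}^+\times\mathbb{R}\times[-1,1]\to\mathbb{R}$, $(s,\gamma,y)\mapsto\Phi(s,\gamma,y)$, is such that $\Phi(s,\gamma,y)\in[-1,1]$ for all $s\ge 0$, $\gamma\in\mathbb{R}$, $y\in[-1,1]$; that for all $y\in[-1,1]$ one has $\Phi(0,0,y)=y$, $\partial_\gamma\Phi(0,0,y)=\sigma(y)$ and $\partial_s\Phi(0,0,y)+\frac12\partial_\gamma^2\Phi(0,0,y)=0$; and that $\Phi$ is of class $\mathcal{C}^3$ with $\|\Phi\|_{3,\beta}<\infty$ for some $\beta\in(0,\infty)$. Given $T\in(0,\infty)$ and $\tau=T/N$ with $N\in\mathbb{N}$, let $(X_n)_{n=0,\ldots,N}$ be defined by $X_0=x_0$ and, for $n\in\{0,\ldots,N-1\}$, $k\in\{1,\ldots,d\}$,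 $$X_{n+1,k}=\Phi\left(\|f_k(X_n)\|^2\tau,\ f_k(X_n)\cdot\delta B_n+f_k^0(X_n)\tau,\ X_{n,k}\right).$$ Then for all $T\in(0,\infty)$ there exists $C(T)\in(0,\infty)$ such that for all $\tau=T/N$ with $N\in\mathbb{N}$ one has $$\sup_{0\le n\le N}\left(\mathbb{E}\left[\|X_n-X(t_n)\|^2\right]\right)^{\frac12}\le C(T)\,\tau^{\frac12}.$$
   Context: $B=(B^1,\ldots,B^M)$ is a standard $\mathbb{R}^M$-valued Brownian motion; $t_n=n\tau$ and $\delta B_n=B(t_{n+1})-B(t_n)\in\mathbb{R}^M$. Components of vectors in $\mathbb{R}^d$ are indexed by $k$: $g^m=(g_1^m,\ldots,g_d^m)$, $X_n=(X_{n,1},\ldots,X_{n,d})$. Under the stated assumptions the stochastic differential equation has a unique solution, and almost surely $X(t)\in\mathcal{D}$ for all $t\ge 0$. $\sigma(y)=(y-1)(y+1)$ for $y\in[-1,1]$. For $m\in\{0,\ldots,M\}$ and $k\in\{1,\ldots,d\}$, $f_k^m:\mathcal{D}\to\mathbb{R}$ is the (unique) continuous function such that $g_k^m(x)=\sigma(x_k)f_k^m(x)$ for all $x\in\mathcal{D}$; it exists because $g_k^m$ is of class $\mathcal{C}^2$ and vanishes when $x_k\in\{-1,1\}$. Set $f_k(x)=(f_k^1(x),\ldots,f_k^M(x))\in\mathbb{R}^M$, with $\cdot$ and $\|\cdot\|$ the Euclidean inner product and norm. For $p\in\mathbb{N}$, $\beta\in(0,\infty)$ and $\Phi$ of class $\mathcal{C}^p$,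 $$\|\Phi\|_{p,\beta}=\sum_{|\alpha|\le p}\ \sup_{s\ge 0,\gamma\in\mathbb{R},y\in[-1,1]}e^{-\beta(s+|\gamma|)}\left|\partial_s^{\alpha_s}\partial_\gamma^{\alpha_\gamma}\partial_y^{\alpha_y}\Phi(s,\gamma,y)\right|\in[0,\infty],$$ where $\alpha=(\alpha_s,\alpha_\gamma,\alpha_y)\in\mathbb{N}_0^3$, $|\alpha|=\alpha_s+\alpha_\gamma+\alpha_y$. The constant $C(T)$ does not depend on $N$. *)

(* Defs.v *)
From HB Require Import structures.
From mathcomp Require Import all_boot all_order all_algebra.
From mathcomp Require Import all_classical all_reals all_analysis.

Set Implicit Arguments.
Unset Strict Implicit.
Unset Printing Implicit Defensive.

Import Order.TTheory GRing.Theory Num.Theory.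
Import numFieldNormedType.Exports.

Local Open Scope classical_set_scope.
Local Open Scope ring_scope.

(* The canonical norm of 'rV_n is the sup norm, hence the Euclidean one here. *)
Definition edot (R : realType) (n : nat) (u v : 'rV[R]_n) : R :=
  \sum_(i < n) u 0 i * v 0 i.

Definition enorm (R : realType) (n : nat) (u : 'rV[R]_n) : R :=
  Num.sqrt (edot u u).

(* Difference quotients of f at x in direction e_i, for increments that stay
   in A: derivatives are one-sided at boundary points of A, and the values of f
   outside A are irrelevant when x is in A. *)
Definition pquot (R : realType) (n : nat) (A : set 'rV[R]_n) (i : 'I_n)
    (f : 'rV[R]_n -> R) (x : 'rV[R]_n) : set_system R :=
  (fun h : R => h^-1 * (f (x + h *: delta_mx 0 i) - f x)) @
    within [set h : R | A (x + h *: delta_mx 0 i)] (0 : R)^'.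

Definition pderiv (R : realType) (n : nat) (A : set 'rV[R]_n) (i : 'I_n)
    (f : 'rV[R]_n -> R) : 'rV[R]_n -> R :=
  fun x => lim (pquot A i f x).

Fixpoint class_C (R : realType) (n p : nat) (A : set 'rV[R]_n)
    (f : 'rV[R]_n -> R) : Prop :=
  {within A, continuous f} /\
  if p is q.+1 then
    forall i : 'I_n,
      (forall x, A x -> cvg (pquot A i f x)) /\ class_C q A (pderiv A i f)
  else True.

Definition cube (R : realType) (d : nat) : set 'rV[R]_d :=
  [set x | forall k, -1 <= x 0 k <= 1].

Definition sigma (R : realType) (y : R) : R := (y - 1) * (y + 1).

Definition vec3 (R : realType) (s gamma y : R) : 'rV[R]_3 :=
  \row_(i < 3) [:: s; gamma; y]`_i.

Definition uncurry3 (R : realType) (Phi : R -> R -> R -> R) (v : 'rV[R]_3) : R :=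
  Phi (v 0 0) (v 0 1) (v 0 2).

Definition int_dom (R : realType) : set 'rV[R]_3 :=
  [set v | 0 <= v 0 0 /\ -1 <= v 0 2 <= 1].

Definition dPhi (R : realType) (Phi : R -> R -> R -> R) (a b c : nat)
    (s gamma y : R) : R :=
  iter a (pderiv (@int_dom R) 0)
    (iter b (pderiv (@int_dom R) 1)
      (iter c (pderiv (@int_dom R) 2) (uncurry3 Phi))) (vec3 s gamma y).

Definition norm_p_beta (R : realType) (p : nat) (beta : R)
    (Phi : R -> R -> R -> R) : \bar R :=
  (\sum_(a < p.+1) \sum_(b < p.+1) \sum_(c < p.+1 | (a + b + c <= p)%N)
    ereal_sup [set u : \bar R | exists s gamma y : R,
      [/\ (0 <= s)%R, (-1 <= y <= 1)%R &
       u = (expR (- beta * (s + `|gamma|)) * `|dPhi Phi a b c s gamma y|)%:E]])%E.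

(* Time is [0, +oo[: filtrations and processes are indexed by R, and their
   values at negative times are never used. *)
Definition filtration (R : realType) (disp : measure_display)
    (Omega : measurableType disp) (F : R -> set (set Omega)) : Prop :=
  (forall t, 0 <= t -> sigma_algebra [set: Omega] (F t) /\
                       F t `<=` measurable) /\
  (forall s t, 0 <= s -> s <= t -> F s `<=` F t).

Definition sigma_measurable (R : realType) (Omega : Type)
    (G : set (set Omega)) (Y : Omega -> R) : Prop :=
  forall U : set R, measurable U -> G (Y @^-1` U).

(* Standard Brownian motion with respect to F. The last clause says that
   B(t) - B(s) is independent of F s with law N(0, (t - s) I_M). *)
Definition brownian_motion (R : realType) (disp : measure_display)
    (Omega : measurableType disp) (P : probability Omega R)
    (F : R -> set (set Omega)) (M : nat) (B : 'I_M -> R -> Omega -> R) : Prop :=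
  [/\ forall m t, 0 <= t -> sigma_measurable (F t) (B m t),
      {ae P, forall w, forall m, B m 0 w = 0},
      {ae P, forall w, forall m,
         {within `[0, +oo[, continuous (fun t => B m t w)}} &
      forall (s t : R) (A : set Omega) (U : 'I_M -> set R),
        0 <= s -> s < t -> F s A -> (forall m, measurable (U m)) ->
        P (A `&` [set w | forall m, U m (B m t w - B m s w)]) =
        (P A * \prod_(m < M) normal_prob 0 (Num.sqrt (t - s)) (U m))%E].

(* The elementary process r |-> \sum_(j < ep_size) ep_coef j 1_(]s_j, s_(j+1)])
   where s_j = ep_node j *)
Record eprocess (R : realType) (Omega : Type) := EProcess {
  ep_size : nat;
  ep_node : nat -> R;
  ep_coef : nat -> Omega -> R }.

Definition elementary (R : realType) (Omega : Type) (F : R -> set (set Omega))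
    (t : R) (e : eprocess R Omega) : Prop :=
  [/\ ep_node e 0 = 0, ep_node e (ep_size e) = t,
      forall j, (j < ep_size e)%N -> ep_node e j <= ep_node e j.+1,
      forall j, (j < ep_size e)%N ->
        sigma_measurable (F (ep_node e j)) (ep_coef e j) &
      exists K : R, forall j w, (j < ep_size e)%N -> `|ep_coef e j w| <= K].

Definition ep_val (R : realType) (Omega : Type) (e : eprocess R Omega)
    (r : R) (w : Omega) : R :=
  \sum_(j < ep_size e)
    ep_coef e j w * \1_(`]ep_node e j, ep_node e j.+1]) r.

Definition ep_int (R : realType) (Omega : Type) (e : eprocess R Omega)
    (b : R -> Omega -> R) (w : Omega) : R :=
  \sum_(j < ep_size e)
    ep_coef e j w * (b (ep_node e j.+1) w - b (ep_node e j) w).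

Definition L2_process_norm2 (R : realType) (disp : measure_display)
    (Omega : measurableType disp) (P : probability Omega R) (t : R)
    (H : R -> Omega -> R) : \bar R :=
  (\int[P]_w \int[lebesgue_measure]_(r in `[0%R, t]) ((H r w) ^+ 2)%:E)%E.

Definition ito_integrand (R : realType) (disp : measure_display)
    (Omega : measurableType disp) (P : probability Omega R)
    (F : R -> set (set Omega)) (t : R) (H : R -> Omega -> R) : Prop :=
  [/\ measurable_fun (`[0, t] `*` [set: Omega])
        (fun rw : measurableTypeR R * Omega => H rw.1 rw.2),
      forall r, 0 <= r <= t -> sigma_measurable (F r) (H r) &
      (L2_process_norm2 P t H < +oo)%E].

(* I is (a version of) \int_0^t H db, for a real F-Brownian motion b: the limit
   in L^2 of the integrals of elementary processes converging to H. *)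
Definition ito_integral (R : realType) (disp : measure_display)
    (Omega : measurableType disp) (P : probability Omega R)
    (F : R -> set (set Omega)) (b : R -> Omega -> R) (t : R)
    (H : R -> Omega -> R) (I : Omega -> R) : Prop :=
  [/\ ito_integrand P F t H, measurable_fun [set: Omega] I &
      exists e : nat -> eprocess R Omega,
        [/\ forall n, elementary F t (e n),
            (fun n => L2_process_norm2 P t (fun r w => ep_val (e n) r w - H r w))
              @ \oo --> 0%E &
            (fun n => 'E_P[fun w => ((ep_int (e n) b w - I w) ^+ 2)%R])%E
              @ \oo --> 0%E]].

(* g (drift: index 0) is only meaningful on the cube. A solution lives there
   almost surely; the indicator makes g(X) independent of the values of g
   outside the cube. *)
Definition coef_process (R : realType) (Omega : Type) (d : nat)
    (gm : 'rV[R]_d -> 'rV[R]_d) (X : R -> Omega -> 'rV[R]_d) (k : 'I_d)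
    (r : R) (w : Omega) : R :=
  \1_(@cube R d) (X r w) * gm (X r w) 0 k.

Definition sde_solution (R : realType) (disp : measure_display)
    (Omega : measurableType disp) (P : probability Omega R)
    (F : R -> set (set Omega)) (d M : nat) (B : 'I_M -> R -> Omega -> R)
    (g : 'I_M.+1 -> 'rV[R]_d -> 'rV[R]_d) (x0 : 'rV[R]_d)
    (X : R -> Omega -> 'rV[R]_d) : Prop :=
  [/\ forall k t, 0 <= t -> sigma_measurable (F t) (fun w => X t w 0 k),
      {ae P, forall w, {within `[0, +oo[, continuous (fun t => X t w)}},
      {ae P, forall w, forall t, 0 <= t -> @cube R d (X t w)},
      {ae P, forall w, X 0 w = x0} &
      forall (t : R) (k : 'I_d), 0 <= t ->
        exists I : 'I_M -> Omega -> R,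
          (forall m, ito_integral P F (B m) t
                       (coef_process (g (lift ord0 m)) X k) (I m)) /\
          {ae P, forall w,
             X t w 0 k = x0 0 k
               + \int[lebesgue_measure]_(r in `[0, t])
                   coef_process (g ord0) X k r w
               + \sum_(m < M) I m w}].

Fixpoint scheme (R : realType) (Omega : Type) (d M : nat)
    (Phi : R -> R -> R -> R) (f : 'I_M.+1 -> 'rV[R]_d -> 'rV[R]_d)
    (B : 'I_M -> R -> Omega -> R) (x0 : 'rV[R]_d) (tau : R) (n : nat)
    (w : Omega) : 'rV[R]_d :=
  if n is n'.+1 then
    let x := scheme Phi f B x0 tau n' w in
    let dB : 'rV[R]_M :=
      \row_(m < M) (B m (n'.+1%:R * tau) w - B m (n'%:R * tau) w) in
    \row_(k < d)
      let fk : 'rV[R]_M := \row_(m < M) f (lift ord0 m) x 0 k in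
      Phi (enorm fk ^+ 2 * tau) (edot fk dB + f ord0 x 0 k * tau) (x 0 k)
  else x0.

(* Main.v *)
(* Both the scheme and the solution satisfy, over one step ]s, t] of length tau,
     Y_t - Y_s = g^0(Y_s) tau + sum_m g^m(Y_s) (B^m_t - B^m_s) + D + J
   with E D^2 = O(tau^3), E J^2 = O(tau^2) and J orthogonal to the bounded
   F_s-measurable variables. For the scheme this is the Taylor expansion of Phi:
   the condition on Phi leaves J = (q/2) ((f . dB)^2 - |f|^2 tau), q being the
   second gamma-derivative of Phi at (0, 0, .), and D collects the third-order
   terms, whose exponential factor is integrable against Gaussian increments.
   For the solution, D and J come from freezing the coefficients at time s in
   the drift and in the Ito integrals. Subtracting, the error over one step is
   e + V + W with E(e V) = 0, so that Young's inequality with weight tau gives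
   E|e'|^2 <= (1 + K tau) E|e|^2 + K tau^2, and the discrete Gronwall lemma
   concludes. *)
Require Import Defs.
From HB Require Import structures.
From mathcomp Require Import all_boot all_order all_algebra.
From mathcomp Require Import all_classical all_reals all_analysis.
From mathcomp Require Import measurable_realfun ring lra.

Set Implicit Arguments.
Unset Strict Implicit.
Unset Printing Implicit Defensive.

Import Order.TTheory GRing.Theory Num.Theory.
Import numFieldNormedType.Exports.

Local Open Scope classical_set_scope.
Local Open Scope ring_scope.

(** * Square-integrable random variables *)

(** No conditional expectation is formed. That one vanishes is expressed by testing: the product
    with every bounded [F s]-measurable variable has mean 0. Such products are reduced to indicators
    of events of [F s], to which the independence clause of Brownian motion applies directly. Two
    features of the data shape the rest. An Ito integral is a separate L^2 limit for each final
    time, so the integrals up to s and up to t come from unrelated elementary processes; increments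
    are therefore approximated by finite families of possibly overlapping intervals, for which the
    isometry is a quadratic form in the lengths of the intersections. Moreover f is only continuous,
    so nothing Lipschitz can be asked of it: the scheme is expanded in terms of f through its
    continuity and bounds, and sigma f = g is substituted in the first-order part before two
    trajectories are compared, which leaves Lipschitz estimates on g alone. *)

Lemma sqr_sum_le (R : realType) (n : nat) (x : 'I_n -> R) :
  (\sum_i x i) ^+ 2 <= n%:R * \sum_i x i ^+ 2.
Proof.
have : 0 <= \sum_i \sum_j (x i - x j) ^+ 2.
  by apply: sumr_ge0 => i _; apply: sumr_ge0 => j _; exact: sqr_ge0.
have -> : \sum_i \sum_j (x i - x j) ^+ 2 =
    2 * (n%:R * (\sum_i x i ^+ 2)) - 2 * (\sum_i x i) ^+ 2.
  transitivity (\sum_i \sum_j (x i ^+ 2 + x j ^+ 2 - 2 * (x i * x j))).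
    by apply: eq_bigr => i _; apply: eq_bigr => j _; ring.
  under eq_bigr do rewrite sumrB big_split/= sumr_const card_ord -mulr_sumr -mulr_sumr.
  rewrite sumrB big_split/= sumr_const card_ord -mulr_sumr -mulr_suml.
  rewrite sumrMnl -mulr_natl -[X in _ + X - _]mulr_natl.
  by set a := \sum_i _; set b := \sum_i _; ring.
by set a := n%:R * _; set b := _ ^+ 2; lra.
Qed.

Section expectation.
Context d (T : measurableType d) (R : realType) (P : probability T R).
Implicit Types X Y Z : T -> R.

Definition int1 X := P.-integrable setT (EFin \o X).

Definition sq_int X := measurable_fun setT X /\ int1 (fun w => X w ^+ 2).

(** The finite part of an extended integral, hence 0 for a nonnegative variable of infinite mean;
    bounds on [Ex] therefore travel with integrability. *)
Definition Ex X := (\int[P]_w X w)%R.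

Lemma int1_measurable X : int1 X -> measurable_fun setT X.
Proof. by move=> /measurable_int /measurable_EFinP. Qed.

Lemma int1D X Y : int1 X -> int1 Y -> int1 (fun w => X w + Y w).
Proof. by move=> iX iY; exact: (integrableD measurableT iX iY). Qed.

Lemma int1B X Y : int1 X -> int1 Y -> int1 (fun w => X w - Y w).
Proof. by move=> iX iY; exact: (integrableB measurableT iX iY). Qed.

Lemma int1Z k X : int1 X -> int1 (fun w => k * X w).
Proof. by move=> iX; exact: (integrableZl measurableT k iX). Qed.

Lemma int1_le X Y : measurable_fun setT X -> (forall w, `|X w| <= Y w) ->
  int1 Y -> int1 X.
Proof.
move=> mX XY; apply: le_integrable => //; first exact/measurable_EFinP.
by move=> w _; rewrite /= lee_fin (le_trans (XY w))// ler_norm.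
Qed.

Lemma int1_cst k : int1 (fun=> k).
Proof. exact: finite_measure_integrable_cst. Qed.

Lemma int1_bnd X k : measurable_fun setT X -> (forall w, `|X w| <= k) -> int1 X.
Proof. by move=> mX Xk; exact: int1_le mX Xk (int1_cst k). Qed.

Lemma int1_norm X : int1 X -> int1 (fun w => `|X w|).
Proof. by move=> iX; exact: (integrable_norm iX). Qed.

Lemma int1_sum (I : Type) (s : seq I) (Q : pred I) (h : I -> T -> R) :
  (forall i, Q i -> int1 (h i)) -> int1 (fun w => \sum_(i <- s | Q i) h i w).
Proof.
move=> ih; have := @integrable_sum _ _ _ P _ measurableT _ s Q (fun i => EFin \o h i) ih.
by rewrite /int1; congr integrable; apply/funext => w /=; rewrite sumEFin.
Qed.

Lemma ExD X Y : int1 X -> int1 Y -> Ex (fun w => X w + Y w) = Ex X + Ex Y.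
Proof. by move=> iX iY; rewrite /Ex RintegralD. Qed.

Lemma ExB X Y : int1 X -> int1 Y -> Ex (fun w => X w - Y w) = Ex X - Ex Y.
Proof. by move=> iX iY; rewrite /Ex RintegralB. Qed.

Lemma ExZ k X : int1 X -> Ex (fun w => k * X w) = k * Ex X.
Proof. by move=> iX; rewrite /Ex RintegralZl. Qed.

Lemma Ex_cst k : Ex (fun=> k) = k.
Proof. by rewrite /Ex Rintegral_cst//= [P _]probability_setT mulr1. Qed.

Lemma Ex_sum (I : Type) (s : seq I) (Q : pred I) (h : I -> T -> R) :
  (forall i, Q i -> int1 (h i)) ->
  Ex (fun w => \sum_(i <- s | Q i) h i w) = \sum_(i <- s | Q i) Ex (h i).
Proof.
move=> ih; elim: s => [|i s IH].
  by rewrite big_nil -[RHS](Ex_cst 0); congr Ex; apply/funext => w; rewrite big_nil.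
rewrite big_cons; have [Qi|Qi] := boolP (Q i).
  rewrite -IH -ExD; [|exact: ih|exact: int1_sum].
  by congr Ex; apply/funext => w; rewrite big_cons Qi.
by rewrite -IH; congr Ex; apply/funext => w; rewrite big_cons (negbTE Qi).
Qed.

Lemma le_Ex X Y : int1 X -> int1 Y -> (forall w, X w <= Y w) -> Ex X <= Ex Y.
Proof. by move=> iX iY XY; apply: le_Rintegral. Qed.

Lemma Ex_ge0 X : (forall w, 0 <= X w) -> 0 <= Ex X.
Proof. by move=> X0; exact: Rintegral_ge0. Qed.

Lemma le_norm_Ex X : int1 X -> `|Ex X| <= Ex (fun w => `|X w|).
Proof. by move=> iX; exact: le_normr_Rintegral. Qed.

Lemma Ex_ae X Y : measurable_fun setT X -> measurable_fun setT Y ->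
  {ae P, forall w, X w = Y w} -> Ex X = Ex Y.
Proof.
move=> mX mY XY; congr fine; apply: ae_eq_integral => //; try exact/measurable_EFinP.
by apply: filterS XY => w /= ->.
Qed.

Lemma EFin_Ex X : int1 X -> (Ex X)%:E = (\int[P]_w (X w)%:E)%E.
Proof. by move=> iX; rewrite /Ex /Rintegral fineK//; exact: integrable_fin_num. Qed.

Lemma sq_int_measurable X : sq_int X -> measurable_fun setT X.
Proof. by case. Qed.

Lemma sq_int_bnd X k : measurable_fun setT X -> (forall w, `|X w| <= k) -> sq_int X.
Proof.
move=> mX Xk; split => //; apply: (@int1_bnd _ (k ^+ 2)).
  exact: measurable_funX.
by move=> w; rewrite normrX lerXn2r// ?nnegrE// (le_trans _ (Xk w)).
Qed.

Lemma sq_intM X Y : sq_int X -> sq_int Y -> int1 (fun w => X w * Y w).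
Proof.
move=> [mX iX] [mY iY]; apply: int1_le (int1D iX iY); first exact: measurable_funM.
move=> w; rewrite ler_norml; apply/andP; split.
  have := sqr_ge0 (X w + Y w); have := sqr_ge0 (X w); have := sqr_ge0 (Y w); nra.
have := sqr_ge0 (X w - Y w); have := sqr_ge0 (X w); have := sqr_ge0 (Y w); nra.
Qed.

Lemma sq_int_int1 X : sq_int X -> int1 X.
Proof.
move=> sX; have sc : sq_int (fun=> 1) by apply: (@sq_int_bnd _ 1) => // w; rewrite normr1.
by have := sq_intM sX sc; congr int1; apply/funext => w; rewrite mulr1.
Qed.

Lemma sq_intZ k X : sq_int X -> sq_int (fun w => k * X w).
Proof.
move=> [mX iX]; split; first exact: measurable_funM.
by have := int1Z (k ^+ 2) iX; congr int1; apply/funext => w; rewrite exprMn.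
Qed.

Lemma sq_intD X Y : sq_int X -> sq_int Y -> sq_int (fun w => X w + Y w).
Proof.
move=> sX sY; split; first by apply: measurable_funD; [case: sX|case: sY].
have := int1D (int1D sX.2 sY.2) (int1Z 2 (sq_intM sX sY)).
by congr int1; apply/funext => w; ring.
Qed.

Lemma sq_intB X Y : sq_int X -> sq_int Y -> sq_int (fun w => X w - Y w).
Proof.
move=> sX sY; have := sq_intD sX (sq_intZ (-1) sY).
by congr sq_int; apply/funext => w; rewrite mulN1r.
Qed.

Lemma sq_int_sum (I : Type) (s : seq I) (Q : pred I) (h : I -> T -> R) :
  (forall i, Q i -> sq_int (h i)) -> sq_int (fun w => \sum_(i <- s | Q i) h i w).
Proof.
move=> ih; elim: s => [|i s IH].
  rewrite (_ : (fun _ => _) = fun=> 0); last by apply/funext => w; rewrite big_nil.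
  by apply: (@sq_int_bnd _ 0) => // w; rewrite normr0.
have [Qi|Qi] := boolP (Q i).
  rewrite (_ : (fun _ => _) = fun w => h i w + \sum_(j <- s | Q j) h j w).
    by apply: sq_intD => //; exact: ih.
  by apply/funext => w; rewrite big_cons Qi.
by move: IH; congr sq_int; apply/funext => w; rewrite big_cons (negbTE Qi).
Qed.

Lemma sq_int_Mbnd X Y k : measurable_fun setT X -> (forall w, `|X w| <= k) ->
  sq_int Y -> sq_int (fun w => X w * Y w).
Proof.
move=> mX Xk [mY iY]; split; first exact: measurable_funM.
apply: int1_le (int1Z (k ^+ 2) iY).
  by apply: measurable_funX; exact: measurable_funM.
move=> w; rewrite normrX normrM exprMn -[Y w ^+ 2]real_normK ?num_real//.
by apply: ler_wpM2r; rewrite ?sqr_ge0// lerXn2r// ?nnegrE// (le_trans _ (Xk w)).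
Qed.

Lemma int1_Mbnd X Y k : measurable_fun setT X -> (forall w, `|X w| <= k) ->
  int1 Y -> int1 (fun w => X w * Y w).
Proof.
move=> mX Xk iY; apply: int1_le (int1Z k (int1_norm iY)).
  by apply: measurable_funM => //; exact: int1_measurable.
by move=> w; rewrite normrM ler_wpM2r.
Qed.

(** The limits that define Ito integrals are taken in the extended reals; a finite bound there
    yields square-integrability along with the real inequality. *)
Lemma sq_int_lt X (e : R) : measurable_fun setT X ->
  (\int[P]_w (X w ^+ 2)%:E < e%:E)%E -> sq_int X /\ Ex (fun w => X w ^+ 2) < e.
Proof.
move=> mX Xe; have iX : int1 (fun w => X w ^+ 2).
  apply/integrableP; split; first by apply/measurable_EFinP; exact: measurable_funX.
  under eq_integral do rewrite /= ger0_norm ?sqr_ge0//.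
  by rewrite (lt_trans Xe) ?ltry.
by split=> //; rewrite -lte_fin EFin_Ex.
Qed.

(** Young's inequality, from the square of e|X| - |Y| divided by e. When the second moment of Y is
    of order e^2 the right-hand side is of order e, which gives orthogonality in the limit. *)
Lemma Ex_AMGM X Y (e : R) : 0 < e -> sq_int X -> sq_int Y ->
  `|Ex (fun w => X w * Y w)| <= e * Ex (fun w => X w ^+ 2) + e^-1 * Ex (fun w => Y w ^+ 2).
Proof.
move=> e0 sX sY; apply: (le_trans (le_norm_Ex (sq_intM sX sY))).
rewrite -!ExZ -?ExD; [|by apply: int1Z; case: sX|by apply: int1Z; case: sY|by case: sY|by case: sX].
apply: le_Ex; [exact/int1_norm/sq_intM| |].
  by apply: int1D; apply: int1Z; [case: sX|case: sY].
move=> w; rewrite normrM.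
have := sqr_ge0 (e * `|X w| - `|Y w|).
rewrite -[X w ^+ 2]real_normK ?num_real// -[Y w ^+ 2]real_normK ?num_real//.
set x := `|X w|; set y := `|Y w| => h.
have x0 : 0 <= x by exact: normr_ge0.
have y0 : 0 <= y by exact: normr_ge0.
rewrite -(ler_pM2l e0) mulrDr mulrA mulrA mulVKf ?gt_eqF// -expr2.
have := mulr_ge0 (ltW e0) (mulr_ge0 x0 y0).
by nra.
Qed.

Lemma Ex_sqrD X Y : sq_int X -> sq_int Y ->
  Ex (fun w => (X w + Y w) ^+ 2) <= 2 * Ex (fun w => X w ^+ 2) + 2 * Ex (fun w => Y w ^+ 2).
Proof.
move=> sX sY; rewrite -!ExZ -?ExD; [|by apply: int1Z; case: sX|by apply: int1Z; case: sY|by case: sY|by case: sX].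
apply: le_Ex; first by case: (sq_intD sX sY).
  by apply: int1D; apply: int1Z; [case: sX|case: sY].
by move=> w; have := sqr_ge0 (X w - Y w); nra.
Qed.

Lemma Ex_sqrB X Y : sq_int X -> sq_int Y ->
  Ex (fun w => (X w - Y w) ^+ 2) <= 2 * Ex (fun w => X w ^+ 2) + 2 * Ex (fun w => Y w ^+ 2).
Proof.
move=> X2 Y2; have := Ex_sqrD X2 (sq_intZ (-1) Y2).
rewrite (_ : (fun w => (X w + _) ^+ 2) = fun w => (X w - Y w) ^+ 2).
  by rewrite (_ : (fun w => (-1 * Y w) ^+ 2) = fun w => Y w ^+ 2)//; apply/funext => w; ring.
by apply/funext => w; rewrite mulN1r.
Qed.

Lemma Ex_sqr_sum (n : nat) (h : 'I_n -> T -> R) : (forall i, sq_int (h i)) ->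
  Ex (fun w => (\sum_i h i w) ^+ 2) <= n%:R * \sum_i Ex (fun w => h i w ^+ 2).
Proof.
move=> sh; rewrite -Ex_sum => [|i _]; last by case: (sh i).
rewrite -ExZ; last by apply: int1_sum => i _; case: (sh i).
apply: le_Ex; first by case: (@sq_int_sum _ (index_enum 'I_n) predT h (fun i _ => sh i)).
  by apply: int1Z; apply: int1_sum => i _; case: (sh i).
by move=> w; exact: sqr_sum_le.
Qed.

End expectation.

(** * Orthogonality tested on indicators *)

Section mul_eq0.
Import HBSimple HBNNSimple.
Context d (T : measurableType d) (R : realType) (P : probability T R).
Local Notation Ex := (Ex P).
Local Notation int1 := (int1 P).

(** Replaces the vanishing of the conditional expectation of [W] given [xi]: simple functions of
    [xi] are combinations of the indicators in the hypothesis, and they increase to [xi] while their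
    products with [W] stay dominated by |xi W|. *)
Lemma Ex_mul_eq0_ge0 (xi W : T -> R) : measurable_fun setT xi -> (forall w, 0 <= xi w) ->
  int1 W -> int1 (fun w => xi w * W w) ->
  (forall V : set R, measurable V -> Ex (fun w => \1_V (xi w) * W w) = 0) ->
  Ex (fun w => xi w * W w) = 0.
Proof.
move=> mxi xi0 iW ixW H; have mW := int1_measurable iW.
(* The approximation by simple functions is made for a nonnegative function on the whole line, so
   |x| is approximated; it agrees with x on the values of [xi]. *)
have mid : measurable_fun setT (fun x : measurableTypeR R => (`|x|)%:E).
  by apply/measurable_EFinP; exact: normr_measurable.
pose g := nnsfun_approx measurableT mid.
have gx n w : g n (xi w) <= xi w.
  rewrite -lee_fin (nnsfun_approxE measurableT mid n) -[X in (_ <= X%:E)%E](ger0_norm (xi0 w)).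
  by apply: (@le_approx _ _ _ setT (fun x : measurableTypeR R => (`|x|)%:E)) => //= t _; rewrite lee_fin normr_ge0.
have mg n : measurable_fun setT (fun w => g n (xi w)).
  exact: (measurableT_comp (measurable_funPT (g n)) mxi).
have gn n : Ex (fun w => g n (xi w) * W w) = 0.
  have iV (V : set R) : measurable V -> int1 (fun w => \1_V (xi w) * W w).
    move=> mV; apply: (@int1_Mbnd _ _ _ _ _ _ 1) => //.
      by apply: measurableT_comp => //; exact: measurable_indic.
    by move=> w; rewrite indicE; case: (_ \in _); rewrite ?normr1 ?normr0.
  have [s gE] : exists s : seq R, forall x, g n x = \sum_(y <- s) y * \1_(g n @^-1` [set y]) x.
    by eexists => x; rewrite fimfunE fsbig_finite//=.
  rewrite (_ : (fun _ => _) =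
      fun w => \sum_(y <- s) y * (\1_(g n @^-1` [set y]) (xi w) * W w)).
    have mgV y : measurable (g n @^-1` [set y]) by exact: measurable_funPTI.
    rewrite Ex_sum => [|y _]; last exact: (int1Z _ (iV _ (mgV y))).
    by rewrite big1// => y _; rewrite ExZ ?(H _ (mgV y)) ?mulr0//; exact: (iV _ (mgV y)).
  by apply/funext => w; rewrite gE mulr_suml; apply: eq_bigr => y _; rewrite mulrA.
have [] := @dominated_convergence _ _ _ P setT measurableT
  (fun n w => (g n (xi w) * W w)%:E) (fun w => (xi w * W w)%:E) (fun w => (`|xi w * W w|)%:E).
- by move=> n; apply/measurable_EFinP; exact: measurable_funM.
- by apply/measurable_EFinP; exact: int1_measurable ixW.
- apply: aeW => w _; apply/fine_cvgP; split; first exact: nearW.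
  apply: cvgMl; have /fine_cvgP[_] := @cvg_nnsfun_approx _ _ _ _ measurableT _ mid (fun x _ => normr_ge0 x) (xi w) I.
  by rewrite /= ger0_norm.
- exact: int1_norm.
- apply: aeW => w n _; rewrite /= lee_fin !normrM ler_wpM2r// ger0_norm// ger0_norm//.
- move=> _ _; rewrite (_ : [sequence _]_n = fun=> 0%E).
    by move=> /cvg_lim h; rewrite /Ex /Rintegral -h// lim_cst.
  apply/funext => n /=; have := gn n; rewrite /Ex /Rintegral.
  rewrite -[X in _ -> X = _]fineK; first by move=> ->.
  apply: integrable_fin_num => //; apply: int1_le (int1_norm ixW).
    by exact: measurable_funM.
  by move=> w; rewrite !normrM ler_wpM2r// ger0_norm// ger0_norm.
Qed.

(** Sets tested against the positive or the negative part of [xi] pull back to sets tested against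
    [xi], so both parts inherit the hypothesis. *)
Lemma Ex_mul_eq0 (xi W : T -> R) : measurable_fun setT xi ->
  int1 W -> int1 (fun w => xi w * W w) ->
  (forall V : set R, measurable V -> Ex (fun w => \1_V (xi w) * W w) = 0) ->
  Ex (fun w => xi w * W w) = 0.
Proof.
move=> mxi iW ixW H.
have mW := int1_measurable iW.
pose p w := Num.max (xi w) 0; pose q w := Num.max (- xi w) 0.
have mp : measurable_fun setT p by apply: measurable_maxr.
have mq : measurable_fun setT q by apply: measurable_maxr => //; exact: measurableT_comp.
have pq w : xi w = p w - q w.
  by rewrite /p /q; case: (leP (xi w) 0) => h; case: (leP (- xi w) 0) => h'; lra.
have p0 w : 0 <= p w by rewrite le_max lexx orbT.
have q0 w : 0 <= q w by rewrite le_max lexx orbT.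
have px w : `|p w| <= `|xi w|.
  by rewrite ger0_norm// /p; case: (leP (xi w) 0) => // h; exact: ler_norm.
have qx w : `|q w| <= `|xi w|.
  by rewrite ger0_norm// /q; case: (leP (- xi w) 0) => // h; rewrite -normrN ler_norm.
have ip : int1 (fun w => p w * W w).
  by apply: int1_le (int1_norm ixW) => [|w]; [exact: measurable_funM|rewrite !normrM ler_wpM2r].
have iq : int1 (fun w => q w * W w).
  by apply: int1_le (int1_norm ixW) => [|w]; [exact: measurable_funM|rewrite !normrM ler_wpM2r].
transitivity (Ex (fun w => p w * W w - q w * W w)).
  by congr Ex; apply/funext => w; rewrite pq mulrBl.
rewrite ExB// !Ex_mul_eq0_ge0 ?subr0// => V mV.
- have mV' : measurable ((fun x : R => Num.max (- x) 0) @^-1` V).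
    have mN : measurable_fun setT (fun x : R => Num.max (- x) 0).
      by apply: measurable_maxr => //; exact: oppr_measurable.
    by rewrite -[X in measurable X]setTI; exact: mN.
  by have := H _ mV'; congr (_ = _); congr Ex; apply/funext => w.
- have mV' : measurable ((fun x : R => Num.max x 0) @^-1` V).
    have mN : measurable_fun setT (fun x : R => Num.max x 0) by exact: measurable_maxr.
    by rewrite -[X in measurable X]setTI; exact: mN.
  by have := H _ mV'; congr (_ = _); congr Ex; apply/funext => w.
Qed.

End mul_eq0.

(** * Taylor expansion on the line *)

Section taylor.
Variable R : realType.
Implicit Types f df : R -> R.

Lemma MVT_0 f df (x : R) : (forall t : R, is_derive t 1 f (df t)) ->
  exists2 c, `|c| <= `|x| & f x - f 0 = df c * x.
Proof.
move=> fdf; have cf : continuous f.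
  by move=> t; apply: differentiable_continuous; apply/derivable1_diffP; case: (fdf t).
have [x0|x0|->] := ltgtP x 0; last by exists 0; rewrite ?subrr ?mulr0.
- have [|c /itvP cx E] := MVT x0 (fun t _ => fdf t); first exact: continuous_subspaceT.
  exists c; last by move: E; rewrite -(opprB (f x)) sub0r; lra.
  by rewrite !ler0_norm ?lerN2 ?cx// ltW ?cx.
- have [|c /itvP cx E] := MVT x0 (fun t _ => fdf t); first exact: continuous_subspaceT.
  by exists c; [rewrite !ger0_norm ?cx// ltW ?cx|rewrite E subr0].
Qed.

(** Iterating the mean value theorem instead of integrating gives up the factor 1/(n+1); the
    third-order remainder below thus has the constant K rather than K/6. *)
Lemma iterated_MVT_bound f df (x K : R) n : 0 <= K -> (forall t : R, is_derive t 1 f (df t)) ->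
  f 0 = 0 -> (forall t, `|t| <= `|x| -> `|df t| <= K * `|t| ^+ n) ->
  forall t, `|t| <= `|x| -> `|f t| <= K * `|t| ^+ n.+1.
Proof.
move=> K0 fdf f0 dfK t tx; have [c ct] := MVT_0 t fdf; rewrite f0 subr0 => ->.
rewrite normrM exprSr mulrA ler_wpM2r//.
apply: (le_trans (dfK c (le_trans ct tx))).
by rewrite ler_wpM2l// lerXn2r ?nnegrE.
Qed.

Lemma taylor3 f f1 f2 f3 (x K : R) :
  (forall t : R, is_derive t 1 f (f1 t)) -> (forall t : R, is_derive t 1 f1 (f2 t)) ->
  (forall t : R, is_derive t 1 f2 (f3 t)) -> (forall t, `|t| <= `|x| -> `|f3 t| <= K) ->
  `|f x - f 0 - x * f1 0 - x ^+ 2 / 2 * f2 0| <= K * `|x| ^+ 3.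
Proof.
move=> d1 d2 d3 fK.
have K0 : 0 <= K by rewrite (le_trans _ (fK 0 _)) ?normr0.
have e2 (t : R) : is_derive t 1 (fun y => f2 y - f2 0) (f3 t).
  by apply: is_derive_eq; rewrite subr0.
have e1 (t : R) : is_derive t 1 (fun y => f1 y - f1 0 - y * f2 0) (f2 t - f2 0).
  by apply: is_derive_eq; rewrite !scaler0 /GRing.scale/=; lra.
have e0 (t : R) : is_derive t 1 (fun y => f y - f 0 - y * f1 0 - y ^+ 2 / 2 * f2 0) (f1 t - f1 0 - t * f2 0).
  by apply: is_derive_eq; rewrite !scaler0 /GRing.scale/=; lra.
apply: (iterated_MVT_bound K0 e0) => //; first by ring.
apply: (iterated_MVT_bound K0 e1) => //; first by ring.
apply: (iterated_MVT_bound K0 e2) => //; first by ring.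
by move=> t tx; rewrite expr0 mulr1; exact: fK.
Qed.

Lemma expR_taylor3 (y : R) : `|expR y - 1 - y - y ^+ 2 / 2| <= `|y| ^+ 3 * expR `|y|.
Proof.
have dE (t : R) : is_derive t 1 expR (expR t) by exact: is_derive_expR.
have bE t : `|t| <= `|y| -> `|expR t| <= expR `|y|.
  by move=> ty; rewrite ger0_norm ?expR_ge0// ler_expR (le_trans _ ty)// ler_norm.
by have := taylor3 dE dE dE bE; rewrite expR0 !mulr1 [X in _ <= X]mulrC.
Qed.

End taylor.

(** * Gaussian integrals and moments *)

Section gaussian.
Variables (R : realType) (s : R).
Hypothesis s0 : 0 < s.
Local Notation N := (normal_prob 0 s).
Local Notation mu := (@lebesgue_measure R).
Local Notation Ex := (Ex N).
Local Notation int1 := (int1 N).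

(** The Radon-Nikodym derivative of the Gaussian law agrees almost everywhere with the explicit
    density, because both have the same integral over every measurable set. *)
Lemma ge0_integral_normal_prob (m : R) (f : R -> \bar R) : measurable_fun setT f ->
  (forall x, (0 <= f x)%E) ->
  (\int[normal_prob m s]_x f x = \int[mu]_x (f x * (normal_pdf m s x)%:E))%E.
Proof.
move=> mf f0; have dom := normal_prob_dominates m s.
rewrite -(Radon_Nikodym_SigmaFinite.change_of_variables dom)//.
apply: ae_eq_integral => //.
- apply: emeasurable_funM => //; apply: (measurable_int mu).
  exact: Radon_Nikodym_SigmaFinite.f_integrable.
- apply: emeasurable_funM => //=; apply/measurable_EFinP; exact: measurable_normal_pdf.
- apply: ae_eqe_mul2l => /=; apply: integral_ae_eq => //=.
  + exact: Radon_Nikodym_SigmaFinite.f_integrable.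
  + by apply/measurable_EFinP; exact: measurable_normal_pdf.
  + by move=> E _ mE; rewrite -Radon_Nikodym_SigmaFinite.f_integral.
Qed.

Lemma integral_normal_expR (c : R) :
  (\int[N]_x (expR (c * x))%:E = (expR (c ^+ 2 * s ^+ 2 / 2))%:E)%E.
Proof.
have mf : measurable_fun setT (fun x : R => expR (c * x)).
  by apply: measurableT_comp => //; exact: measurable_funM.
rewrite ge0_integral_normal_prob; [|exact/measurable_EFinP|by move=> x; rewrite lee_fin expR_ge0].
(* Completing the square: the exponential weight moves the centre of the density from 0 to
   [c * s ^+ 2]. *)
rewrite (_ : (fun x => _) = fun x =>
    ((expR (c ^+ 2 * s ^+ 2 / 2))%:E * (normal_pdf (c * s ^+ 2) s x)%:E)%E).
  rewrite ge0_integralZl_EFin ?expR_ge0// ?integral_normal_pdf ?mule1//.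
  - by move=> x _; rewrite lee_fin normal_pdf_ge0.
  - by apply/measurable_EFinP; exact: measurable_normal_pdf.
apply/funext => x; rewrite -!EFinM !normal_pdfE ?gt_eqF// mulrCA [in RHS]mulrCA.
congr (_ * _)%:E; rewrite /normal_fun -!expRD; congr expR.
have sn0 : s != 0 by rewrite gt_eqF.
by field.
Qed.

Lemma int1_expR (c : R) : int1 (fun x => expR (c * x)).
Proof.
have mf : measurable_fun setT (fun x : R => expR (c * x)).
  by apply: measurableT_comp => //; exact: measurable_funM.
apply/integrableP; split; first exact/measurable_EFinP.
under eq_integral do rewrite /= ger0_norm ?expR_ge0//.
by rewrite integral_normal_expR ltry.
Qed.

Lemma Ex_expR (c : R) : Ex (fun x => expR (c * x)) = expR (c ^+ 2 * s ^+ 2 / 2).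
Proof. by rewrite /Ex /Rintegral integral_normal_expR. Qed.

Lemma expR_norm_le (c x : R) : 0 <= c -> expR (c * `|x|) <= expR (c * x) + expR (- c * x).
Proof.
move=> c0; have [x0|x0] := leP 0 x; first by rewrite ger0_norm// lerDl expR_ge0.
by rewrite ltr0_norm// mulrN mulNr lerDr expR_ge0.
Qed.

Lemma expr_le_expR (n : nat) (x : R) : 0 <= x -> x ^+ n <= n`!%:R * expR x.
Proof.
case: n => [|n] x0; first by rewrite expr0 fact0 mul1r -expR0 ler_expR.
rewrite mulrC -ler_pdivrMr ?ltr0n ?fact_gt0//.
by apply: le_trans (expR_ge1Dxn n x0); rewrite lerDr.
Qed.

Lemma int1_expR_norm (c : R) : int1 (fun x => expR (c * `|x|)).
Proof.
have mf (k : R) : measurable_fun setT (fun x : R => expR (k * x)).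
  by apply: measurableT_comp => //; exact: measurable_funM.
have [c0|/ltW c0] := leP 0 c; last first.
  apply: (@int1_bnd _ _ _ _ _ 1).
    by apply: (measurableT_comp (mf c)); exact: normr_measurable.
  by move=> x; rewrite ger0_norm ?expR_ge0// -expR0 ler_expR mulr_le0_ge0.
apply: int1_le (int1D (int1_expR c) (int1_expR (- c))).
  by apply: (measurableT_comp (mf c)); exact: normr_measurable.
by move=> x; rewrite ger0_norm ?expR_ge0//; exact: expR_norm_le.
Qed.

Lemma int1_poly_expR (n : nat) (c : R) : int1 (fun x => `|x| ^+ n * expR (c * `|x|)).
Proof.
have mn : measurable_fun setT (fun x : R => `|x|) by exact: normr_measurable.
apply: int1_le (int1Z n`!%:R (int1_expR_norm (c + 1))).
  apply: measurable_funM; first exact: measurable_funX.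
  by apply: measurableT_comp => //; exact: measurable_funM.
move=> x; rewrite normrM normrX normr_id (ger0_norm (expR_ge0 _)) mulrDl mul1r expRD.
by rewrite mulrCA mulrC ler_wpM2l ?expR_ge0 ?expr_le_expR.
Qed.

End gaussian.

Section gaussian_moments.
Variables (R : realType) (s : R).
Hypothesis s0 : 0 < s.
Local Notation N := (normal_prob 0 s).
Local Notation Ex := (Ex N).
Local Notation int1 := (int1 N).

Lemma le0_of_small (a K : R) : (forall c, 0 < c -> c <= 1 -> a <= c * K) -> a <= 0.
Proof.
move=> H; rewrite leNgt; apply/negP => a0.
have K0 : 0 < K by have := H 1 ltr01 (lexx _); rewrite mul1r => /(lt_le_trans a0).
pose c := Num.min 1 (a / (2 * K)).
have c0 : 0 < c by rewrite lt_min ltr01/= divr_gt0// mulr_gt0.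
have c1 : c <= 1 by rewrite ge_min lexx.
have cK : c <= a / (2 * K) by rewrite ge_min lexx orbT.
have := le_trans (H c c0 c1) (ler_wpM2r (ltW K0) cK).
have -> : a / (2 * K) * K = a / 2 by field; rewrite gt_eqF.
lra.
Qed.

Lemma int1_normal_id : int1 id.
Proof.
apply: int1_le (int1_poly_expR s0 1 0) => // x.
by rewrite mul0r expR0 mulr1 expr1.
Qed.

Lemma int1_normal_sqr : int1 (fun x => x ^+ 2).
Proof.
apply: int1_le (int1_poly_expR s0 2 0) => [|x]; first exact: measurable_funX.
by rewrite mul0r expR0 mulr1 normrX.
Qed.

Lemma expR_taylor3_scaled (c x : R) : 0 < c -> c <= 1 ->
  `|expR (c * x) - 1 - c * x - (c * x) ^+ 2 / 2| <= c ^+ 3 * (`|x| ^+ 3 * expR (1 * `|x|)).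
Proof.
move=> c0 c1; apply: (le_trans (expR_taylor3 _)).
rewrite normrM exprMn (gtr0_norm c0) -mulrA ler_wpM2l ?exprn_ge0 ?(ltW c0)//.
by rewrite ler_wpM2l ?exprn_ge0// ler_expR ler_wpM2r.
Qed.

(** Moments are read off exponential moments: [expR (c * x) - expR (- c * x)] has mean 0 and equals
    [2 * c * x] up to order c^3; dividing by c and letting it tend to 0 leaves 0. *)
Lemma Ex_normal_id : Ex id = 0.
Proof.
apply/eqP; rewrite -normr_le0.
pose h := fun x : R => `|x| ^+ 3 * expR (1 * `|x|) : R.
apply: (@le0_of_small _ (Ex h)) => c c0 c1; have ih : int1 h by exact: int1_poly_expR.
have iE := int1_expR s0.
have := @le_Ex _ _ _ N (fun x => `|(expR (c * x) - expR (- c * x)) - 2 * c * x|) (fun x => 2 * c ^+ 3 * h x).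
have i1 : int1 (fun x => expR (c * x) - expR (- c * x) - 2 * c * x).
  by apply: int1B; [exact: int1B|apply: int1Z; exact: int1_normal_id].
move=> /(_ (int1_norm i1) (int1Z _ ih)) H.
have {}H := le_trans (le_norm_Ex i1) (H _).
have : `|Ex (fun x : R => expR (c * x) - expR (- c * x) - 2 * c * x)| <= Ex (fun x => 2 * c ^+ 3 * h x).
  apply: H => x; have := expR_taylor3_scaled x c0 c1; have := expR_taylor3_scaled (- x) c0 c1.
  rewrite normrN -/(h x) mulNr mulrN sqrrN.
  set e1 := expR _; set e2 := expR (c * x); set t := (_ ^+ 2 / 2).
  rewrite !ler_norml => /andP[? ?] /andP[? ?]; apply/andP; split; lra.
rewrite ExZ// !ExB//; [|exact: int1B|apply: int1Z; exact: int1_normal_id].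
rewrite !(Ex_expR s0) sqrrN subrr sub0r normrN.
rewrite (ExZ (2 * c) int1_normal_id) normrM gtr0_norm ?mulr_gt0//.
rewrite exprS mulrA -[leRHS]mulrA ler_pM2l ?mulr_gt0// => /le_trans; apply.
apply: ler_wpM2r; first by apply: Ex_ge0 => x; rewrite mulr_ge0 ?expR_ge0 ?exprn_ge0.
by rewrite expr2 ler_piMr// ltW.
Qed.

(** Same device with the even part: [expR (c * x) + expR (- c * x) - 2] is [c ^+ 2 * x ^+ 2] up to
    order c^3, while its mean [2 * (expR (c ^+ 2 * s ^+ 2 / 2) - 1)] is [c ^+ 2 * s ^+ 2] to the
    same order. *)
Lemma Ex_normal_sqr : Ex (fun x => x ^+ 2) = s ^+ 2.
Proof.
apply/eqP; rewrite -subr_eq0 -normr_le0.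
pose h := fun x : R => `|x| ^+ 3 * expR (1 * `|x|) : R.
have ih : int1 h by exact: int1_poly_expR.
pose v := s ^+ 2 / 2.
have v0 : 0 <= v by rewrite divr_ge0 ?sqr_ge0.
apply: (@le0_of_small _ (2 * Ex h + v ^+ 2 + 2 * (v ^+ 3 * expR v))) => c c0 c1.
have iE := int1_expR s0.
have := @le_Ex _ _ _ N (fun x => `|(expR (c * x) + expR (- c * x)) - 2 - c ^+ 2 * x ^+ 2|) (fun x => 2 * c ^+ 3 * h x).
have i2 : int1 (fun x => expR (c * x) + expR (- c * x) - 2).
  by apply: int1B; [exact: int1D|exact: int1_cst].
have i1 : int1 (fun x => expR (c * x) + expR (- c * x) - 2 - c ^+ 2 * x ^+ 2).
  by apply: int1B => //; apply: int1Z; exact: int1_normal_sqr.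
move=> /(_ (int1_norm i1) (int1Z _ ih)) H.
have {}H := le_trans (le_norm_Ex i1) (H _).
have {H} : `|Ex (fun x : R => expR (c * x) + expR (- c * x) - 2 - c ^+ 2 * x ^+ 2)| <= Ex (fun x => 2 * c ^+ 3 * h x).
  apply: H => x; have := expR_taylor3_scaled x c0 c1; have := expR_taylor3_scaled (- x) c0 c1.
  rewrite normrN -/(h x) mulNr mulrN sqrrN.
  set e1 := expR _; set e2 := expR (c * x).
  have -> : c ^+ 2 * x ^+ 2 = 2 * ((c * x) ^+ 2 / 2) by field.
  set t := (_ ^+ 2 / 2).
  rewrite !ler_norml => /andP[? ?] /andP[? ?]; apply/andP; split; lra.
rewrite ExZ// !ExB//; [|exact: int1D|exact: int1_cst|by apply: int1Z; exact: int1_normal_sqr].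
rewrite ExD// !(Ex_expR s0) sqrrN Ex_cst (ExZ _ int1_normal_sqr).
have u1 : `|expR (c ^+ 2 * v) - 1 - c ^+ 2 * v - (c ^+ 2 * v) ^+ 2 / 2| <= c ^+ 3 * (v ^+ 3 * expR v).
  apply: (le_trans (expR_taylor3 _)).
  have cv0 : 0 <= c ^+ 2 * v by rewrite mulr_ge0 ?sqr_ge0.
  rewrite (ger0_norm cv0) exprMn -mulrA -exprM.
  have c2 : c ^+ 2 <= 1 by rewrite expr_le1// ltW.
  apply: ler_pM; rewrite ?mulr_ge0 ?exprn_ge0 ?expR_ge0 ?(ltW c0) ?(ltW s0)//.
    by rewrite ler_wiXn2l// ltW.
  by rewrite ler_wpM2l ?exprn_ge0// ler_expR ler_piMl.
have u2 : (c ^+ 2 * v) ^+ 2 <= c ^+ 3 * v ^+ 2.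
  by rewrite exprMn -exprM ler_wpM2r ?sqr_ge0// ler_wiXn2l// ltW.
have u3 : 0 <= (c ^+ 2 * v) ^+ 2 by exact: sqr_ge0.
have -> : c ^+ 2 * s ^+ 2 / 2 = c ^+ 2 * v by rewrite /v; field.
set V := Ex (fun x => x ^+ 2) => Hm.
have -> : V - s ^+ 2 = V - 2 * v by rewrite /v; field.
rewrite -(@ler_pM2l _ (c ^+ 2)) ?exprn_gt0// -{1}(gtr0_norm (exprn_gt0 2 c0)) -normrM.
rewrite (mulrA (c ^+ 2)) -exprSr.
move: u1 u2 u3 Hm; set e := expR _; set a := c ^+ 3; set b := (c ^+ 2 * v) ^+ 2.
set EH := Ex h; set q := v ^+ 3 * expR v; set cv := c ^+ 2 * v.
have -> : c ^+ 2 * (V - 2 * v) = c ^+ 2 * V - 2 * cv by rewrite /cv; ring.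
set cV := c ^+ 2 * V; rewrite !ler_norml => /andP[? ?] ? ? /andP[? ?].
by apply/andP; split; lra.
Qed.

(** Since |x|^n is at most n! s^n exp(|x|/s), the polynomial costs one more exponential, of rate
    1/s, and leaves the factor [s ^+ n]. The remaining constant depends on n and [c * s] only, hence
    is bounded for bounded s. *)
Lemma Ex_normal_poly_expR (n : nat) (c : R) : 0 <= c ->
  Ex (fun x => `|x| ^+ n * expR (c * `|x|)) <=
  n`!%:R * (2 * expR ((c * s + 1) ^+ 2 / 2)) * s ^+ n.
Proof.
move=> c0; have ic := int1_poly_expR s0 n c.
pose k := c + s^-1.
have k0 : 0 <= k by rewrite addr_ge0// invr_ge0 ltW.
have i1 := int1Z (n`!%:R * s ^+ n) (int1D (int1_expR s0 k) (int1_expR s0 (- k))).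
apply: (le_trans (le_Ex ic i1 _)).
  move=> x; apply: (@le_trans _ _ (n`!%:R * s ^+ n * expR (k * `|x|))); last first.
    by rewrite ler_wpM2l ?mulr_ge0 ?exprn_ge0 ?(ltW s0)//; exact: expR_norm_le.
  rewrite /k mulrDl expRD [X in _ <= _ * X]mulrC mulrA ler_wpM2r ?expR_ge0//.
  rewrite mulrAC -ler_pdivrMr ?exprn_gt0// -expr_div_n.
  have -> : s^-1 * `|x| = `|x| / s by rewrite mulrC.
  by apply: expr_le_expR; rewrite divr_ge0// ltW.
rewrite ExZ ?ExD; [|exact: int1_expR..|by apply: int1D; exact: int1_expR].
rewrite !Ex_expR// sqrrN.
have -> : k ^+ 2 * s ^+ 2 / 2 = (c * s + 1) ^+ 2 / 2 by rewrite /k; field; rewrite gt_eqF.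
by set e := expR _; rewrite le_eqVlt; apply/orP; left; apply/eqP; ring.
Qed.

End gaussian_moments.

(** * Integration of independent variables *)

Section independence.
Context d (T : measurableType d) (R : realType) (P : probability T R).
Variables (Y : T -> R) (A : set T) (mu : probability (measurableTypeR R) R).
Hypotheses (mY : measurable_fun setT Y) (mA : measurable A).
Hypothesis PAY : forall U : set R, measurable U -> (P (A `&` Y @^-1` U) = P A * mu U)%E.

(** Under P restricted to A, the image measure by Y is the multiple [P A] of [mu]; the formula is
    the change of variables for that image. *)
Lemma ge0_integral_indep (phi : R -> \bar R) : measurable_fun setT phi ->
  (forall x, (0 <= phi x)%E) ->
  (\int[P]_(w in A) phi (Y w) = P A * \int[mu]_x phi x)%E.
Proof.
move=> mphi phi0.
have PAfin : P A \is a fin_num by exact: fin_num_measure.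
have PA0 : 0 <= fine (P A) by exact: fine_ge0.
transitivity (\int[mscale (NngNum PA0) mu]_x phi x)%E; last first.
  by rewrite ge0_integral_mscale//= fineK.
have mpY : measurable_fun setT (phi \o Y) by exact: measurableT_comp.
transitivity (\int[mrestr P mA]_w (phi \o Y) w)%E.
  have mAC : mrestr P mA (~` A) = 0%E by rewrite /mrestr setICl measure0.
  rewrite (@ge0_negligible_integral _ _ _ (mrestr P mA) setT (~` A))//;
    [|exact: measurableC|by move=> x _; exact: phi0].
  rewrite setTD setCK.
  apply: eq_measure_integral => E mE EA.
  by rewrite /= /mrestr setIidl.
have mY' : measurable_fun setT (Y : T -> measurableTypeR R) by [].
have := @ge0_integral_pushforward _ _ _ _ _ _ mY' (mrestr P mA) setT phi measurableT mphi (fun x _ => phi0 x).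
rewrite preimage_setT => <-.
apply: eq_measure_integral => U mU _.
change (P (Y @^-1` U `&` A) = (fine (P A))%:E * mu U)%E.
by rewrite fineK// setIC PAY.
Qed.

Lemma integral_indep (phi : R -> R) : int1 mu phi ->
  (\int[P]_(w in A) (phi (Y w))%:E = P A * \int[mu]_x (phi x)%:E)%E.
Proof.
move=> iphi; have mphi : measurable_fun setT (fun x => (phi x)%:E) by case/integrableP: iphi.
rewrite integralE [in RHS]integralE muleBr; last 2 first.
- exact: fin_num_measure.
- by apply: integrable_add_def.
have mp := measurable_funepos mphi; have mq := measurable_funeneg mphi.
rewrite -(ge0_integral_indep mp (fun x => funepos_ge0 _ x)).
rewrite -(ge0_integral_indep mq (fun x => funeneg_ge0 _ x)).
by congr (_ - _)%E; apply: eq_integral => w _; rewrite ?funeposE ?funenegE.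
Qed.

Lemma Ex_indep (phi : R -> R) : int1 mu phi ->
  Ex P (fun w => \1_A w * phi (Y w)) = fine (P A) * Ex mu phi.
Proof.
move=> iphi; rewrite /Ex /Rintegral -fineM; last 2 first.
- exact: fin_num_measure.
- exact: integrable_fin_num.
rewrite -integral_indep// [in RHS]integral_mkcond; congr fine.
apply: eq_integral => w _; rewrite patchE indicE.
by case: ifPn => _; rewrite ?mul1r ?mul0r.
Qed.

End independence.

Section sub_sigma_algebra.
Context d (T : measurableType d) (R : realType).
Variable G : set (set T).
Hypotheses (sG : sigma_algebra setT G).
Implicit Types X Y : T -> R.

(** Turns measurability with respect to a set of events into [measurable_fun] on the generated
    structure, so that sums, products and limits of adapted variables need no separate treatment. *)
Lemma sigma_measurableE X :
  sigma_measurable G X <-> measurable_fun setT (X : g_sigma_algebraType G -> R).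
Proof.
split => [mX _ U mU|mX U mU].
  by rewrite setTI; apply: sub_sigma_algebra; exact: mX.
have := mX measurableT U mU; rewrite setTI /measurable/= sigma_algebra_id//.
Qed.

End sub_sigma_algebra.

(** * Brownian increments *)

Section filtration_theory.
Context disp (Omega : measurableType disp) (R : realType).
Variable F : R -> set (set Omega).
Hypothesis hF : filtration F.
Implicit Types X Y : Omega -> R.

Lemma filtration_measurable t A : 0 <= t -> F t A -> measurable A.
Proof. by move=> t0 FA; apply: (hF.1 t t0).2. Qed.

Lemma sigma_measurable_le s t X : 0 <= s -> s <= t ->
  sigma_measurable (F s) X -> sigma_measurable (F t) X.
Proof. by move=> s0 st mX U mU; apply: (hF.2 s t s0 st); exact: mX. Qed.

Lemma sigma_measurable_fun t X : 0 <= t -> sigma_measurable (F t) X ->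
  measurable_fun setT X.
Proof.
by move=> t0 mX _ U mU; rewrite setTI; apply: (filtration_measurable t0); exact: mX.
Qed.

Lemma sigma_measurableB t X Y : 0 <= t -> sigma_measurable (F t) X ->
  sigma_measurable (F t) Y -> sigma_measurable (F t) (fun w => X w - Y w).
Proof.
move=> t0; have [sF _] := hF.1 t t0; rewrite !(sigma_measurableE sF) => mX mY.
exact: (@measurable_funB _ (g_sigma_algebraType (F t))).
Qed.

Lemma sigma_measurableM t X Y : 0 <= t -> sigma_measurable (F t) X ->
  sigma_measurable (F t) Y -> sigma_measurable (F t) (fun w => X w * Y w).
Proof.
move=> t0; have [sF _] := hF.1 t t0; rewrite !(sigma_measurableE sF) => mX mY.
exact: (@measurable_funM _ (g_sigma_algebraType (F t))).
Qed.

Lemma sigma_measurable_cst t (k : R) : 0 <= t -> sigma_measurable (F t) (fun=> k).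
Proof. by move=> t0; have [sF _] := hF.1 t t0; rewrite (sigma_measurableE sF). Qed.

End filtration_theory.

Definition incr (R : realType) (Omega : Type) (M : nat) (B : 'I_M -> R -> Omega -> R)
  (m : 'I_M) (s t : R) (w : Omega) : R := B m t w - B m s w.

Section brownian_increments.
Context disp (Omega : measurableType disp) (R : realType) (P : probability Omega R).
Variables (F : R -> set (set Omega)) (M : nat) (B : 'I_M -> R -> Omega -> R).
Hypotheses (hF : filtration F) (hB : brownian_motion P F B).
Local Notation EP := (Ex P).
Local Notation L1 := (int1 P).
Local Notation D := (incr B).
Local Notation N s t := (normal_prob 0 (Num.sqrt (t - s))).
Implicit Types (s t : R) (m : 'I_M).

Lemma incr_sigma_measurable m s t u : 0 <= s -> s <= u -> 0 <= t -> t <= u ->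
  sigma_measurable (F u) (D m s t).
Proof.
move=> s0 su t0 tu; have [mB _ _ _] := hB.
apply: (sigma_measurableB hF); first exact: le_trans su.
- exact: (sigma_measurable_le hF t0 tu (mB m t t0)).
- exact: (sigma_measurable_le hF s0 su (mB m s s0)).
Qed.

Lemma incr_measurable m s t : 0 <= s -> s <= t -> measurable_fun setT (D m s t).
Proof.
move=> s0 st; have t0 := le_trans s0 st.
by apply: (sigma_measurable_fun hF t0); exact: incr_sigma_measurable.
Qed.

Lemma incrxx m s w : D m s s w = 0.
Proof. by rewrite /incr subrr. Qed.

Lemma incr_indep m s t (A : set Omega) (U : set R) : 0 <= s -> s < t -> F s A ->
  measurable U -> (P (A `&` D m s t @^-1` U) = P A * N s t U)%E.
Proof.
move=> s0 st FA mU; have [_ _ _ ind] := hB.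
have := ind s t A (fun i => if i == m then U else setT) s0 st FA.
rewrite (bigD1 m)//= eqxx big1 => [|i /negbTE ->]; last exact: probability_setT.
rewrite mule1 => <-; last by move=> i; case: ifP.
congr (P (_ `&` _)); apply/seteqP; split => [w Uw i|w /(_ m)]; last by rewrite /= eqxx.
by case: eqP => [->|].
Qed.

(** The event given by [A] and the component [m] is kept as one set, so that it can take the place
    of [A] in [Ex_indep] applied to the component [m']. *)
Lemma incr_indep2 m m' s t (A : set Omega) (U V : set R) : m != m' -> 0 <= s -> s < t ->
  F s A -> measurable U -> measurable V ->
  (P ((A `&` D m s t @^-1` U) `&` D m' s t @^-1` V) =
   P (A `&` D m s t @^-1` U) * N s t V)%E.
Proof.
move=> mm' s0 st FA mU mV; have [_ _ _ ind] := hB.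
rewrite (incr_indep _ s0 st FA mU)//.
have := ind s t A (fun i => if i == m then U else if i == m' then V else setT) s0 st FA.
have m'm : m' != m by rewrite eq_sym.
rewrite (bigD1 m)//= eqxx (bigD1 m' m'm)/= (negbTE m'm) eqxx big1 => [|i /andP[/negbTE -> /negbTE ->]]; last exact: probability_setT.
rewrite mule1 muleA => <-; last by move=> i; case: ifP => // _; case: ifP.
rewrite -setIA; congr (P (_ `&` _)); apply/seteqP; split => [w [Uw Vw] i|w Uw].
  by case: eqP => [->|]//; case: eqP => [->|].
split; first by have := Uw m; rewrite eqxx.
by have := Uw m'; rewrite eq_sym (negbTE mm') eqxx.
Qed.

Lemma sqrt_gt0 s t : s < t -> 0 < Num.sqrt (t - s).
Proof. by move=> st; rewrite sqrtr_gt0 subr_gt0. Qed.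

Lemma F_setT s : 0 <= s -> F s setT.
Proof.
move=> s0; have [[F0 FC _] _] := hF.1 s s0.
by have := FC _ F0; rewrite setD0.
Qed.

Lemma incr_law m s t (phi : R -> R) : 0 <= s -> s < t -> measurable_fun setT phi ->
  int1 (N s t) phi -> L1 (fun w => phi (D m s t w)) /\
  EP (fun w => phi (D m s t w)) = Ex (N s t) phi.
Proof.
move=> s0 st mphi iphi; have mD := incr_measurable m s0 (ltW st).
have FT := F_setT s0.
have ind U := incr_indep m s0 st FT (U := U).
split.
  apply/integrableP; split; first by apply/measurable_EFinP; exact: measurableT_comp.
  rewrite /= (@ge0_integral_indep _ _ _ P (D m s t) setT (N s t) mD measurableT ind (fun x => `|phi x|%:E)).
  - rewrite probability_setT mul1e.
    by case/integrableP: iphi.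
  - by apply/measurable_EFinP; exact: measurableT_comp.
  - by move=> x; rewrite lee_fin.
have := Ex_indep mD measurableT ind iphi.
rewrite probability_setT mul1r => <-; congr EP; apply/funext => w.
by rewrite indicT mul1r.
Qed.

End brownian_increments.

Section brownian_martingale.
Context disp (Omega : measurableType disp) (R : realType) (P : probability Omega R).
Variables (F : R -> set (set Omega)) (M : nat) (B : 'I_M -> R -> Omega -> R).
Hypotheses (hF : filtration F) (hB : brownian_motion P F B).
Local Notation EP := (Ex P).
Local Notation L1 := (int1 P).
Local Notation L2 := (sq_int P).
Local Notation D := (incr B).
Local Notation N s t := (normal_prob 0 (Num.sqrt (t - s))).
Implicit Types (s t : R) (m : 'I_M).

Lemma incr_moment m s t (n : nat) (c : R) : 0 <= s -> s <= t -> 0 <= c ->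
  L1 (fun w => `|D m s t w| ^+ n * expR (c * `|D m s t w|)) /\
  EP (fun w => `|D m s t w| ^+ n * expR (c * `|D m s t w|)) <=
  n`!%:R * (2 * expR ((c * Num.sqrt (t - s) + 1) ^+ 2 / 2)) * Num.sqrt (t - s) ^+ n.
Proof.
(* The law of an increment is given for [s < t] only. For [s = t] the increment is 0, and the bound
   is trivial except for [n = 0], where it says that 1 is at most 2 sqrt(e). *)
move=> s0; rewrite le_eqVlt => /predU1P[<- c0|st c0].
  rewrite (_ : (fun _ => _) = fun=> 0 ^+ n * expR (c * 0)); last first.
    by apply/funext => w; rewrite incrxx normr0.
  split; first exact: int1_cst.
  rewrite Ex_cst subrr sqrtr0 !mulr0 add0r expR0 mulr1.
  case: n => [|n]; last by rewrite !expr0n/= mulr0.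
  rewrite !expr0 fact0 mulr1 mul1r (le_trans _ (_ : 2 * 1 <= _))//; first by lra.
  by rewrite ler_pM2l// -expR0 ler_expR divr_ge0 ?sqr_ge0.
have sq0 := sqrt_gt0 st.
have iN := int1_poly_expR sq0 n c.
have [] := incr_law hF hB m s0 st (int1_measurable iN) iN.
by move=> i1 ->; split => //; exact: Ex_normal_poly_expR.
Qed.

Lemma incr_sq_int m s t : 0 <= s -> s <= t -> L2 (D m s t).
Proof.
move=> s0 st; have mD := incr_measurable hF hB m s0 st; split => //.
have [+ _] := incr_moment m 2 s0 st (lexx 0).
congr int1; apply/funext => w.
by rewrite mul0r expR0 mulr1 real_normK ?num_real.
Qed.

Lemma Ex_sigma_incr m s t (zeta : Omega -> R) : 0 <= s -> s <= t ->
  sigma_measurable (F s) zeta -> L2 zeta -> EP (fun w => zeta w * D m s t w) = 0.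
Proof.
move=> s0; rewrite le_eqVlt => /predU1P[<- mz z2|st mz z2].
  by rewrite -[RHS](Ex_cst P 0); congr EP; apply/funext => w; rewrite incrxx mulr0.
have st' := ltW st; have sD := incr_sq_int m s0 st'.
apply: Ex_mul_eq0.
- by case: z2.
- exact: sq_int_int1.
- exact: sq_intM.
move=> V mV; have FA := mz V mV; have sq0 := sqrt_gt0 st.
have := Ex_indep (sq_int_measurable sD) (filtration_measurable hF s0 FA)
  (fun U mU => incr_indep hB m s0 st FA mU) (int1_normal_id sq0).
by rewrite Ex_normal_id// mulr0.
Qed.

Lemma Ex_sigma_incr_sqr m s t (zeta : Omega -> R) (k : R) : 0 <= s -> s <= t ->
  sigma_measurable (F s) zeta -> (forall w, `|zeta w| <= k) ->
  EP (fun w => zeta w * D m s t w ^+ 2) = EP zeta * (t - s).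
Proof.
move=> s0; rewrite le_eqVlt => /predU1P[<- mz zk|st mz zk].
  rewrite subrr mulr0 -[RHS](Ex_cst P 0); congr EP; apply/funext => w.
  by rewrite incrxx expr0n/= mulr0.
have st' := ltW st; have sD := incr_sq_int m s0 st'.
have mz' := sigma_measurable_fun hF s0 mz.
have iz := int1_bnd P mz' zk.
have iD : L1 (fun w => D m s t w ^+ 2 - (t - s)) by apply: int1B; [case: sD|exact: int1_cst].
have izD := int1_Mbnd mz' zk iD.
have : EP (fun w => zeta w * (D m s t w ^+ 2 - (t - s))) = 0.
  apply: Ex_mul_eq0 => // V mV; have FA := mz V mV; have sq0 := sqrt_gt0 st.
  have iN : int1 (N s t) (fun x => x ^+ 2 - (t - s)).
    by apply: int1B; [exact: int1_normal_sqr|exact: int1_cst].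
  have := Ex_indep (sq_int_measurable sD) (filtration_measurable hF s0 FA)
    (fun U mU => incr_indep hB m s0 st FA mU) iN.
  move=> E; rewrite [LHS]E ExB; [|exact: int1_normal_sqr|exact: int1_cst].
  by rewrite Ex_normal_sqr// Ex_cst sqr_sqrtr ?subr_ge0// subrr mulr0.
rewrite -(mulrC (t - s)) -ExZ// => h; apply/eqP; rewrite -subr_eq0 -ExB.
- by apply/eqP; rewrite -[RHS]h; congr EP; apply/funext => w; ring.
- by have := int1_Mbnd mz' zk (proj2 sD).
- exact: int1Z.
Qed.

(** Two reductions to indicators, of [zeta] and then of the increment of component [m]; what remains
    is the mean of the increment of [m'] over an event independent of it. *)
Lemma Ex_sigma_incr_mul m m' s t (zeta : Omega -> R) (k : R) : m != m' -> 0 <= s -> s <= t ->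
  sigma_measurable (F s) zeta -> (forall w, `|zeta w| <= k) ->
  EP (fun w => zeta w * (D m s t w * D m' s t w)) = 0.
Proof.
move=> mm' s0; rewrite le_eqVlt => /predU1P[<- mz zk|st mz zk].
  rewrite -[RHS](Ex_cst P 0); congr EP; apply/funext => w.
  by rewrite incrxx mul0r mulr0.
have st' := ltW st; have sD i := incr_sq_int i s0 st'.
have mz' := sigma_measurable_fun hF s0 mz.
have iD : L1 (fun w => D m s t w * D m' s t w) by exact: sq_intM.
apply: Ex_mul_eq0 => //; first exact: int1_Mbnd zk iD.
move=> U mU; have FA := mz U mU; have sq0 := sqrt_gt0 st.
pose W w := \1_U (zeta w) * D m' s t w.
have sW : L2 W.
  apply: (@sq_int_Mbnd _ _ _ _ _ _ 1) => //.
    by apply: measurableT_comp => //; exact: measurable_indic.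
  by move=> w; rewrite indicE; case: (_ \in _); rewrite ?normr1 ?normr0.
transitivity (EP (fun w => D m s t w * W w)).
  by congr EP; apply/funext => w; rewrite /W; ring.
have mD := sq_int_measurable (sD m).
apply: Ex_mul_eq0 => //; [exact: sq_int_int1|exact: sq_intM|].
move=> V mV.
have mA : measurable (zeta @^-1` U `&` D m s t @^-1` V).
  apply: measurableI; first exact: (filtration_measurable hF s0 FA).
  by rewrite -[X in measurable X]setTI; exact: mD.
have := Ex_indep (sq_int_measurable (sD m')) mA
  (fun V' mV' => incr_indep2 hB mm' s0 st FA mV mV') (int1_normal_id sq0).
rewrite Ex_normal_id// mulr0 => E; rewrite -[RHS]E.
congr EP; apply/funext => w; rewrite /W mulrA; congr (_ * _).
by rewrite !indicE in_setI mulrC -natrM mulnb.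
Qed.

End brownian_martingale.

(** * Ito integrals *)

Section simple_process.
Context disp (Omega : measurableType disp) (R : realType) (P : probability Omega R).
Variables (F : R -> set (set Omega)) (M : nat) (B : 'I_M -> R -> Omega -> R).
Hypotheses (hF : filtration F) (hB : brownian_motion P F B).
Local Notation EP := (Ex P).
Local Notation L1 := (int1 P).
Local Notation L2 := (sq_int P).
Local Notation D := (incr B).
Implicit Types (s t : R) (m : 'I_M).

(** These variables serve both as coefficients of simple processes and as the test variables that
    express orthogonality to [F a]; boundedness keeps their products with square-integrable
    variables square-integrable. *)
Definition adm (a : R) (xi : Omega -> R) :=
  sigma_measurable (F a) xi /\ exists K, forall w, `|xi w| <= K.

(* length of the intersection of ]a, b] and ]c, e] *)
Definition overlap (a b c e : R) : R := Num.max 0 (Num.min b e - Num.max a c).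

Lemma adm_measurable a xi : 0 <= a -> adm a xi -> measurable_fun setT xi.
Proof. by move=> a0 [mx _]; exact: (sigma_measurable_fun hF a0). Qed.

Lemma adm_le a b xi : 0 <= a -> a <= b -> adm a xi -> adm b xi.
Proof. by move=> a0 ab [mx K]; split => //; exact: (sigma_measurable_le hF a0 ab). Qed.

Lemma admM a xi eta : 0 <= a -> adm a xi -> adm a eta -> adm a (fun w => xi w * eta w).
Proof.
move=> a0 [mx [K xK]] [me [L eL]]; split; first exact: (sigma_measurableM hF a0).
by exists (K * L) => w; rewrite normrM ler_pM.
Qed.

Lemma admN a xi : 0 <= a -> adm a xi -> adm a (fun w => - xi w).
Proof.
move=> a0 [mx [K xK]]; split; last by exists K => w; rewrite normrN.
have := sigma_measurableB hF a0 (sigma_measurable_cst hF 0 a0) mx.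
by congr sigma_measurable; apply/funext => w; rewrite sub0r.
Qed.

Lemma admB a xi eta : 0 <= a -> adm a xi -> adm a eta -> adm a (fun w => xi w - eta w).
Proof.
move=> a0 [mx [K xK]] [me [L eL]]; split; first exact: (sigma_measurableB hF a0).
by exists (K + L) => w; rewrite (le_trans (ler_normB _ _))// lerD.
Qed.

Lemma adm_sq_int a xi X : 0 <= a -> adm a xi -> L2 X -> L2 (fun w => xi w * X w).
Proof. by move=> a0 /[dup] /(adm_measurable a0) mx [_ [K xK]]; exact: sq_int_Mbnd. Qed.

Lemma adm_int1 a xi X : 0 <= a -> adm a xi -> L1 X -> L1 (fun w => xi w * X w).
Proof. by move=> a0 /[dup] /(adm_measurable a0) mx [_ [K xK]]; exact: int1_Mbnd. Qed.

Lemma adm_int1_self a xi : 0 <= a -> adm a xi -> L1 xi.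
Proof. by move=> a0 /[dup] /(adm_measurable a0) mx [_ [K xK]]; exact: int1_bnd xK. Qed.

Lemma incrD m a b c w : D m a b w + D m b c w = D m a c w.
Proof. by rewrite /incr; ring. Qed.

Lemma Ex_adm_incr m a b xi X : 0 <= a -> a <= b -> adm a xi ->
  sigma_measurable (F a) X -> L2 X -> EP (fun w => xi w * X w * D m a b w) = 0.
Proof.
move=> a0 ab hx mX sX.
apply: (Ex_sigma_incr hF hB m a0 ab (zeta := fun w => xi w * X w)).
  by apply: (sigma_measurableM hF a0) => //; case: hx.
exact: adm_sq_int hx sX.
Qed.

Lemma Ex_incr_nested m c x y zeta : 0 <= c -> c <= x -> x <= y -> adm c zeta ->
  EP (fun w => zeta w * (D m c x w * D m c y w)) = EP zeta * (x - c).
Proof.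
move=> c0 cx xy hz; have x0 := le_trans c0 cx.
have sD := incr_sq_int hF hB m c0 cx; have sD' := incr_sq_int hF hB m x0 xy.
have hzx := adm_le c0 cx hz.
have mD := incr_sigma_measurable hF hB m c0 cx x0 (lexx x).
transitivity (EP (fun w => zeta w * D m c x w ^+ 2 + zeta w * D m c x w * D m x y w)).
  by congr EP; apply/funext => w; rewrite -(incrD m c x y); ring.
rewrite ExD; [|by apply: adm_int1 hz _ => //; case: sD|].
  rewrite (Ex_adm_incr m x0 xy hzx mD sD) addr0.
  by case: hz => mz [K zK]; exact: (Ex_sigma_incr_sqr hF hB m c0 cx mz zK).
by apply: sq_intM => //; exact: adm_sq_int hz sD.
Qed.

(** Polarised Ito isometry for two intervals. With [a <= c], the part of the first interval before
    [c] is known at time [c], hence orthogonal to the second increment; the rest starts at [c] like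
    the second interval, and [Ex_incr_nested] gives the common length. *)
Lemma Ex_incr_overlap m a b c e xi eta : 0 <= a -> a <= b -> 0 <= c -> c <= e ->
  adm a xi -> adm c eta ->
  EP (fun w => (xi w * D m a b w) * (eta w * D m c e w)) =
  EP (fun w => xi w * eta w) * overlap a b c e.
Proof.
wlog ac : a b c e xi eta / a <= c.
  move=> H a0 ab c0 ce hx he; have [ac|/ltW ca] := leP a c; first exact: H.
  rewrite /overlap (minC b) (maxC a) -/(overlap c e a b).
  transitivity (EP (fun w => (eta w * D m c e w) * (xi w * D m a b w))).
    by congr EP; apply/funext => w; rewrite mulrC.
  rewrite H//; congr (_ * _); congr EP; apply/funext => w; exact: mulrC.
move=> a0 ab c0 ce hx he; rewrite /overlap (max_r ac).
have hxc := adm_le a0 ac hx; have hxe := admM c0 hxc he.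
have sce := incr_sq_int hF hB m c0 ce.
have [bc|/ltW cb] := leP b c.
  rewrite max_l ?mulr0; last by rewrite subr_le0 ge_min bc.
  have sab := incr_sq_int hF hB m a0 ab; have b0 := le_trans a0 ab.
  rewrite -[RHS](Ex_adm_incr m c0 ce hxe (incr_sigma_measurable hF hB m a0 (le_trans ab bc) b0 bc) sab).
  by congr EP; apply/funext => w; ring.
have sac := incr_sq_int hF hB m a0 ac; have scb := incr_sq_int hF hB m c0 cb.
transitivity (EP (fun w => (xi w * eta w) * D m a c w * D m c e w +
    (xi w * eta w) * (D m c b w * D m c e w))).
  by congr EP; apply/funext => w; rewrite -(incrD m a c b); ring.
have i1 : L1 (fun w => (xi w * eta w) * (D m c b w * D m c e w)).
  by apply: adm_int1 hxe _ => //; exact: sq_intM.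
have i2 : L1 (fun w => (xi w * eta w) * D m a c w * D m c e w).
  by apply: sq_intM => //; exact: adm_sq_int hxe sac.
rewrite ExD// (Ex_adm_incr m c0 ce hxe (incr_sigma_measurable hF hB m a0 ac c0 (lexx c)) sac) add0r.
have [be|/ltW eb] := leP b e.
  by rewrite (Ex_incr_nested m c0 cb be hxe) max_r// subr_ge0.
rewrite max_r ?subr_ge0// -(Ex_incr_nested m c0 ce eb hxe).
by congr EP; apply/funext => w; ring.
Qed.

Section family.
Variables (I : finType) (a b : I -> R) (xi : I -> Omega -> R).

(* Contrary to the pieces of an eprocess, the intervals ]a i, b i] may overlap
   and come in any order: such families can be truncated and concatenated. *)
Definition sp_int m (w : Omega) : R := \sum_i xi i w * D m (a i) (b i) w.

Definition sp_val (r : R) (w : Omega) : R := \sum_i xi i w * \1_`]a i, b i] r.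

(** Both the second moment of [sp_int] and the squared norm of [sp_val] are computed as this number:
    passing through it is the Ito isometry. *)
Definition sp_norm : R :=
  \sum_i \sum_j EP (fun w => xi i w * xi j w) * overlap (a i) (b i) (a j) (b j).

Hypotheses (a0 : forall i, 0 <= a i) (ab : forall i, a i <= b i)
  (hxi : forall i, adm (a i) (xi i)).

Lemma sp_int_sq_int m : L2 (sp_int m).
Proof.
apply: sq_int_sum => i _; apply: adm_sq_int (hxi i) _ => //.
exact: (incr_sq_int hF hB).
Qed.

Lemma Ex_sp_int_sqr m : EP (fun w => sp_int m w ^+ 2) = sp_norm.
Proof.
have sX i : L2 (fun w => xi i w * D m (a i) (b i) w).
  by apply: adm_sq_int (hxi i) _ => //; exact: (incr_sq_int hF hB).
transitivity (EP (fun w => \sum_i \sum_j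
   (xi i w * D m (a i) (b i) w) * (xi j w * D m (a j) (b j) w))).
  congr EP; apply/funext => w; rewrite expr2 /sp_int mulr_suml.
  by apply: eq_bigr => i _; rewrite mulr_sumr.
rewrite Ex_sum => [|i _]; last by apply: int1_sum => j _; exact: sq_intM.
apply: eq_bigr => i _; rewrite Ex_sum => [|j _]; last exact: sq_intM.
by apply: eq_bigr => j _; exact: Ex_incr_overlap.
Qed.

Lemma measurable_sp_val :
  measurable_fun setT (fun rw : measurableTypeR R * Omega => sp_val rw.1 rw.2).
Proof.
rewrite /sp_val; apply: measurable_sum => i; apply: measurable_funM.
  by apply: measurableT_comp => //; exact: adm_measurable (hxi i).
by apply: (@measurableT_comp _ _ _ _ _ _ (\1_(`]a i, b i] : set R) : measurableTypeR R -> R)).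
Qed.

Lemma integral_sp_val_sqr t w : (forall i, b i <= t) ->
  (\int[lebesgue_measure]_(r in `[0%R, t]) ((sp_val r w) ^+ 2)%:E =
   (\sum_i \sum_j xi i w * xi j w * overlap (a i) (b i) (a j) (b j))%:E)%E.
Proof.
move=> bt.
transitivity (\int[lebesgue_measure]_(r in `[0%R, t]) \sum_i \sum_j
    ((xi i w * xi j w)%:E * (\1_(`]a i, b i] `&` `]a j, b j]) r)%:E))%E.
  apply: eq_integral => r _; rewrite expr2 /sp_val mulr_suml -sumEFin.
  apply: eq_bigr => i _; rewrite mulr_sumr -sumEFin; apply: eq_bigr => j _.
  by rewrite indicI -EFinM /=; congr EFin; ring.
have mI i j : measurable (`]a i, b i] `&` `]a j, b j] : set (measurableTypeR R)).
  exact: measurableI.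
have iI i j : lebesgue_measure.-integrable `[0%R, t]
    (fun r : R => ((xi i w * xi j w)%:E * (\1_(`]a i, b i] `&` `]a j, b j]) r)%:E)%E).
  apply: integrableZl => //; apply/integrableP; split.
    by apply/measurable_EFinP; apply: measurable_funTS; exact: measurable_indic.
  under eq_integral do rewrite gee0_abs ?lee_fin//.
  rewrite integral_indic// (@le_lt_trans _ _ (lebesgue_measure (`[0%R, t] : set R)))//.
    by apply: le_measure; rewrite ?inE//; exact: measurableI.
  by rewrite lebesgue_measure_itv/=; case: ifP => _; rewrite ?ltry// -EFinB ltry.
rewrite integral_sum//; last by move=> i; apply: integrable_sum.
rewrite -sumEFin; apply: eq_bigr => i _.
rewrite integral_sum// -sumEFin; apply: eq_bigr => j _.
rewrite integralZl//; last first.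
  apply/integrableP; split.
    by apply/measurable_EFinP; apply: measurable_funTS; exact: measurable_indic.
  under eq_integral do rewrite gee0_abs ?lee_fin//.
  rewrite integral_indic// (@le_lt_trans _ _ (lebesgue_measure (`[0%R, t] : set R)))//.
    by apply: le_measure; rewrite ?inE//; exact: measurableI.
  by rewrite lebesgue_measure_itv/=; case: ifP => _; rewrite ?ltry// -EFinB ltry.
rewrite integral_indic// [RHS]EFinM; congr (_ * _)%E.
rewrite (_ : `]a i, b i] `&` `]a j, b j] `&` `[0%R, t] = `]Num.max (a i) (a j), Num.min (b i) (b j)]%classic).
  rewrite [LHS](lebesgue_measure_itv `]Num.max (a i) (a j), Num.min (b i) (b j)])/=.
  rewrite lte_fin /overlap; case: ltP => h.
    by rewrite -EFinB [X in _ = X%:E]max_r// subr_ge0 ltW.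
  by rewrite [X in _ = X%:E]max_l// subr_le0.
apply/seteqP; split => r /=; rewrite !in_itv/= gt_max le_min.
  by move=> [[/andP[-> ->] /andP[-> ->]]].
move=> /andP[/andP[ai aj] /andP[bi bj]]; rewrite ai aj bi bj; split => //.
by rewrite (le_trans (a0 i) (ltW ai)) (le_trans bi (bt i)).
Qed.

Lemma L2_process_norm2_sp_val t : (forall i, b i <= t) ->
  L2_process_norm2 P t sp_val = sp_norm%:E.
Proof.
move=> bt; rewrite /L2_process_norm2.
under eq_integral do rewrite integral_sp_val_sqr//.
have iX i j : L1 (fun w => xi i w * xi j w).
  by apply: adm_int1 (hxi i) _ => //; exact: adm_int1_self (hxi j).
have iX' i j : L1 (fun w => xi i w * xi j w * overlap (a i) (b i) (a j) (b j)).
  have := int1Z (overlap (a i) (b i) (a j) (b j)) (iX i j).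
  by congr int1; apply/funext => w; rewrite mulrC.
rewrite -EFin_Ex; last by apply: int1_sum => i _; apply: int1_sum => j _.
congr EFin; rewrite Ex_sum => [|i _]; last by apply: int1_sum => j _.
apply: eq_bigr => i _; rewrite Ex_sum// ; apply: eq_bigr => j _.
rewrite mulrC -ExZ//; congr EP; apply/funext => w; exact: mulrC.
Qed.

End family.

End simple_process.

(** * Norm of integrands *)

Section process_norm.
Context disp (Omega : measurableType disp) (R : realType) (P : probability Omega R).
Variable t : R.
Implicit Types H : R -> Omega -> R.

Definition jointly_measurable H := measurable_fun (`[0, t] `*` [set: Omega])
  (fun rw : measurableTypeR R * Omega => H rw.1 rw.2).

(** Extension by 0 off the time interval: the iterated integrals then run over full spaces, as in
    Tonelli's theorem. *)
Let G H (rw : measurableTypeR R * Omega) : \bar R :=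
  ((fun rw => (H rw.1 rw.2 ^+ 2)%:E) \_ (`[0, t] `*` [set: Omega])) rw.

Let mG H : jointly_measurable H -> measurable_fun setT (G H).
Proof.
move=> mH; apply/(measurable_restrictT _ _).1; first by apply: measurableX.
by apply/measurable_EFinP; exact: measurable_funX.
Qed.

Let G0 H rw : (0 <= G H rw)%E.
Proof. by rewrite /G patchE; case: ifP => // _; rewrite lee_fin sqr_ge0. Qed.

Let GE H r w : G H (r, w) = ((fun r => (H r w ^+ 2)%:E) \_ `[0, t]) r.
Proof. by rewrite /G !patchE in_setX /= in_setT andbT. Qed.

Let normE H : L2_process_norm2 P t H = (\int[P]_w \int[lebesgue_measure]_r G H (r, w))%E.
Proof.
rewrite /L2_process_norm2; apply: eq_integral => w _; rewrite integral_mkcond.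
by apply: eq_integral => r _; rewrite GE.
Qed.

Lemma L2_process_norm2_leD H H1 H2 (a b : R) : 0 <= a -> 0 <= b ->
  jointly_measurable H -> jointly_measurable H1 -> jointly_measurable H2 ->
  (forall r w, 0 <= r <= t -> H r w ^+ 2 <= a * H1 r w ^+ 2 + b * H2 r w ^+ 2) ->
  (L2_process_norm2 P t H <= a%:E * L2_process_norm2 P t H1 + b%:E * L2_process_norm2 P t H2)%E.
Proof.
move=> a0 b0 mH mH1 mH2 HH; rewrite !normE.
have mI H' : jointly_measurable H' ->
    measurable_fun setT (fun w => \int[lebesgue_measure]_r G H' (r, w))%E.
  by move=> mH'; exact: (measurable_fun_fubini_tonelli_G (m1 := lebesgue_measure) (G H') (mG mH') (G0 H')).
have mS H' w : jointly_measurable H' -> measurable_fun setT (fun r => G H' (r, w)).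
  by move=> mH'; exact: (measurableT_comp (mG mH')).
have I0 H' w : (0 <= \int[lebesgue_measure]_r G H' (r, w))%E by exact: integral_ge0.
rewrite -!ge0_integralZl_EFin//; [|exact: mI..].
rewrite -ge0_integralD//; first last.
- by apply: measurable_funeM; exact: mI.
- by move=> w _; rewrite mule_ge0.
- by apply: measurable_funeM; exact: mI.
- by move=> w _; rewrite mule_ge0.
apply: ge0_le_integral => //.
- exact: mI.
- by apply: emeasurable_funD; apply: measurable_funeM; exact: mI.
move=> w _; rewrite -!ge0_integralZl_EFin//; [|exact: mS..].
rewrite -ge0_integralD//; first last.
- by apply: measurable_funeM; exact: mS.
- by move=> r _; rewrite mule_ge0.
- by apply: measurable_funeM; exact: mS.
- by move=> r _; rewrite mule_ge0.
apply: ge0_le_integral => //.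
- exact: mS.
- by apply: emeasurable_funD; apply: measurable_funeM; exact: mS.
move=> r _; rewrite !GE !patchE; case: ifPn => [|_]; last by rewrite !mule0 adde0.
by rewrite inE/= in_itv/= => rt; rewrite -!EFinM -EFinD lee_fin; exact: HH.
Qed.

(** The bound on H is given at each fixed time, so the expectation must be taken first: Tonelli
    exchanges the integrals, and each time after s contributes at most K. *)
Lemma L2_process_norm2_bound H (s K : R) : 0 <= s -> s <= t -> 0 <= K ->
  jointly_measurable H ->
  (forall r, s < r <= t -> (\int[P]_w ((H r w) ^+ 2)%:E <= K%:E)%E) ->
  (forall r w, r <= s -> H r w = 0) ->
  (L2_process_norm2 P t H <= (K * (t - s))%:E)%E.
Proof.
move=> s0 st K0 mH HK H0; rewrite normE.
rewrite -(fubini_tonelli (m1 := lebesgue_measure) (m2 := P) (G H) (mG mH) (G0 H)).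
apply: (@le_trans _ _ (\int[lebesgue_measure]_r ((cst K%:E) \_ `]s, t]) r)%E); last first.
  rewrite -integral_mkcond integral_cst// [X in (_ * X)%E](lebesgue_measure_itv `]s, t])/= lte_fin.
  case: ltP => h; first by rewrite -EFinB -EFinM.
  by rewrite mule0 lee_fin mulr_ge0// subr_ge0.
apply: ge0_le_integral => //.
- by move=> r _; exact: integral_ge0.
- exact: (measurable_fun_fubini_tonelli_F (m2 := P) (G H) (mG mH) (G0 H)).
- by apply/(measurable_restrictT _ _).1.
move=> r _; rewrite patchE; case: ifPn => [|].
  rewrite inE/= in_itv/= => rst; apply: le_trans (HK r rst).
  rewrite le_eqVlt; apply/orP; left; apply/eqP; apply: eq_integral => w _.
  rewrite GE patchE ifT// inE/= in_itv/=; case/andP: rst => sr ->.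
  by rewrite (le_trans s0 (ltW sr)).
rewrite notin_setE/= in_itv/= => nr.
rewrite integral0_eq// => w _; rewrite GE patchE; case: ifPn => //.
rewrite inE/= in_itv/= => /andP[_ rt]; rewrite H0 ?expr0n//.
by rewrite leNgt; apply/negP => sr; apply: nr; rewrite sr.
Qed.

End process_norm.

(** * Increments of Ito integrals *)

Section ito_increment.
Context disp (Omega : measurableType disp) (R : realType) (P : probability Omega R).
Variables (F : R -> set (set Omega)) (M : nat) (B : 'I_M -> R -> Omega -> R).
Hypotheses (hF : filtration F) (hB : brownian_motion P F B).
Local Notation EP := (Ex P).
Local Notation L2 := (sq_int P).
Local Notation D := (incr B).
Implicit Types (s t : R) (m : 'I_M).

Lemma elementary_node t (e : eprocess R Omega) : elementary F t e ->
  forall j, (j < ep_size e)%N -> [/\ 0 <= ep_node e j, ep_node e j <= ep_node e j.+1,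
    ep_node e j.+1 <= t & adm F (ep_node e j) (ep_coef e j)].
Proof.
move=> [n0 nt nd me [K eK]].
have mono i j : (i <= j)%N -> (j <= ep_size e)%N -> ep_node e i <= ep_node e j.
  move=> ij je; rewrite -(subnK ij); move: je; rewrite -{1}(subnK ij).
  elim: (j - i)%N => [|k IH] // kie; apply: (le_trans (IH (ltnW kie))).
  by rewrite addSn; exact: nd.
move=> j je; split.
- by rewrite -n0 mono// ltnW.
- exact: nd.
- by rewrite -nt mono.
- by split; [exact: me|exists K => w; exact: eK].
Qed.
Lemma L2_process_norm2_restrict s t (H : R -> Omega -> R) : s <= t ->
  L2_process_norm2 P t (fun r w => H r w * (r <= s)%R%:R) = L2_process_norm2 P s H.
Proof.
move=> st; rewrite /L2_process_norm2; apply: eq_integral => w _.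
rewrite integral_mkcond [RHS]integral_mkcond; apply: eq_integral => r _.
rewrite !patchE !mem_setE !in_itv/=; have [rs|sr] := leP r s.
  by rewrite (le_trans rs st) mulr1.
by rewrite andbF mulr0 expr0n/= if_same.
Qed.

Lemma jointly_measurableB t (H1 H2 : R -> Omega -> R) : jointly_measurable t H1 ->
  jointly_measurable t H2 -> jointly_measurable t (fun r w => H1 r w - H2 r w).
Proof. by move=> m1 m2; exact: measurable_funB. Qed.

Lemma measurable_le_indic s : measurable_fun setT (fun r : measurableTypeR R => (r <= s)%R%:R : R).
Proof.
rewrite (_ : (fun _ => _) = \1_(`]-oo, s] : set R)); first exact: measurable_indic.
by apply/funext => r; rewrite indicE mem_setE in_itv.
Qed.

Lemma jointly_measurable_le t s (H : R -> Omega -> R) : jointly_measurable t H ->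
  jointly_measurable t (fun r w => H r w * (r <= s)%R%:R).
Proof.
move=> mH; apply: measurable_funM => //; apply: measurable_funTS.
by apply: (@measurableT_comp _ _ _ _ _ _ (fun r : measurableTypeR R => (r <= s)%R%:R : R)); [exact: measurable_le_indic|].
Qed.

Lemma jointly_measurable_lt t s (H : R -> Omega -> R) : jointly_measurable t H ->
  jointly_measurable t (fun r w => H r w * (s < r)%R%:R).
Proof.
move=> mH; have := jointly_measurableB mH (jointly_measurable_le s mH).
congr measurable_fun; apply/funext => rw.
by rewrite ltNge; case: (_ <= _); rewrite /= ?mulr1 ?mulr0 ?subrr ?subr0.
Qed.

Lemma sqrB_le2 (x y : R) : (x - y) ^+ 2 <= 2 * x ^+ 2 + 2 * y ^+ 2.
Proof. by have := sqr_ge0 (x + y); nra. Qed.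

(** The outer maximum makes the truncated interval empty when s is before a, instead of giving it a
    right end below its left end. *)
Lemma indic_before (a b s r : R) : a <= b ->
  \1_`]a, Num.max a (Num.min b s)] r = \1_`]a, b] r * (r <= s)%R%:R :> R.
Proof.
move=> ab; rewrite !indicE !mem_setE !in_itv/= le_max le_min -natrM mulnb.
by congr (nat_of_bool _)%:R; have [ar|//] := ltP a r => /=.
Qed.

Lemma indic_after (a b s r : R) :
  \1_`]Num.max a s, Num.max b s] r = \1_`]a, b] r * (s < r)%R%:R :> R.
Proof.
rewrite !indicE !mem_setE !in_itv/= le_max gt_max -natrM mulnb.
by congr (nat_of_bool _)%:R; have [sr|//] := ltP s r; rewrite ?andbT ?andbF ?orbF.
Qed.

Lemma incr_split m (a b s : R) w : a <= b ->
  D m a (Num.max a (Num.min b s)) w + D m (Num.max a s) (Num.max b s) w = D m a b w.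
Proof.
move=> ab; have [bs|/ltW sb] := leP b s.
  by rewrite (max_r (le_trans ab bs)) (max_r ab) incrxx addr0.
have [sa|/ltW as_] := leP s a; first by rewrite incrxx add0r.
exact: incrD.
Qed.

Lemma cvg0_lt (u : (\bar R)^nat) (e : R) : 0 < e -> u @ \oo --> 0%E ->
  \forall n \near \oo, (u n < e%:E)%E.
Proof.
move=> e0 u0; apply: (u0 [set x | (x < e%:E)%E]).
by apply: open_nbhs_nbhs; split; [exact: open_ereal_lt_ereal|rewrite /= lte_fin].
Qed.

Lemma ito_integral_approx m t (H : R -> Omega -> R) (I : Omega -> R) (e : R) : 0 < e ->
  ito_integral P F (B m) t H I -> exists E : eprocess R Omega,
  [/\ elementary F t E,
      (L2_process_norm2 P t (fun r w => ep_val E r w - H r w)%R < e%:E)%E,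
      L2 (fun w => ep_int E (B m) w - I w) &
      EP (fun w => (ep_int E (B m) w - I w) ^+ 2) < e].
Proof.
move=> e0 [_ mI [E [eE c1 c2]]].
have [n [/= h1 h2]] : exists n, (L2_process_norm2 P t (fun r w => ep_val (E n) r w - H r w)%R < e%:E)%E
    /\ ('E_P[fun w => ((ep_int (E n) (B m) w - I w) ^+ 2)%R] < e%:E)%E.
  have [n _ hn] := filterI (cvg0_lt e0 c1) (cvg0_lt e0 c2).
  by exists n; exact: (hn n (leqnn n)).
exists (E n).
have mE : measurable_fun setT (ep_int (E n) (B m)).
  rewrite (_ : ep_int _ _ = sp_int B (fun j : 'I_(ep_size (E n)) => ep_node (E n) j)
    (fun j => ep_node (E n) j.+1) (fun j => ep_coef (E n) j) m)//.
  by apply: sq_int_measurable; apply: (sp_int_sq_int hF hB) => j; have [] := elementary_node (eE n) (ltn_ord j).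
rewrite unlock in h2.
have [] := @sq_int_lt _ _ _ P _ e _ h2; first exact: measurable_funB.
by [].
Qed.

(** Let E approximate H up to t, and E' up to s, independently of each other. The part of E after s
    is the approximation sought. Its error consists of the errors of E and E' at their own final
    times and of the integral of E - E' over [0, s], which the isometry controls because both
    processes are close to H there. *)
Lemma ito_increment_approx m s t (H : R -> Omega -> R) (Is It : Omega -> R) (e : R) :
  0 <= s -> s <= t -> 0 < e ->
  ito_integral P F (B m) s H Is -> ito_integral P F (B m) t H It ->
  exists (I : finType) (a b : I -> R) (xi : I -> Omega -> R),
    [/\ forall i, [/\ s <= a i, a i <= b i, b i <= t & adm F (a i) (xi i)],
        L2 (fun w => It w - Is w - sp_int B a b xi m w),
        EP (fun w => (It w - Is w - sp_int B a b xi m w) ^+ 2) <= e &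
        (L2_process_norm2 P t (fun r w => sp_val a b xi r w - H r w * (s < r)%R%:R)%R <= e%:E)%E].
Proof.
(* The three errors have second moments at most 4d, d and d; two uses of (x + y)^2 <= 2x^2 + 2y^2
   give 22d, which is below [e]. *)
move=> s0 st e0 hs ht; pose d := e / 32.
have d0 : 0 < d by rewrite divr_gt0.
have t0 := le_trans s0 st.
have mH : jointly_measurable t H by case: ht => -[].
have [E [eE E1 E2 E3]] := ito_integral_approx d0 ht.
have [E' [eE' E1' E2' E3']] := ito_integral_approx d0 hs.
have nE := elementary_node eE; have nE' := elementary_node eE'.
pose I := 'I_(ep_size E); pose a (j : I) := ep_node E j; pose b (j : I) := ep_node E j.+1.
pose xi (j : I) := ep_coef E j.
pose I' := 'I_(ep_size E'); pose a' (j : I') := ep_node E' j; pose b' (j : I') := ep_node E' j.+1.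
pose xi' (j : I') := ep_coef E' j.
have hE (j : I) : [/\ 0 <= a j, a j <= b j, b j <= t & adm F (a j) (xi j)] := nE j (ltn_ord j).
have hE' (j : I') : [/\ 0 <= a' j, a' j <= b' j, b' j <= s & adm F (a' j) (xi' j)] := nE' j (ltn_ord j).
pose aS (j : I) := Num.max (a j) s; pose bS (j : I) := Num.max (b j) s.
exists I, aS, bS, xi.
have hS (i : I) : [/\ s <= aS i, aS i <= bS i, bS i <= t & adm F (aS i) (xi i)].
  have [ai abi bi xii] := hE i; rewrite /aS /bS; split.
  - by rewrite le_max lexx orbT.
  - by rewrite ge_max !le_max abi lexx orbT.
  - by rewrite ge_max bi.
  - by apply: (adm_le hF ai) => //; rewrite le_max lexx.
have valS r w : sp_val aS bS xi r w = ep_val E r w * (s < r)%R%:R.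
  rewrite /sp_val mulr_suml; apply: eq_bigr => j _.
  by rewrite indic_after mulrA.
(* signed union of the part of E before s with -E', of small norm on [0, s] *)
pose J : finType := (I + I')%type.
pose aJ (j : J) := match j with inl i => a i | inr i => a' i end.
pose bJ (j : J) := match j with inl i => Num.max (a i) (Num.min (b i) s) | inr i => b' i end.
pose xJ (j : J) := match j with inl i => xi i | inr i => fun w => - xi' i w end.
have hJ (j : J) : [/\ 0 <= aJ j, aJ j <= bJ j, bJ j <= t & adm F (aJ j) (xJ j)].
  case: j => j /=.
    have [ai abi bi xii] := hE j; split => //; first by rewrite le_max lexx.
    by rewrite ge_max (le_trans abi bi) ge_min bi.
  have [ai abi bi xii] := hE' j; split => //; first exact: le_trans st.
  exact: (admN hF ai xii).
have aJ0 j : 0 <= aJ j by have [] := hJ j.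
have abJ j : aJ j <= bJ j by have [] := hJ j.
have bJt j : bJ j <= t by have [] := hJ j.
have admJ j : adm F (aJ j) (xJ j) by have [] := hJ j.
have intJ w : sp_int B aJ bJ xJ m w = sp_int B a (fun j => Num.max (a j) (Num.min (b j) s)) xi m w - ep_int E' (B m) w.
  rewrite /sp_int big_sumType/=; congr (_ + _).
  by rewrite -sumrN; apply: eq_bigr => j _; rewrite mulNr.
have valJ r w : sp_val aJ bJ xJ r w = ep_val E r w * (r <= s)%R%:R - ep_val E' r w.
  rewrite /sp_val big_sumType/=; congr (_ + _).
    rewrite mulr_suml; apply: eq_bigr => j _; have [_ abj _ _] := hE j.
    by rewrite indic_before// mulrA.
  by rewrite -sumrN; apply: eq_bigr => j _; rewrite mulNr.
have val' r w : s < r -> ep_val E' r w = 0.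
  move=> sr; rewrite /ep_val big1// => j _; have [_ _ bs _] := hE' j.
  rewrite indicE mem_setE in_itv/= [r <= _]leNgt (le_lt_trans bs sr) andbF mulr0//.
have mval : jointly_measurable t (ep_val E).
  apply: measurable_funTS; apply: (measurable_sp_val hF b (a := a) (xi := xi)) => i; by have [] := hE i.
have mval' : jointly_measurable t (ep_val E').
  apply: measurable_funTS; apply: (measurable_sp_val hF b' (a := a') (xi := xi')) => i; by have [] := hE' i.
have mvalJ : jointly_measurable t (sp_val aJ bJ xJ).
  apply: measurable_funTS; exact: (measurable_sp_val hF bJ aJ0 admJ).
have sJ : L2 (sp_int B aJ bJ xJ m).
  exact: (sp_int_sq_int hF hB aJ0 abJ admJ).
have EJ : EP (fun w => sp_int B aJ bJ xJ m w ^+ 2) <= 4 * d.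
  rewrite (Ex_sp_int_sqr hF hB aJ0 abJ admJ) -lee_fin.
  rewrite -(L2_process_norm2_sp_val P hF aJ0 admJ bJt).
  have := @L2_process_norm2_leD _ _ _ P t (sp_val aJ bJ xJ) (fun r w => ep_val E r w - H r w)
    (fun r w => (ep_val E' r w - H r w) * (r <= s)%R%:R) 2 2.
  move=> /(_ ltac:(by []) ltac:(by [])) /(_ mvalJ (jointly_measurableB mval mH)).
  move=> /(_ (jointly_measurable_le s (jointly_measurableB mval' mH))) h.
  apply: (le_trans (h _)).
    move=> r w _; rewrite valJ; have [rs|sr] := leP r s.
      rewrite !mulr1 (_ : _ - _ = (ep_val E r w - H r w) - (ep_val E' r w - H r w)); last by ring.
      exact: sqrB_le2.
    by rewrite val'// !mulr0 subr0 expr0n/= mulr0 addr0 mulr_ge0// sqr_ge0.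
  rewrite L2_process_norm2_restrict//.
  have -> : (4 * d)%:E = (2%:E * d%:E + 2%:E * d%:E)%E by rewrite -!EFinM -EFinD; congr EFin; ring.
  by apply: leeD; apply: lee_wpmul2l => //; exact: ltW.
have dec w : It w - Is w - sp_int B aS bS xi m w =
    sp_int B aJ bJ xJ m w - (ep_int E (B m) w - It w) + (ep_int E' (B m) w - Is w).
  rewrite intJ.
  have -> : ep_int E (B m) w = sp_int B a (fun j => Num.max (a j) (Num.min (b j) s)) xi m w + sp_int B aS bS xi m w.
    rewrite /sp_int -big_split/=; apply: eq_bigr => j _; rewrite -mulrDr.
    by have [_ abj _ _] := hE j; rewrite /aS /bS incr_split.
  ring.
have sdec : L2 (fun w => sp_int B aJ bJ xJ m w - (ep_int E (B m) w - It w) + (ep_int E' (B m) w - Is w)).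
  by apply: sq_intD => //; exact: sq_intB.
have decE : (fun w => It w - Is w - sp_int B aS bS xi m w) = (fun w =>
    sp_int B aJ bJ xJ m w - (ep_int E (B m) w - It w) + (ep_int E' (B m) w - Is w)) by apply/funext.
split => //; first by rewrite decE.
- rewrite (_ : (fun w => _ ^+ 2) = (fun w =>
    (sp_int B aJ bJ xJ m w - (ep_int E (B m) w - It w) + (ep_int E' (B m) w - Is w)) ^+ 2)); last first.
    by apply/funext => w; rewrite dec.
  apply: (le_trans (Ex_sqrD (sq_intB sJ E2) E2')).
  have := Ex_sqrD sJ (sq_intZ (-1) E2).
  rewrite (_ : (fun w => (_ + -1 * _) ^+ 2) = (fun w => (sp_int B aJ bJ xJ m w - (ep_int E (B m) w - It w)) ^+ 2)); last first.
    by apply/funext => w; rewrite mulN1r.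
  rewrite (_ : (fun w => (-1 * _) ^+ 2) = (fun w => (ep_int E (B m) w - It w) ^+ 2)); last first.
    by apply/funext => w; rewrite mulN1r sqrrN.
  move: EJ E3 E3'; rewrite /d; move: (EP _) (EP _) (EP _) (EP _) => x1 x2 x3 x4; lra.
(* After s the truncated difference is that of E and H, before s it vanishes: this is plain
   domination, hence the weights 1 and 0. *)
have := @L2_process_norm2_leD _ _ _ P t (fun r w => sp_val aS bS xi r w - H r w * (s < r)%R%:R)
  (fun r w => ep_val E r w - H r w) (fun r w => ep_val E r w - H r w) 1 0.
move=> /(_ ltac:(by []) ltac:(by [])).
have mS : jointly_measurable t (fun r w => sp_val aS bS xi r w - H r w * (s < r)%R%:R).
  apply: jointly_measurableB; last exact: jointly_measurable_lt.
  apply: measurable_funTS; apply: (measurable_sp_val hF) => i; have [sa _ _ ?] := hS i => //.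
  exact: le_trans sa.
move=> /(_ mS (jointly_measurableB mval mH) (jointly_measurableB mval mH)) h.
apply: (le_trans (h _)).
  move=> r w _; rewrite valS mul1r mul0r addr0 -mulrBl exprMn ler_piMr ?sqr_ge0//.
  by case: (s < r)%R; rewrite ?expr1n ?expr0n.
rewrite mul1e mul0e adde0 (le_trans (ltW E1))// lee_fin /d; lra.
Qed.

End ito_increment.

Section ito_increment_theorem.
Context disp (Omega : measurableType disp) (R : realType) (P : probability Omega R).
Variables (F : R -> set (set Omega)) (M : nat) (B : 'I_M -> R -> Omega -> R).
Hypotheses (hF : filtration F) (hB : brownian_motion P F B).
Local Notation EP := (Ex P).
Local Notation L1 := (int1 P).
Local Notation L2 := (sq_int P).
Local Notation D := (incr B).
Variables (m : 'I_M) (s t : R) (H : R -> Omega -> R) (Is It c : Omega -> R).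
Hypotheses (s0 : 0 <= s) (st : s <= t).
Hypotheses (hs : ito_integral P F (B m) s H Is) (ht : ito_integral P F (B m) t H It).
Hypothesis hc : adm F s c.
Let J w := It w - Is w - c w * D m s t w.

Let cD2 : L2 (fun w => c w * D m s t w).
Proof. by apply: (adm_sq_int hF s0 hc); exact: (incr_sq_int hF hB m s0 st). Qed.

Lemma ito_increment_sq_int : L2 J.
Proof.
have [I [a [b [xi [hS X2 _ _]]]]] := ito_increment_approx hF hB s0 st ltr01 hs ht.
have sS : L2 (sp_int B a b xi m).
  apply: (sp_int_sq_int hF hB) => i; have [sa ? _ ?] := hS i => //.
  exact: le_trans sa.
have := sq_intB (sq_intD X2 sS) cD2.
by congr sq_int; apply/funext => w; rewrite /J; ring.
Qed.

Lemma ito_increment_orth (Z : Omega -> R) : adm F s Z -> EP (fun w => Z w * J w) = 0.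
Proof.
move=> hZ; have mZ := adm_measurable hF s0 hZ.
have Z2 : L2 Z by case: hZ => _ [K zK]; exact: sq_int_bnd zK.
apply/eqP; rewrite -normr_le0.
apply: (@le0_of_small _ _ (EP (fun w => Z w ^+ 2) + 1)) => e e0 _.
(* The tolerance is [e ^+ 2] because Young's inequality divides it by [e]. *)
have [I [a [b [xi [hS X2 Xe _]]]]] := ito_increment_approx hF hB s0 st (exprn_gt0 2 e0) hs ht.
have a0 i : 0 <= a i by have [sa _ _ _] := hS i; exact: le_trans sa.
have ab i : a i <= b i by have [] := hS i.
have ax i : adm F (a i) (xi i) by have [] := hS i.
have sS : L2 (sp_int B a b xi m) by exact: (sp_int_sq_int hF hB a0 ab ax).
set X := fun w => It w - Is w - sp_int B a b xi m w in X2 Xe.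
have JE w : Z w * J w = Z w * X w + (Z w * sp_int B a b xi m w - Z w * (c w * D m s t w)).
  by rewrite /J /X; ring.
have i1 : L1 (fun w => Z w * X w) by exact: sq_intM.
have i2 : L1 (fun w => Z w * sp_int B a b xi m w) by exact: sq_intM.
have i3 : L1 (fun w => Z w * (c w * D m s t w)) by exact: sq_intM.
have E2 : EP (fun w => Z w * sp_int B a b xi m w) = 0.
  have sD i : L2 (fun w => xi i w * D m (a i) (b i) w).
    by apply: (adm_sq_int hF (a0 i) (ax i)); exact: (incr_sq_int hF hB).
  rewrite (_ : (fun _ => _) = fun w => \sum_i Z w * (xi i w * D m (a i) (b i) w)).
    rewrite Ex_sum => [|i _]; last exact: sq_intM.
    rewrite big1// => i _; have [sa _ _ _] := hS i.
    have hZi := admM hF (a0 i) (adm_le hF s0 sa hZ) (ax i).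
    rewrite -[RHS](Ex_sigma_incr hF hB m (a0 i) (ab i) (proj1 hZi)).
      by congr EP; apply/funext => w; rewrite mulrA.
    by case: (hZi) => _ [K zK]; exact: sq_int_bnd (adm_measurable hF (a0 i) hZi) zK.
  by apply/funext => w; rewrite /sp_int mulr_sumr.
have E3 : EP (fun w => Z w * (c w * D m s t w)) = 0.
  have hZc := admM hF s0 hZ hc.
  rewrite -[RHS](Ex_sigma_incr hF hB m s0 st (proj1 hZc)).
    by congr EP; apply/funext => w; rewrite mulrA.
  by case: (hZc) => _ [K zK]; exact: sq_int_bnd (adm_measurable hF s0 hZc) zK.
rewrite (_ : (fun w => Z w * J w) = fun w => Z w * X w + (Z w * sp_int B a b xi m w - Z w * (c w * D m s t w))); last first.
  by apply/funext.
rewrite ExD//; last exact: int1B.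
rewrite ExB// E2 E3 subrr addr0 (le_trans (Ex_AMGM e0 Z2 X2))// mulrDr mulr1 lerD2l.
by rewrite mulrC ler_pdivrMr// -expr2.
Qed.

Lemma ito_increment_bound (K : R) : 0 <= K ->
  (forall r, s < r <= t -> (\int[P]_w ((H r w - c w) ^+ 2)%:E <= K%:E)%E) ->
  EP (fun w => J w ^+ 2) <= 4 * (K * (t - s)).
Proof.
move=> K0 HK; rewrite -subr_le0.
(* Two uses of (x + y)^2 <= 2x^2 + 2y^2 give the bound 2e + 2(2e + 2K(t - s)), whence the 6 here and
   the 4 in the statement. *)
apply: (@le0_of_small _ _ 6) => e e0 _.
have t0 := le_trans s0 st.
have mH : jointly_measurable t H by case: ht => -[].
have [I [a [b [xi [hS X2 Xe Xn]]]]] := ito_increment_approx hF hB s0 st e0 hs ht.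
have a0 i : 0 <= a i by have [sa _ _ _] := hS i; exact: le_trans sa.
have ab i : a i <= b i by have [] := hS i.
have bt i : b i <= t by have [] := hS i.
have ax i : adm F (a i) (xi i) by have [] := hS i.
(* the additional index stands for - c on ]s, t] *)
pose I1 : finType := (I + 'I_1)%type.
pose a1 (i : I1) := if i is inl j then a j else s.
pose b1 (i : I1) := if i is inl j then b j else t.
pose x1 (i : I1) := if i is inl j then xi j else fun w => - c w.
have a10 i : 0 <= a1 i by case: i.
have ab1 i : a1 i <= b1 i by case: i.
have bt1 i : b1 i <= t by case: i.
have hNc := admN hF s0 hc.
have ax1 i : adm F (a1 i) (x1 i) by case: i.
have sS := sp_int_sq_int hF hB a10 ab1 ax1 m.
have intE w : sp_int B a1 b1 x1 m w = sp_int B a b xi m w - c w * D m s t w.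
  by rewrite /sp_int big_sumType/= big_ord1 mulNr.
have valE r w : sp_val a1 b1 x1 r w = sp_val a b xi r w - c w * \1_`]s, t] r.
  by rewrite /sp_val big_sumType/= big_ord1 mulNr.
have ES : EP (fun w => sp_int B a1 b1 x1 m w ^+ 2) <= 2 * e + 2 * (K * (t - s)).
  rewrite (Ex_sp_int_sqr hF hB a10 ab1 ax1) -lee_fin.
  rewrite -(L2_process_norm2_sp_val P hF a10 ax1 bt1).
  pose H' r w := (H r w - c w) * (s < r)%R%:R.
  have mc : jointly_measurable t (fun _ w => c w).
    apply: measurable_funTS; apply: (measurableT_comp (adm_measurable hF s0 hc)).
    exact: measurable_snd.
  have mval : jointly_measurable t (sp_val a b xi).
    by apply: measurable_funTS; exact: (measurable_sp_val hF b a0 ax).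
  have mval1 : jointly_measurable t (sp_val a1 b1 x1).
    by apply: measurable_funTS; exact: (measurable_sp_val hF b1 a10 ax1).
  have mH' : jointly_measurable t H'.
    by apply: jointly_measurable_lt; exact: jointly_measurableB.
  have := @L2_process_norm2_leD _ _ _ P t (sp_val a1 b1 x1)
    (fun r w => sp_val a b xi r w - H r w * (s < r)%R%:R) H' 2 2.
  move=> /(_ ltac:(by []) ltac:(by [])) /(_ mval1 (jointly_measurableB mval (jointly_measurable_lt s mH)) mH') h.
  apply: (le_trans (h _)).
    move=> r w /andP[r0 rt]; rewrite valE indicE mem_setE in_itv/= rt andbT.
    rewrite (_ : _ - c w * _ = (sp_val a b xi r w - H r w * (s < r)%R%:R) - (- H' r w)); last by rewrite /H'; ring.
    by apply: (le_trans (sqrB_le2 _ _)); rewrite sqrrN.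
  rewrite (_ : (2 * e + _)%:E = 2%:E * e%:E + 2%:E * (K * (t - s))%:E)%E; last first.
    by rewrite -!EFinM -EFinD.
  apply: leeD; apply: lee_wpmul2l => //; apply: L2_process_norm2_bound => //.
    move=> r /[dup] /andP[sr rt] rst; apply: le_trans (HK r rst).
    by rewrite /H' sr; under eq_integral do rewrite mulr1.
  by move=> r w rs; rewrite /H' ltNge rs mulr0.
have -> : (fun w => J w ^+ 2) = (fun w => ((It w - Is w - sp_int B a b xi m w) + sp_int B a1 b1 x1 m w) ^+ 2).
  by apply/funext => w; rewrite intE /J; congr (_ ^+ 2); ring.
have := Ex_sqrD X2 sS; move: Xe ES.
move: (EP _) (EP _) (EP _) => x2 x3 x4; set k := K * _; lra.
Qed.

End ito_increment_theorem.

(** * Calculus on the cube *)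

Section pderiv_calculus.
Variables (R : realType) (n : nat) (A : set 'rV[R]_n) (i : 'I_n) (f : 'rV[R]_n -> R).
Local Notation e := (delta_mx 0 i : 'rV[R]_n).

Lemma within_near (T : Type) (F : set_system T) (D : set T) : Filter F -> F D -> within D F = F.
Proof.
move=> FF FD; apply/funext => Q; apply/propext; split => [FQ|FQ].
  by apply: filterS2 FD FQ => x Dx; exact.
by apply: filterS FQ.
Qed.

(** Where the line stays in [A] near [u], restricting the increments does not change the punctured
    neighbourhood filter, and the quotient is the usual two-sided one. *)
Lemma pderiv_is_derive (x : 'rV[R]_n) (u : R) :
  (\forall h \near (0 : R), A (x + (u + h) *: e)) ->
  cvg (pquot A i f (x + u *: e)) ->
  is_derive u 1 (fun v : R => f (x + v *: e)) (pderiv A i f (x + u *: e)).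
Proof.
move=> nA; rewrite /pderiv /pquot.
have E (h : R) : x + u *: e + h *: e = x + (u + h) *: e by rewrite scalerDl addrA.
rewrite (within_near (F := (0 : R)^')); last first.
  by rewrite /dnbhs /within/=; apply: filterS nA => h; rewrite E.
have -> : (fun h : R => h^-1 * (f (x + u *: e + h *: e) - f (x + u *: e))) =
    (fun h : R => h^-1 *: (((fun v : R => f (x + v *: e)) \o shift u) (h *: 1) - f (x + u *: e))).
  apply/funext => h; rewrite E /=; congr (_ * (f (x + _ *: e) - _)).
  by rewrite [h *: 1]mulr1 addrC.
by move=> c; apply: DeriveDef.
Qed.

Lemma within_continuous_line (x : 'rV[R]_n) (a b : R) : {within A, continuous f} ->
  (forall u, a <= u <= b -> A (x + u *: e)) ->
  {within `[a, b], continuous (fun v : R => f (x + v *: e))}.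
Proof.
move=> /subspace_continuousP cf hA; apply/subspace_continuousP => u ab.
have cl : {for u, continuous (fun v : R => x + v *: e)}.
  by apply: cvgD; [exact: cvg_cst|exact: scalel_continuous].
apply: cvg_trans (cf _ (hA u _)); last by move: ab; rewrite /= in_itv.
move=> Q /= h.
have := cl _ h; rewrite /within/= => h'.
change (nbhs u (fun v => `[a, b]%classic v -> Q (f (x + v *: e)))).
have {}h' : nbhs u (fun v => A (x + v *: e) -> Q (f (x + v *: e))) by exact: h'.
apply: filterS h' => v /= hv vab; apply: hv; apply: hA.
by move: vab; rewrite in_itv.
Qed.

(** Two-sided derivatives are taken only in the open segment; at its ends, which may be boundary
    points of [A], the mean value theorem asks only for continuity relative to [A]. *)
Lemma pderiv_MVT (x : 'rV[R]_n) (v : R) : 0 <= v ->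
  (forall u, 0 <= u <= v -> A (x + u *: e)) -> {within A, continuous f} ->
  (forall x, A x -> cvg (pquot A i f x)) ->
  exists2 u, 0 <= u <= v & f (x + v *: e) - f x = pderiv A i f (x + u *: e) * v.
Proof.
move=> v0 hA cf df.
have H (u : R) : u \in `]0, v[%R ->
    is_derive u 1 (fun w : R => f (x + w *: e)) (pderiv A i f (x + u *: e)).
  rewrite in_itv/= => /andP[u0 uv]; apply: pderiv_is_derive; last first.
    by apply: df; apply: hA; rewrite !ltW.
  near=> h; apply: hA; apply/andP; split.
    have : - h <= u.
      by rewrite ltW//; near: h; apply: (cvgr_lt 0); [rewrite -[X in _ --> X]oppr0; exact: cvgN|].
    lra.
  have : h <= v - u by rewrite ltW//; near: h; apply: (cvgr_lt 0); rewrite ?subr_gt0//; exact: cvg_id.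
  lra.
have [u] := MVT_segment v0 H (within_continuous_line cf hA).
rewrite in_itv/= => uv; rewrite scale0r addr0 subr0 => E.
by exists u.
Unshelve. all: by end_near. Qed.

End pderiv_calculus.

Section cube.
Variables (R : realType) (d : nat).
Implicit Types x y : 'rV[R]_d.
Local Notation cube := (@cube R d).

Lemma compact_cube : compact cube.
Proof.
have := @rV_compact _ d (fun=> `[-1, 1]%classic : set R) (fun=> @segment_compact R (-1) 1).
congr compact; apply/seteqP; split => x /= xc k; have := xc k; rewrite ?in_itv//.
Qed.

Lemma cube_bounded (f : 'rV[R]_d -> R) : {within cube, continuous f} ->
  exists2 K, 0 <= K & forall x, cube x -> `|f x| <= K.
Proof.
move=> cf; have /compact_bounded[K [_ hK]] := continuous_compact cf compact_cube.
exists (`|K| + 1); first by rewrite addr_ge0.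
move=> x cx; apply: hK; last by exists x.
by rewrite (le_lt_trans (ler_norm K))// ltrDl.
Qed.

Lemma delta_coord x (u : R) (i k : 'I_d) : (x + u *: delta_mx 0 i) 0 k = x 0 k + u * (k == i)%:R.
Proof. by rewrite !mxE eqxx. Qed.

Lemma cube_line x (u v : R) (i : 'I_d) : cube x -> cube (x + v *: delta_mx 0 i) ->
  0 <= u <= v -> cube (x + u *: delta_mx 0 i).
Proof.
move=> cx cv /andP[u0 uv] k; have := cv k; have := cx k; rewrite !delta_coord.
by case: eqP => _; rewrite ?mulr1 ?mulr0 => /andP[? ?] /andP[? ?]; apply/andP; split; lra.
Qed.

(** Coordinates are changed one at a time. The cube being a product, the intermediate points stay in
    it, and each move follows an axis, where the bound on one partial derivative applies. *)
Lemma cube_lipschitz (f : 'rV[R]_d -> R) : class_C 1 cube f ->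
  exists2 L, 0 <= L & forall x y, cube x -> cube y ->
    `|f x - f y| <= L * \sum_k `|x 0 k - y 0 k|.
Proof.
case=> cf df.
have [K K0 hK] : exists2 K, 0 <= K & forall i x, cube x -> `|pderiv cube i f x| <= K.
  have /choice[K hK] : forall i, exists K, 0 <= K /\ forall x, cube x -> `|pderiv cube i f x| <= K.
    move=> i; have [_ [+ _]] := df i; move=> /cube_bounded[K K0 hK].
    by exists K.
  exists (\sum_i K i); first by apply: sumr_ge0 => i _; have [] := hK i.
  move=> i x cx; have [_ /(_ x cx) h] := hK i; apply: (le_trans h).
  by rewrite (bigD1 i)//= lerDl sumr_ge0// => j _; have [] := hK j.
have line x (v : R) i : cube x -> cube (x + v *: delta_mx 0 i) -> 0 <= v ->
    `|f (x + v *: delta_mx 0 i) - f x| <= K * `|v|.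
  move=> cx cv v0.
  have [|u uv ->] := @pderiv_MVT _ _ cube i f x v v0 _ cf (proj1 (df i)).
    by move=> u; exact: cube_line.
  by rewrite normrM ler_wpM2r// hK//; exact: cube_line cv uv.
have line2 x (v : R) i : cube x -> cube (x + v *: delta_mx 0 i) ->
    `|f (x + v *: delta_mx 0 i) - f x| <= K * `|v|.
  move=> cx cv; have [v0|/ltW v0] := leP 0 v; first exact: line.
  have := line _ (- v) i cv; rewrite scaleNr addrK normrN distrC oppr_ge0.
  by apply.
exists K => // x y cx cy.
pose z j : 'rV[R]_d := \row_k (if (k < j)%N then y 0 k else x 0 k).
have cz j : cube (z j) by move=> k; rewrite mxE; case: ifP.
have zS (j : 'I_d) : z j.+1 = z j + (y 0 j - x 0 j) *: delta_mx 0 j.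
  apply/rowP => k; rewrite delta_coord !mxE ltnS; case: eqP => [->|/eqP kj].
    by rewrite leqnn ltnn mulr1; ring.
  by rewrite mulr0 addr0 leq_eqVlt val_eqE (negbTE kj).
have H j : (j <= d)%N -> `|f x - f (z j)| <= K * \sum_(k < d | (k < j)%N) `|x 0 k - y 0 k|.
  elim: j => [_|j IH jd].
    have -> : z 0%N = x by apply/rowP => k; rewrite mxE.
    by rewrite subrr normr0 mulr_ge0// sumr_ge0.
  rewrite (bigD1 (Ordinal jd))/= ?ltnS//.
  have -> : f x - f (z j.+1) = (f x - f (z j)) + (f (z j) - f (z j.+1)) by ring.
  apply: (le_trans (ler_normD _ _)); rewrite mulrDr [leRHS]addrC; apply: lerD; last first.
    have E := zS (Ordinal jd); rewrite /= in E.
    rewrite distrC E (distrC (x 0 _)); apply: line2; first exact: cz.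
    by rewrite -E.
  apply: (le_trans (IH (ltnW jd))); apply: ler_wpM2l => //.
  rewrite le_eqVlt; apply/orP; left; apply/eqP; apply: eq_bigl => k.
  by rewrite ltnS [RHS]andbC -val_eqE /= ltn_neqAle andbC.
have := H d (leqnn d); have -> : z d = y by apply/rowP => k; rewrite mxE ltn_ord.
by under eq_bigl do rewrite ltn_ord.
Qed.

End cube.

(** The sum of the individual bounds is a common one, also when [I] is empty. *)
Lemma fin_uniform_bound (R : realType) (I : finType) (Q : I -> R -> Prop) :
  (forall i K K', K <= K' -> Q i K -> Q i K') -> (forall i, exists2 K, 0 <= K & Q i K) ->
  exists2 K, 0 <= K & forall i, Q i K.
Proof.
move=> mono ex; have /choice[K hK] : forall i, exists K, 0 <= K /\ Q i K.
  by move=> i; have [K ? ?] := ex i; exists K.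
exists (\sum_i K i); first by apply: sumr_ge0 => i _; have [] := hK i.
move=> i; have [_] := hK i; apply: mono.
by rewrite (bigD1 i)//= lerDl sumr_ge0// => j _; have [] := hK j.
Qed.

Lemma cube_uniform_lipschitz (R : realType) d (I J : finType) (h : I -> J -> 'rV[R]_d -> R) :
  (forall i j, class_C 1 (@cube R d) (h i j)) ->
  exists2 L, 0 <= L & forall i j x y, cube x -> cube y ->
    `|h i j x - h i j y| <= L * \sum_l `|x 0 l - y 0 l|.
Proof.
move=> Ch; have [|[i j]|L L0 hL] := @fin_uniform_bound R (I * J)%type (fun ij L =>
    forall x y, cube x -> cube y ->
      `|h ij.1 ij.2 x - h ij.1 ij.2 y| <= L * \sum_l `|x 0 l - y 0 l|).
- move=> ij K K' KK' hK x y cx cy.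
  by apply: le_trans (hK x y cx cy) _; rewrite ler_wpM2r// sumr_ge0.
- exact: cube_lipschitz (Ch i j).
- by exists L => // i j; exact: hL (i, j).
Qed.

Lemma cube_uniform_bound (R : realType) d (I J : finType) (h : I -> J -> 'rV[R]_d -> R) :
  (forall i j, {within @cube R d, continuous (h i j)}) ->
  exists2 K, 0 <= K & forall i j x, cube x -> `|h i j x| <= K.
Proof.
move=> ch; have [|[i j]|K K0 hK] := @fin_uniform_bound R (I * J)%type (fun ij K =>
    forall x, cube x -> `|h ij.1 ij.2 x| <= K).
- by move=> ij K K' KK' hK x cx; exact: le_trans (hK x cx) KK'.
- exact: cube_bounded (ch i j).
- by exists K => // i j; exact: hK (i, j).
Qed.

(** * The integrator and the scheme *)

Section integrator.
Variables (R : realType) (Phi : R -> R -> R -> R) (beta : R).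
Local Notation dom := (@int_dom R).
Hypothesis Phi3 : class_C 3 dom (uncurry3 Phi).
Hypothesis Phi0 : forall y, -1 <= y <= 1 ->
  [/\ Phi 0 0 y = y, dPhi Phi 0 1 0 0 0 y = sigma y &
      dPhi Phi 1 0 0 0 0 y + 2^-1 * dPhi Phi 0 2 0 0 0 y = 0].
Hypotheses (beta0 : 0 < beta) (Phi_norm : (norm_p_beta 3 beta Phi < +oo)%E).

Lemma class_C_iter (n : nat) (A : set 'rV[R]_n) (i : 'I_n) (f : 'rV[R]_n -> R) (b p : nat) :
  class_C (b + p) A f -> class_C p A (iter b (pderiv A i) f).
Proof.
elim: b p => [//|b IH] p; rewrite addSnnS => /IH[_ h].
by have [] := h i.
Qed.

Lemma class_C1 (n : nat) (A : set 'rV[R]_n) (f : 'rV[R]_n -> R) (p : nat) :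
  class_C p.+1 A f -> class_C 1 A f.
Proof.
case=> c1 c2; split => // i; have [c3 c4] := c2 i; split => //; split => //.
by case: p c2 c4 => [|p] _ [].
Qed.

(** All suprema in [norm_p_beta] are nonnegative, so the finite total bounds each of them; the
    decaying weight becomes a growing exponential on the right. *)
Lemma dPhi_bound : exists2 K, 0 <= K & forall a b s gamma y, (a + b <= 3)%N ->
  0 <= s -> -1 <= y <= 1 ->
  `|dPhi Phi a b 0 s gamma y| <= K * expR (beta * (s + `|gamma|)).
Proof.
pose S (a b c : nat) := [set u : \bar R | exists s gamma y : R,
  [/\ (0 <= s)%R, (-1 <= y <= 1)%R &
   u = (expR (- beta * (s + `|gamma|)) * `|dPhi Phi a b c s gamma y|)%:E]].
have S0 a b c : (0 <= ereal_sup (S a b c))%E.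
  apply: (@le_trans _ _ (expR (- beta * (0 + `|0 : R|)) * `|dPhi Phi a b c 0 0 0|)%:E).
    by rewrite lee_fin mulr_ge0// expR_ge0.
  have h : S a b c (expR (- beta * (0 + `|0 : R|)) * `|dPhi Phi a b c 0 0 0|)%:E.
    exists 0, 0, 0. split; [exact: lexx|by rewrite lerN10 ler01|reflexivity].
  exact: (ereal_sup_ubound h).
have Sle (a b : nat) : (a + b <= 3)%N -> (ereal_sup (S a b 0%N) <= norm_p_beta 3 beta Phi)%E.
  move=> ab; rewrite /norm_p_beta.
  have a4 : (a < 4)%N by rewrite ltnS (leq_trans _ ab)// leq_addr.
  have b4 : (b < 4)%N by rewrite ltnS (leq_trans _ ab)// leq_addl.
  rewrite (bigD1 (Ordinal a4))//= (bigD1 (Ordinal b4))//= (bigD1 ord0)/= ?addn0//.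
  rewrite -!addeA leeDl// adde_ge0//; first by apply: sume_ge0 => c _; exact: S0.
  rewrite adde_ge0//.
    by apply: sume_ge0 => c _; apply: sume_ge0 => c' _; exact: S0.
  by apply: sume_ge0 => c'' _; apply: sume_ge0 => c _; apply: sume_ge0 => c' _; exact: S0.
have N0 : (0 <= norm_p_beta 3 beta Phi)%E by apply: le_trans (Sle 0%N 0%N _); rewrite ?S0.
have Nf : norm_p_beta 3 beta Phi \is a fin_num by rewrite ge0_fin_numE.
exists (fine (norm_p_beta 3 beta Phi)); first exact: fine_ge0.
move=> a b s gamma y ab s0 yI; rewrite -ler_pdivrMr ?expR_gt0// -expRN mulrC -mulNr.
rewrite -lee_fin fineK//; apply: le_trans (Sle a b ab).
by apply: ereal_sup_ubound; exists s, gamma, y.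
Qed.

Lemma vec3_0 (s g y v : R) : vec3 s g y + v *: delta_mx 0 0 = vec3 (s + v) g y.
Proof.
apply/rowP => k; rewrite !mxE eqxx/=.
by case: k => -[|[|[|//]]] k3 /=; rewrite ?mulr1 ?mulr0 ?addr0.
Qed.

Lemma vec3_1 (s g y v : R) : vec3 s g y + v *: delta_mx 0 1 = vec3 s (g + v) y.
Proof.
apply/rowP => k; rewrite !mxE eqxx/=.
by case: k => -[|[|[|//]]] k3 /=; rewrite ?mulr1 ?mulr0 ?addr0.
Qed.

Lemma int_dom_vec3 (s g y : R) : 0 <= s -> -1 <= y <= 1 -> dom (vec3 s g y).
Proof. by move=> s0 y1; rewrite /int_dom /= !mxE. Qed.

(** As gamma ranges over the whole line, lines in its direction never leave the domain, and the
    partial derivative is two-sided. *)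
Lemma dPhi_gamma (b : nat) (s y g : R) : (b < 3)%N -> 0 <= s -> -1 <= y <= 1 ->
  is_derive g 1 (fun g : R => dPhi Phi 0 b 0 s g y) (dPhi Phi 0 b.+1 0 s g y).
Proof.
move=> b3 s0 y1; rewrite /dPhi /=.
have C1 : class_C 1 dom (iter b (pderiv dom 1) (uncurry3 Phi)).
  apply: (@class_C1 _ _ _ (2 - b)); apply: class_C_iter.
  by move: Phi3; congr class_C; case: b b3 => [|[|[|]]].
have [_ /(_ 1) [cq _]] := C1.
have E (v : R) : vec3 s v y = vec3 s 0 y + v *: delta_mx 0 1 by rewrite vec3_1 add0r.
rewrite E (_ : (fun _ => _) = fun v : R => iter b (pderiv dom 1) (uncurry3 Phi) (vec3 s 0 y + v *: delta_mx 0 1)).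
  apply: pderiv_is_derive; last by apply: cq; rewrite -E; exact: int_dom_vec3.
  by apply: filterE => h; rewrite -E; exact: int_dom_vec3.
by apply/funext => v; rewrite E.
Qed.

(** In s the domain ends at 0, where the derivative is one-sided; hence a mean value form on [0, s]
    in place of [is_derive]. *)
Lemma dPhi_s (a b : nat) (s y g : R) : (a + b < 3)%N -> 0 <= s -> -1 <= y <= 1 ->
  exists2 u, 0 <= u <= s &
    dPhi Phi a b 0 s g y - dPhi Phi a b 0 0 g y = dPhi Phi a.+1 b 0 u g y * s.
Proof.
move=> ab s0 y1; rewrite /dPhi /=.
have C1 : class_C 1 dom (iter a (pderiv dom 0) (iter b (pderiv dom 1) (uncurry3 Phi))).
  apply: (@class_C1 _ _ _ (2 - (a + b))); do 2 apply: class_C_iter.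
  move: Phi3; congr class_C.
  by case: a ab => [|[|[|]]]; case: b => [|[|[|]]].
have [cF /(_ 0) [cq _]] := C1.
have [|u us E] := @pderiv_MVT _ _ dom 0 _ (vec3 0 g y) s s0 _ cF cq.
  by move=> u /andP[u0 _]; rewrite vec3_0 add0r; exact: int_dom_vec3.
by exists u => //; move: E; rewrite !vec3_0 !add0r.
Qed.

(** [Ph] and [Ph0] stand for Phi at (s, g, y) and (s, 0, y), [d1] and [d2] for the gamma-derivatives
    at (s, 0, y), [pu] for the s-derivative at (u, 0, y), and [sg], [p], [q] for derivatives at (0,
    0, y). The relation p = -q/2 merges [p * s] and [g ^+ 2 / 2 * q] into [q / 2 * (g ^+ 2 - s)]. *)
Lemma remainder_bound (Ph Ph0 d1 d2 y sg p q pu h2 h11 h12 u s g K : R) : 0 <= s -> 0 <= u <= s -> 0 <= K ->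
  Ph0 - y = pu * s -> pu - p = h2 * u -> d1 - sg = h11 * s -> d2 - q = h12 * s ->
  p + 2^-1 * q = 0 -> `|h2| <= K -> `|h11| <= K -> `|h12| <= K ->
  `|Ph - Ph0 - g * d1 - g ^+ 2 / 2 * d2| <= K * `|g| ^+ 3 ->
  `|Ph - y - g * sg - q / 2 * (g ^+ 2 - s)| <=
  K * (`|g| ^+ 3 + s ^+ 2 + `|g| * s + g ^+ 2 * s).
Proof.
move=> s0 /andP[u0 us] K0 E0 E1 E2 E3 E4 B0 B1 B2 T3.
have -> : Ph - y - g * sg - q / 2 * (g ^+ 2 - s) =
    (Ph - Ph0 - g * d1 - g ^+ 2 / 2 * d2) + h2 * u * s + h11 * (g * s) + h12 / 2 * (g ^+ 2 * s).
  have -> : Ph0 = y + pu * s by rewrite -E0; ring.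
  have -> : pu = p + h2 * u by rewrite -E1; ring.
  have -> : d1 = sg + h11 * s by rewrite -E2; ring.
  have -> : d2 = q + h12 * s by rewrite -E3; ring.
  have -> : p = - (2^-1 * q) by apply/eqP; rewrite -addr_eq0 E4.
  by field.
rewrite !mulrDr; apply: (le_trans (ler_normD _ _)); apply: lerD; last first.
  have gs0 : 0 <= g ^+ 2 * s by rewrite mulr_ge0 ?sqr_ge0.
  have h2' : `|h12 / 2| <= K.
    by apply: le_trans B2; rewrite normrM (@ger0_norm _ 2^-1) ?invr_ge0// ler_piMr// invf_le1 ?ler1n.
  by rewrite normrM (ger0_norm gs0) ler_wpM2r.
apply: (le_trans (ler_normD _ _)); apply: lerD; last first.
  by rewrite !normrM (ger0_norm s0) ler_wpM2r// mulr_ge0.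
apply: (le_trans (ler_normD _ _)); apply: lerD => //.
rewrite !normrM (ger0_norm s0) (ger0_norm u0) expr2 -mulrA ler_pM ?mulr_ge0//.
by rewrite ler_wpM2r.
Qed.

(* Expanding in gamma first, and then expanding the coefficients in s, avoids the
   symmetry of mixed derivatives. *)
Lemma Phi_expansion : exists2 K, 0 <= K &
  (forall y, -1 <= y <= 1 -> `|dPhi Phi 0 2 0 0 0 y| <= K) /\
  forall s g y, 0 <= s -> -1 <= y <= 1 ->
  `|Phi s g y - y - g * sigma y - dPhi Phi 0 2 0 0 0 y / 2 * (g ^+ 2 - s)| <=
  K * expR (beta * (s + `|g|)) * (`|g| ^+ 3 + s ^+ 2 + `|g| * s + g ^+ 2 * s).
Proof.
have [K K0 hK] := dPhi_bound; exists K => //; split => [y y1|s g y s0 y1].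
  by have := hK 0%N 2%N 0 0 y isT (lexx 0) y1; rewrite normr0 addr0 mulr0 expR0 mulr1.
have PhiE r : Phi s r y = dPhi Phi 0 0 0 s r y by rewrite /dPhi /uncurry3 /= !mxE.
have PhiE0 r : Phi r 0 y = dPhi Phi 0 0 0 r 0 y by rewrite /dPhi /uncurry3 /= !mxE.
set E := expR _.
have bnd r h a b : (a + b <= 3)%N -> 0 <= r <= s -> `|h| <= `|g| ->
    `|dPhi Phi a b 0 r h y| <= K * E.
  move=> ab /andP[r0 rs] hg; apply: (le_trans (hK a b r h y ab r0 y1)).
  by rewrite ler_wpM2l// ler_expR ler_wpM2l ?(ltW beta0)// lerD.
have T3 : `|Phi s g y - Phi s 0 y - g * dPhi Phi 0 1 0 s 0 y - g ^+ 2 / 2 * dPhi Phi 0 2 0 s 0 y| <= K * E * `|g| ^+ 3.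
  rewrite !PhiE.
  apply: (@taylor3 _ (fun g => dPhi Phi 0 0 0 s g y) (fun g => dPhi Phi 0 1 0 s g y)
      (fun g => dPhi Phi 0 2 0 s g y) (fun g => dPhi Phi 0 3 0 s g y) g (K * E)).
  - by move=> t; exact: (@dPhi_gamma 0 s y t).
  - by move=> t; exact: (@dPhi_gamma 1 s y t).
  - by move=> t; exact: (@dPhi_gamma 2 s y t).
  - by move=> t tg; apply: bnd => //; rewrite s0 lexx.
have n0 : `|0 : R| <= `|g| by rewrite normr0.
(* The value of Phi needs two mean value steps in s, since its linear term in s is kept; for the
   first two gamma-derivatives one step is enough. *)
have [u0 u0s E0] := @dPhi_s 0 0 s y 0 isT s0 y1.
have /andP[u00 u01] := u0s.
have [v0 /andP[v00 v0s] E00] := @dPhi_s 1 0 u0 y 0 isT u00 y1.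
have [u1 u1s E1] := @dPhi_s 0 1 s y 0 isT s0 y1.
have [u2 u2s E2] := @dPhi_s 0 2 s y 0 isT s0 y1.
have [P0 P1 P2] := Phi0 y1.
have B0 : `|dPhi Phi 2 0 0 v0 0 y| <= K * E by apply: bnd => //; rewrite v00 (le_trans v0s).
have B1 : `|dPhi Phi 1 1 0 u1 0 y| <= K * E by exact: bnd.
have B2 : `|dPhi Phi 1 2 0 u2 0 y| <= K * E by exact: bnd.
have KE : 0 <= K * E by rewrite mulr_ge0// expR_ge0.
move: E0; rewrite -!PhiE0 P0 => E0.
rewrite P1 in E1.
exact: (remainder_bound s0 u0s KE E0 E00 E1 E2 P2 B0 B1 B2 T3).
Qed.

End integrator.

(** * Measurability of functions continuous on a subset *)

Section measurable_within_continuous.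
Context d (T : measurableType d) (R : realType) (n : nat).
Implicit Types (A : set 'rV[R]_n) (f : 'rV[R]_n -> R) (x : T -> 'rV[R]_n).

Definition round_down (N : nat) (y : R) : R := (Num.floor (N.+1%:R * y))%:~R / N.+1%:R.

Lemma round_down_bounds N (y : R) : round_down N y <= y < round_down N y + N.+1%:R^-1.
Proof.
have N0 : 0 < N.+1%:R :> R by [].
have /andP[h1 h2] := floor_itv (N.+1%:R * y); apply/andP; split.
  by rewrite /round_down ler_pdivrMr// (mulrC y).
rewrite /round_down -[X in _ < _ + X]mul1r -mulrDl ltr_pdivlMr// (mulrC y).
by rewrite (lt_le_trans h2)// rmorphD.
Qed.

(* f is only continuous relatively to A, hence the countably valued approximations
   of x obtained by rounding, which stay in A. *)
Lemma measurable_within_continuous A f x : {within A, continuous f} ->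
  (forall N y, A y -> A (\row_k round_down N (y 0 k))) ->
  (forall w, A (x w)) -> (forall k, measurable_fun setT (fun w => x w 0 k)) ->
  measurable_fun setT (fun w => f (x w)).
Proof.
move=> /subspace_continuousP cf hA Ax mx.
(* [g N] is an arbitrary function, but of integer vectors: preimages under the composite are
   countable unions of preimages of single vectors by [z N], which are cut out by interval
   conditions on the coordinates. *)
pose z N w : 'rV[int]_n := \row_k Num.floor (N.+1%:R * x w 0 k).
pose g N (v : 'rV[int]_n) : R := f (\row_k ((v 0 k)%:~R / N.+1%:R)).
apply: (@measurable_fun_cvg _ _ _ _ (fun N w => g N (z N w))) => [N _ U mU|w _].
  rewrite setTI (_ : _ @^-1` _ =
      \bigcup_(v : 'rV[int]_n) (if `[< U (g N v) >] then z N @^-1` [set v] else set0)).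
    apply: countable_bigcupT_measurable => [|v]; first exact: countableP.
    case: ifPn => [_|_]; last exact: measurable0.
    rewrite (_ : _ @^-1` _ = \bigcap_(k in [set: 'I_n])
        ((fun w => N.+1%:R * x w 0 k) @^-1` `[(v 0 k)%:~R, (v 0 k + 1)%:~R[)).
      apply: fin_bigcap_measurable => // k _; rewrite -[X in measurable X]setTI.
      by apply: measurable_funM.
    apply/seteqP; split => w /=.
      by move=> <- k _; rewrite /= in_itv/= mxE floor_le floorD1_gt.
    move=> H; apply/rowP => k; rewrite mxE; have := H k I.
    by rewrite /= in_itv /= => /floor_def.
  apply/seteqP; split => w /=.
    by move=> Uw; exists (z N w) => //; rewrite asboolT.
  by move=> [v _]; case: asboolP => //= Uv E; rewrite /= E.
have Ez N : g N (z N w) = f (\row_k round_down N (x w 0 k)).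
  by congr f; apply/rowP => k; rewrite !mxE.
under eq_fun do rewrite Ez.
apply: cvg_comp (cf _ (Ax w)).
move=> Q /nbhs_ballP[e /= e0 hQ].
near=> N; apply: hQ; last exact/hA/Ax.
split => // i k; rewrite ord1 mxE /ball/= ltr_norml.
have /andP[h1 h2] := round_down_bounds N (x w 0 k).
have Ne : N.+1%:R^-1 < e by near: N; exact: (near_infty_natSinv_lt (PosNum e0)).
have e1 : 0 < e := e0.
move: h1 h2 Ne; set a := round_down _ _; set b := x w 0 k; set c := N.+1%:R^-1 => h1 h2 Ne.
by apply/andP; split; rewrite ?ltrBrDr ?ltrBlDr; lra.
Unshelve. all: by end_near. Qed.

End measurable_within_continuous.

(** Integers lie on every grid of mesh 1/(N+1), so rounding down never crosses one: the lower bounds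
    -1 and 0 of the two domains survive. *)
Lemma round_down_ge_int (R : realType) N (m : int) (y : R) : m%:~R <= y -> m%:~R <= round_down N y.
Proof.
move=> my; rewrite /round_down ler_pdivlMr//.
have -> : m%:~R * N.+1%:R = (m * N.+1%:Z)%:~R :> R by rewrite rmorphM.
by rewrite ler_int floor_ge_int rmorphM /= mulrC ler_pM2l.
Qed.

Lemma cube_round_down (R : realType) d N (y : 'rV[R]_d) :
  cube y -> cube (\row_k round_down N (y 0 k)).
Proof.
move=> cy k; rewrite mxE; have /andP[h1 h2] := cy k; apply/andP; split.
  by have := @round_down_ge_int R N (-1) (y 0 k); rewrite rmorphN1; apply.
by have /andP[h _] := round_down_bounds N (y 0 k); exact: le_trans h2.
Qed.

Lemma int_dom_round_down (R : realType) N (y : 'rV[R]_3) :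
  int_dom y -> int_dom (\row_k round_down N (y 0 k)).
Proof.
move=> [h0 /andP[h1 h2]]; split; rewrite !mxE.
  exact: (@round_down_ge_int R N 0).
apply/andP; split; first by have := @round_down_ge_int R N (-1) (y 0 2); rewrite rmorphN1; apply.
by have /andP[h _] := round_down_bounds N (y 0 2); exact: le_trans h2.
Qed.

(** * Adaptedness of the scheme *)

Section scheme_adapted.
Context disp (Omega : measurableType disp) (R : realType) (P : probability Omega R).
Variables (F : R -> set (set Omega)) (M d : nat) (B : 'I_M -> R -> Omega -> R).
Hypotheses (hF : filtration F) (hB : brownian_motion P F B).

Lemma sigma_measurable_within_continuous n (A : set 'rV[R]_n) (f : 'rV[R]_n -> R) t
    (x : Omega -> 'rV[R]_n) : 0 <= t -> {within A, continuous f} ->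
  (forall N y, A y -> A (\row_k round_down N (y 0 k))) ->
  (forall w, A (x w)) -> (forall k, sigma_measurable (F t) (fun w => x w 0 k)) ->
  sigma_measurable (F t) (fun w => f (x w)).
Proof.
move=> t0 cf hA Ax mx; have [sF _] := hF.1 t t0; apply/(sigma_measurableE sF).
apply: (@measurable_within_continuous _ (g_sigma_algebraType (F t)) _ _ A) => // k.
exact/(sigma_measurableE sF).
Qed.

Variables (f : 'I_M.+1 -> 'rV[R]_d -> 'rV[R]_d) (Phi : R -> R -> R -> R) (x0 : 'rV[R]_d).
Hypothesis cf : forall m k, {within @cube R d, continuous (fun x => f m x 0 k)}.
Hypothesis Phi1 : forall s gamma y, 0 <= s -> -1 <= y <= 1 -> -1 <= Phi s gamma y <= 1.
Hypothesis cPhi : {within @int_dom R, continuous (uncurry3 Phi)}.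
Hypothesis cx0 : cube x0.
Variable tau : R.
Hypothesis tau0 : 0 <= tau.
Local Notation X := (scheme Phi f B x0 tau).

Lemma scheme_cube n w : cube (X n w).
Proof.
elim: n => [//|n IH] k /=; rewrite mxE; apply: Phi1; last exact: IH.
by rewrite mulr_ge0// sqr_ge0.
Qed.

Lemma enorm_sqr n (u : 'rV[R]_n) : enorm u ^+ 2 = \sum_i u 0 i ^+ 2.
Proof.
rewrite /enorm sqr_sqrtr; first by apply: eq_bigr => i _; rewrite expr2.
by apply: sumr_ge0 => i _; rewrite -expr2 sqr_ge0.
Qed.

Lemma schemeS n w k : X n.+1 w 0 k =
  Phi ((\sum_(m < M) f (lift ord0 m) (X n w) 0 k ^+ 2) * tau)
      (\sum_(m < M) f (lift ord0 m) (X n w) 0 k * incr B m (n%:R * tau) (n.+1%:R * tau) w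
        + f ord0 (X n w) 0 k * tau) (X n w 0 k).
Proof.
rewrite /= mxE enorm_sqr /edot; congr (Phi (_ * _) (_ + _) _).
  by apply: eq_bigr => m _; rewrite mxE.
by apply: eq_bigr => m _; rewrite !mxE.
Qed.

Lemma scheme_adapted n k : sigma_measurable (F (n%:R * tau)) (fun w => X n w 0 k).
Proof.
elim: n k => [|n IH] k.
  by rewrite mul0r; exact: (sigma_measurable_cst hF (x0 0 k) (lexx 0)).
have t0 : 0 <= n%:R * tau by rewrite mulr_ge0.
have tt : n%:R * tau <= n.+1%:R * tau by rewrite ler_wpM2r// ler_nat.
have t1 := le_trans t0 tt.
have mf m : sigma_measurable (F (n.+1%:R * tau)) (fun w => f m (X n w) 0 k).
  apply: (sigma_measurable_le hF t0 tt).
  have := @sigma_measurable_within_continuous d (@cube R d) (fun x => f m x 0 k) _ (X n) t0 (@cf m k).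
  apply => //.
    by move=> N y; exact: cube_round_down.
  exact: scheme_cube.
pose v w := vec3 ((\sum_(m < M) f (lift ord0 m) (X n w) 0 k ^+ 2) * tau)
      (\sum_(m < M) f (lift ord0 m) (X n w) 0 k * incr B m (n%:R * tau) (n.+1%:R * tau) w
        + f ord0 (X n w) 0 k * tau) (X n w 0 k).
rewrite (_ : (fun w => _) = fun w => uncurry3 Phi (v w)); last first.
  by apply/funext => w; rewrite schemeS /uncurry3 /v /vec3 !mxE.
apply: (sigma_measurable_within_continuous (x := v) t1 cPhi).
- by move=> N y; exact: int_dom_round_down.
- move=> w; apply: int_dom_vec3; last exact: scheme_cube.
  by rewrite mulr_ge0// sumr_ge0// => m _; exact: sqr_ge0.
have [sF _] := hF.1 _ t1.
have mf' m := (sigma_measurableE sF _).1 (mf m).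
have mD m := (sigma_measurableE sF _).1 (incr_sigma_measurable hF hB m t0 tt t1 (lexx _)).
have m1 : measurable_fun setT (fun w : g_sigma_algebraType (F (n.+1%:R * tau)) =>
    (\sum_(m < M) f (lift ord0 m) (X n w) 0 k ^+ 2) * tau).
  apply: measurable_funM => //; apply: measurable_sum => m.
  by apply: measurable_funX; exact: mf'.
have m2 : measurable_fun setT (fun w : g_sigma_algebraType (F (n.+1%:R * tau)) =>
    \sum_(m < M) f (lift ord0 m) (X n w) 0 k * incr B m (n%:R * tau) (n.+1%:R * tau) w
        + f ord0 (X n w) 0 k * tau).
  apply: measurable_funD; last by apply: measurable_funM => //; exact: mf'.
  by apply: measurable_sum => m; apply: measurable_funM; [exact: mf'|exact: mD].
case=> -[|[|[|//]]] k3; apply/(sigma_measurableE sF).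
- by rewrite (_ : (fun w => _) = fun w => (\sum_(m < M) f (lift ord0 m) (X n w) 0 k ^+ 2) * tau); [exact: m1|apply/funext => w; rewrite /v mxE].
- rewrite (_ : (fun w => _) = fun w => \sum_(m < M) f (lift ord0 m) (X n w) 0 k * incr B m (n%:R * tau) (n.+1%:R * tau) w
        + f ord0 (X n w) 0 k * tau); [exact: m2|by apply/funext => w; rewrite /v mxE].
- rewrite (_ : (fun w => _) = fun w => X n w 0 k); last by apply/funext => w; rewrite /v mxE.
  by apply/(sigma_measurableE sF); exact: (sigma_measurable_le hF t0 tt (IH k)).
Qed.

End scheme_adapted.

(** The sum is at most n+1 times its largest term, which is one of the terms on the right.
    Exponential moments of a sum of increments are thus reduced to one-dimensional ones, without the
    joint law of the components. *)
Lemma le_sum_max (R : realType) (n : nat) (h : R -> R) (V : 'I_n.+1 -> R) :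
  (forall x y, 0 <= x -> x <= y -> h x <= h y) -> (forall x, 0 <= x -> 0 <= h x) ->
  (forall i, 0 <= V i) -> h (\sum_i V i) <= \sum_i h (n.+1%:R * V i).
Proof.
move=> hh h0 V0; pose i0 := [arg max_(i > ord0) V i]%O.
have Vi0 i : V i <= V i0.
  by rewrite /i0; case: arg_maxP => // j _ H; exact: H.
apply: (@le_trans _ _ (h (n.+1%:R * V i0))); last first.
  by rewrite (bigD1 i0)//= lerDl sumr_ge0// => i _; rewrite h0// mulr_ge0.
apply: hh; first exact: sumr_ge0.
rewrite mulr_natl -[X in _ *+ X]card_ord -sumr_const; apply: ler_sum => i _; exact: Vi0.
Qed.

(** * Size of one time step *)

Section increments_size.
Context disp (Omega : measurableType disp) (R : realType) (P : probability Omega R).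
Variables (F : R -> set (set Omega)) (M : nat) (B : 'I_M -> R -> Omega -> R).
Hypotheses (hF : filtration F) (hB : brownian_motion P F B).
Local Notation EP := (Ex P).
Local Notation L1 := (int1 P).
Local Notation D := (incr B).

(** A single gauge for all remainders of the scheme: it dominates both sqrt(t - s) and the
    increments, and its p-th moment is of order sqrt(t - s)^p even with an exponential weight. *)
Definition step_size (s t : R) (w : Omega) : R := Num.sqrt (t - s) + \sum_m `|D m s t w|.

Lemma step_size_ge0 s t w : 0 <= step_size s t w.
Proof. by rewrite addr_ge0 ?sqrtr_ge0 ?sumr_ge0. Qed.

Lemma measurable_step_size s t : 0 <= s -> s <= t -> measurable_fun setT (step_size s t).
Proof.
move=> s0 st; apply: measurable_funD => //; apply: measurable_sum => m.
by apply: measurableT_comp => //; exact: (incr_measurable hF hB).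
Qed.

Lemma step_size_moment (p : nat) (c T : R) : 0 <= c -> exists2 C, 0 <= C &
  forall s t, 0 <= s -> s <= t -> t - s <= T ->
  L1 (fun w => step_size s t w ^+ p * expR (c * step_size s t w)) /\
  EP (fun w => step_size s t w ^+ p * expR (c * step_size s t w)) <= C * Num.sqrt (t - s) ^+ p.
Proof.
(* [n] counts the terms of [step_size]; [C1] accounts for the deterministic one and [C2] for each of
   the M increments. *)
move=> c0; pose n : R := M.+1%:R; have n0 : 0 <= n by [].
pose h x := x ^+ p * expR (c * x) : R.
have h0 x : 0 <= x -> 0 <= h x by move=> x0; rewrite mulr_ge0 ?expR_ge0 ?exprn_ge0.
have hh : (forall x y, 0 <= x -> x <= y -> h x <= h y).
  move=> x y x0 xy; have y0 := le_trans x0 xy; rewrite /h ler_pM ?exprn_ge0 ?expR_ge0//.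
    by rewrite lerXn2r.
  by rewrite ler_expR ler_wpM2l.
pose C1 := n ^+ p * expR (c * n * Num.sqrt T).
pose C2 := n ^+ p * (p`!%:R * (2 * expR ((c * n * Num.sqrt T + 1) ^+ 2 / 2))).
have C20 : 0 <= C2 by rewrite !mulr_ge0 ?exprn_ge0 ?expR_ge0.
exists (C1 + M%:R * C2); first by rewrite addr_ge0 ?mulr_ge0 ?exprn_ge0 ?expR_ge0.
move=> s t s0 st tT; set r := Num.sqrt (t - s).
have r0 : 0 <= r := sqrtr_ge0 _.
have rT : r <= Num.sqrt T by rewrite ler_wsqrtr.
have mU := measurable_step_size s0 st.
have mh : measurable_fun setT (fun w => h (step_size s t w)).
  apply: measurable_funM; first exact: measurable_funX.
  by apply: measurableT_comp => //; exact: measurable_funM.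
have cn0 : 0 <= c * n by rewrite mulr_ge0.
have iD m := incr_moment hF hB m p s0 st cn0.
pose Y w := h (n * r) + \sum_m n ^+ p * (`|D m s t w| ^+ p * expR (c * n * `|D m s t w|)).
have hY w : h (step_size s t w) <= Y w.
  pose V (i : 'I_M.+1) := if unlift ord0 i is Some m then `|D m s t w| else r.
  have V0 i : 0 <= V i by rewrite /V; case: unlift.
  have := le_sum_max hh h0 V0; rewrite !big_ord_recl /V unlift_none.
  under eq_bigr do rewrite liftK.
  move/le_trans; apply; rewrite lerD2l; apply: ler_sum => m _.
  by rewrite liftK /h exprMn !mulrA.
have iY : L1 Y.
  apply: int1D; first exact: int1_cst.
  by apply: int1_sum => m _; apply: int1Z; case: (iD m).
have ih : L1 (fun w => h (step_size s t w)).
  apply: int1_le iY => // w; rewrite ger0_norm ?h0 ?step_size_ge0//.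
split => //; apply: (le_trans (le_Ex ih iY hY)).
rewrite ExD; [|exact: int1_cst|by apply: int1_sum => m _; apply: int1Z; case: (iD m)].
rewrite Ex_cst mulrDl; apply: lerD.
  have -> : h (n * r) = n ^+ p * expR (c * n * r) * r ^+ p.
    by rewrite /h exprMn (mulrA c n r); ring.
  rewrite /C1; apply: ler_wpM2r; first exact: exprn_ge0.
  apply: ler_wpM2l; first exact: exprn_ge0.
  by rewrite ler_expR ler_wpM2l.
rewrite Ex_sum => [|m _]; last by apply: int1Z; case: (iD m).
rewrite -mulrA mulr_natl -[X in _ *+ X]card_ord -sumr_const; apply: ler_sum => m _.
rewrite ExZ; last by case: (iD m).
rewrite /C2 -(mulrA (n ^+ p)); apply: ler_wpM2l; first exact: exprn_ge0.
apply: (le_trans (proj2 (iD m))).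
apply: ler_wpM2r; first exact: exprn_ge0.
do 2 apply: ler_wpM2l => //.
rewrite ler_expR; apply: ler_wpM2r; first by rewrite invr_ge0.
have h1 : c * n * r <= c * n * Num.sqrt T by rewrite ler_wpM2l.
have h2 : 0 <= c * n * r by rewrite mulr_ge0.
by rewrite -/r lerXn2r ?nnegrE//; lra.
Qed.

End increments_size.

(* To be applied with r = sqrt tau, W the sum of the |B^m_t - B^m_s|, s = |f|^2 tau,
   a the martingale part of g = a + f0 tau, and q the second gamma-derivative. *)
Lemma scheme_remainder_bound (R : realType) (Kf K beta rho c2 : R) :
  0 <= Kf -> 0 <= K -> 0 <= beta -> 0 <= rho -> 0 <= c2 ->
  exists2 C, 0 <= C & exists2 c, 0 <= c & forall a f0 s r W g q E : R,
    0 <= r -> r <= rho -> 0 <= W -> `|a| <= Kf * W -> `|f0| <= Kf ->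
    0 <= s -> s <= c2 * r ^+ 2 -> g = a + f0 * r ^+ 2 -> `|q| <= K ->
    `|E| <= K * expR (beta * (s + `|g|)) * (`|g| ^+ 3 + s ^+ 2 + `|g| * s + g ^+ 2 * s) ->
    `|E + q / 2 * (g ^+ 2 - a ^+ 2)| <= C * ((r + W) ^+ 3 * expR (c * (r + W))).
Proof.
(* With U = r + W, [c1 * U] bounds |g| and [c * U] bounds beta (s + |g|); a factor r^2 is bounded by
   rho U or by U^2, according to the power that is missing. The four terms of [C1] match those of
   the expansion. *)
move=> Kf0 K0 b0 rho0 c20; pose c1 := Kf * (1 + rho).
have c10 : 0 <= c1 by rewrite mulr_ge0// addr_ge0.
pose c := beta * (c2 * rho + c1).
have c0 : 0 <= c by rewrite mulr_ge0// addr_ge0// mulr_ge0.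
pose C1 := c1 ^+ 3 + c2 * (c2 * rho) + c1 * c2 + c1 ^+ 2 * (c2 * rho).
have c2r0 : 0 <= c2 * rho by rewrite mulr_ge0.
have C10 : 0 <= C1.
  have h1 : 0 <= c1 ^+ 3 by exact: exprn_ge0.
  have h2 : 0 <= c1 ^+ 2 by exact: exprn_ge0.
  rewrite /C1; apply: addr_ge0; last exact: mulr_ge0.
  by rewrite !addr_ge0// mulr_ge0.
(* The second summand pays for replacing g by its martingale part in the curvature term, through g^2
   - a^2 = f0 r^2 (g + a). *)
exists (K * C1 + K * (Kf * c1)).
  by apply: addr_ge0; [exact: mulr_ge0|apply: mulr_ge0 => //; exact: mulr_ge0].
exists c => // a f0 s r W g q E r0 rr W0 aW fK s0 sr gE qK EK.
set U := r + W; have U0 : 0 <= U by rewrite addr_ge0.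
have rU : r <= U by rewrite lerDl.
have WU : W <= U by rewrite lerDr.
have r2U2 : r ^+ 2 <= U ^+ 2 by rewrite lerXn2r.
have r2U : r ^+ 2 <= rho * U by rewrite expr2 ler_pM.
have fr : `|f0 * r ^+ 2| <= Kf * r ^+ 2 by rewrite normrM (ger0_norm (sqr_ge0 r)) ler_wpM2r ?sqr_ge0.
have aU : `|a| <= Kf * U by rewrite (le_trans aW)// ler_wpM2l.
have gU : `|g| <= c1 * U.
  have -> : c1 * U = Kf * U + Kf * (rho * U) by rewrite /c1; ring.
  rewrite gE (le_trans (ler_normD _ _))//; apply: lerD => //.
  by rewrite (le_trans fr)// ler_wpM2l.
have sU : s <= c2 * rho * U by rewrite (le_trans sr)// -mulrA ler_wpM2l.
have sU2 : s <= c2 * U ^+ 2 by rewrite (le_trans sr)// ler_wpM2l.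
have c2r : 0 <= c2 * rho by rewrite mulr_ge0.
have c1U : 0 <= c1 * U by rewrite mulr_ge0.
have B1 : `|g| ^+ 3 <= c1 ^+ 3 * U ^+ 3 by rewrite -exprMn lerXn2r ?nnegrE.
have B2 : s ^+ 2 <= c2 * (c2 * rho) * U ^+ 3.
  have -> : c2 * (c2 * rho) * U ^+ 3 = (c2 * U ^+ 2) * (c2 * rho * U) by ring.
  by rewrite expr2 ler_pM.
have B3 : `|g| * s <= c1 * c2 * U ^+ 3.
  have -> : c1 * c2 * U ^+ 3 = (c1 * U) * (c2 * U ^+ 2) by ring.
  by rewrite ler_pM.
have B4 : g ^+ 2 * s <= c1 ^+ 2 * (c2 * rho) * U ^+ 3.
  have -> : c1 ^+ 2 * (c2 * rho) * U ^+ 3 = (c1 * U) ^+ 2 * (c2 * rho * U) by ring.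
  rewrite -[g ^+ 2]real_normK ?num_real// ler_pM ?sqr_ge0//.
  by rewrite lerXn2r ?nnegrE.
have B5 : `|q / 2 * (g ^+ 2 - a ^+ 2)| <= K * (Kf * c1) * U ^+ 3.
  have -> : q / 2 * (g ^+ 2 - a ^+ 2) = q / 2 * ((f0 * r ^+ 2) * (g + a)) by rewrite gE; ring.
  have -> : K * (Kf * c1) * U ^+ 3 = (K / 2) * (Kf * U ^+ 2 * (2 * c1 * U)) by field.
  rewrite normrM; apply: ler_pM => //.
    by rewrite normrM (@ger0_norm _ 2^-1) ?invr_ge0// ler_wpM2r ?invr_ge0.
  rewrite normrM; apply: ler_pM => //; first by rewrite (le_trans fr)// ler_wpM2l.
  apply: (le_trans (ler_normD _ _)).
  have : Kf * U <= c1 * U by rewrite ler_wpM2r// /c1 ler_peMr// lerDl.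
  by lra.
have e1 : 1 <= expR (c * U) by rewrite -expR0 ler_expR mulr_ge0.
have U30 : 0 <= U ^+ 3 by rewrite exprn_ge0.
apply: (le_trans (ler_normD _ _)); rewrite mulrDl; apply: lerD.
  apply: (le_trans EK); rewrite -mulrA -[leRHS]mulrA ler_wpM2l//.
  have -> : C1 * (U ^+ 3 * expR (c * U)) = expR (c * U) * (C1 * U ^+ 3) by ring.
  apply: ler_pM => //.
  - have h1 : 0 <= `|g| ^+ 3 by exact: exprn_ge0.
    have h2 : 0 <= `|g| * s by exact: mulr_ge0.
    have h3 : 0 <= g ^+ 2 * s by apply: mulr_ge0 => //; exact: sqr_ge0.
    by rewrite !addr_ge0// sqr_ge0.
  - have -> : c * U = beta * (c2 * rho * U + c1 * U) by rewrite /c; ring.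
    by rewrite ler_expR ler_wpM2l// lerD.
  - by rewrite /C1 !mulrDl !lerD.
apply: (le_trans B5); apply: ler_wpM2l; last by rewrite ler_peMr.
by apply: mulr_ge0 => //; exact: mulr_ge0.
Qed.

(** * Local error of the scheme *)

Section scheme_local.
Context disp (Omega : measurableType disp) (R : realType) (P : probability Omega R).
Variables (F : R -> set (set Omega)) (M d : nat) (B : 'I_M -> R -> Omega -> R).
Hypotheses (hF : filtration F) (hB : brownian_motion P F B).
Local Notation EP := (Ex P).
Local Notation L1 := (int1 P).
Local Notation D := (incr B).

Lemma Ex_adm_incr2 m m' s t Z : 0 <= s -> s <= t -> adm F s Z ->
  L1 (fun w => Z w * (D m s t w * D m' s t w - (m == m')%:R * (t - s))) /\
  EP (fun w => Z w * (D m s t w * D m' s t w - (m == m')%:R * (t - s))) = 0.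
Proof.
move=> s0 st hZ; have sD i := incr_sq_int hF hB i s0 st.
have i1 : L1 (fun w => D m s t w * D m' s t w) by exact: sq_intM.
have i2 : L1 (fun w => Z w * (D m s t w * D m' s t w)) by exact: (adm_int1 hF s0 hZ).
have i3 := adm_int1_self P hF s0 hZ.
have i4 := int1Z ((m == m')%:R * (t - s)) i3.
have E : (fun w => Z w * (D m s t w * D m' s t w - (m == m')%:R * (t - s))) =
   (fun w => Z w * (D m s t w * D m' s t w) - (m == m')%:R * (t - s) * Z w).
  by apply/funext => w; ring.
split; first by rewrite E; exact: int1B.
rewrite E ExB// ExZ//; case: hZ => mZ [K ZK]; case: eqP => [<-|/eqP mm'].
  have -> : (fun w => Z w * (D m s t w * D m s t w)) = (fun w => Z w * D m s t w ^+ 2).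
    by apply/funext => w; rewrite expr2.
  by rewrite (Ex_sigma_incr_sqr hF hB m s0 st mZ ZK) mul1r mulrC subrr.
by rewrite (Ex_sigma_incr_mul hF hB mm' s0 st mZ ZK) !mul0r subrr.
Qed.

End scheme_local.

Section scheme_local_error.
Context disp (Omega : measurableType disp) (R : realType) (P : probability Omega R).
Variables (F : R -> set (set Omega)) (M d : nat) (B : 'I_M -> R -> Omega -> R).
Hypotheses (hF : filtration F) (hB : brownian_motion P F B).
Local Notation EP := (Ex P).
Local Notation L2 := (sq_int P).
Local Notation D := (incr B).
Variables (g f : 'I_M.+1 -> 'rV[R]_d -> 'rV[R]_d) (Phi : R -> R -> R -> R) (x0 : 'rV[R]_d).
Variables (beta T : R).
Hypothesis cf : forall m k, {within @cube R d, continuous (fun x => f m x 0 k)}.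
Hypothesis gE : forall m k x, @cube R d x -> g m x 0 k = sigma (x 0 k) * f m x 0 k.
Hypothesis Phi1 : forall s gamma y, 0 <= s -> -1 <= y <= 1 -> -1 <= Phi s gamma y <= 1.
Hypothesis Phi3 : class_C 3 (@int_dom R) (uncurry3 Phi).
Hypothesis Phi0 : forall y, -1 <= y <= 1 ->
  [/\ Phi 0 0 y = y, dPhi Phi 0 1 0 0 0 y = sigma y &
      dPhi Phi 1 0 0 0 0 y + 2^-1 * dPhi Phi 0 2 0 0 0 y = 0].
Hypotheses (beta0 : 0 < beta) (Phi_norm : (norm_p_beta 3 beta Phi < +oo)%E).
Hypothesis cx0 : cube x0.
Local Notation X := (scheme Phi f B x0).

Let cPhi : {within @int_dom R, continuous (uncurry3 Phi)} := proj1 Phi3.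

Lemma scheme_fun_adm (h : 'rV[R]_d -> R) tau n : 0 <= tau ->
  {within @cube R d, continuous h} -> adm F (n%:R * tau) (fun w => h (X tau n w)).
Proof.
move=> tau0 ch; have t0 : 0 <= n%:R * tau by rewrite mulr_ge0.
have [K K0 hK] := cube_bounded ch; split.
  apply: (@sigma_measurable_within_continuous _ _ _ _ hF d (@cube R d) h _ (X tau n) t0 ch).
  - by move=> N y; exact: cube_round_down.
  - exact: (scheme_cube B f Phi1 cx0 tau0 n).
  - exact: (scheme_adapted hF hB cf Phi1 cPhi cx0 tau0 n).
by exists K => w; apply: hK; exact: (scheme_cube B f Phi1 cx0 tau0 n).
Qed.

Lemma scheme_curvature_adm tau n k : 0 <= tau ->
  adm F (n%:R * tau) (fun w => dPhi Phi 0 2 0 0 0 (X tau n w 0 k)).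
Proof.
move=> tau0; have t0 : 0 <= n%:R * tau by rewrite mulr_ge0.
have [K K0 [qK _]] := Phi_expansion Phi3 Phi0 beta0 Phi_norm.
have cX := scheme_cube B f Phi1 cx0 tau0 n.
split; last by exists K => w; apply: qK; exact: cX.
have [cq _] : class_C 1 (@int_dom R) (iter 2 (pderiv (@int_dom R) 1) (uncurry3 Phi)).
  exact: class_C_iter.
apply: (@sigma_measurable_within_continuous _ _ _ _ hF 3 (@int_dom R) _ _
  (fun w => vec3 0 0 (X tau n w 0 k)) t0 cq).
- by move=> N y; exact: int_dom_round_down.
- by move=> w; apply: int_dom_vec3; last exact: cX.
have := scheme_adapted hF hB cf Phi1 cPhi cx0 tau0 n k => mX.
case=> -[|[|[|//]]] k3.
- rewrite (_ : (fun w => _) = fun=> 0); first exact: (sigma_measurable_cst hF).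
  by apply/funext => w; rewrite mxE.
- rewrite (_ : (fun w => _) = fun=> 0); first exact: (sigma_measurable_cst hF).
  by apply/funext => w; rewrite mxE.
- by rewrite (_ : (fun w => _) = fun w => X tau n w 0 k)//; apply/funext => w; rewrite mxE.
Qed.

Lemma scheme_local_error : exists2 C, 0 <= C & forall tau n k, 0 <= tau -> tau <= T ->
  exists D' J' : Omega -> R,
  [/\ forall w, X tau n.+1 w 0 k - X tau n w 0 k = g ord0 (X tau n w) 0 k * tau +
        \sum_(m < M) g (lift ord0 m) (X tau n w) 0 k * D m (n%:R * tau) (n.+1%:R * tau) w +
        D' w + J' w,
      L2 D' /\ L2 J',
      EP (fun w => D' w ^+ 2) <= C * tau ^+ 3, EP (fun w => J' w ^+ 2) <= C * tau ^+ 2 &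
      forall Z, adm F (n%:R * tau) Z -> EP (fun w => Z w * J' w) = 0].
Proof.
have [K K0 [qK expK]] := Phi_expansion Phi3 Phi0 beta0 Phi_norm.
have [Kf Kf0 hKf] := cube_uniform_bound cf.
pose c2 := M%:R * Kf ^+ 2.
have c20 : 0 <= c2 by rewrite mulr_ge0 ?exprn_ge0.
have [C C0 [c c0 hC]] := scheme_remainder_bound Kf0 K0 (ltW beta0) (sqrtr_ge0 T) c20.
(* Squaring the bound U^3 exp(cU) on [D'] doubles the rate and gives degree 6, that is tau^3; the
   square of [J'] has degree 4 and no exponential, that is tau^2. *)
have cc0 : 0 <= 2 * c by rewrite mulr_ge0.
have [C6 C60 m6] := step_size_moment hF hB 6 T cc0.
have [C4 C40 m4] := step_size_moment hF hB 4 T (lexx 0).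
pose CJ := K / 2 * (Kf ^+ 2 + c2).
have CJ0 : 0 <= CJ by rewrite mulr_ge0 ?divr_ge0 ?addr_ge0 ?exprn_ge0.
exists (C ^+ 2 * C6 + CJ ^+ 2 * C4); first by rewrite addr_ge0// mulr_ge0// sqr_ge0.
move=> tau n k tau0 tauT; set s := n%:R * tau; set t := n.+1%:R * tau.
have s0 : 0 <= s by rewrite mulr_ge0.
have st : s <= t by rewrite ler_wpM2r// ler_nat.
have tsE : t - s = tau by rewrite /t /s -natr1; ring.
have tsT : t - s <= T by rewrite tsE.
have cX := scheme_cube B f Phi1 cx0 tau0 n.
pose fX m w := f m (X tau n w) 0 k.
pose q w := dPhi Phi 0 2 0 0 0 (X tau n w 0 k).
pose a w := \sum_(m < M) fX (lift ord0 m) w * D m s t w.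
pose S w := (\sum_(m < M) fX (lift ord0 m) w ^+ 2) * tau.
pose J' w := q w / 2 * (a w ^+ 2 - S w).
(* Defined by difference, so that the decomposition is an identity; the expansion of Phi enters only
   in the bound on [D']. *)
pose D' w := X tau n.+1 w 0 k - X tau n w 0 k - g ord0 (X tau n w) 0 k * tau
  - \sum_(m < M) g (lift ord0 m) (X tau n w) 0 k * D m s t w - J' w.
have hf m : adm F s (fX m) by exact: (scheme_fun_adm _ tau0 (@cf m k)).
have hq : adm F s q by exact: scheme_curvature_adm.
have mf m : measurable_fun setT (fX m) := adm_measurable hF s0 (hf m).
have mq : measurable_fun setT q := adm_measurable hF s0 hq.
have mD m := incr_measurable hF hB m s0 st.
have ma : measurable_fun setT a.
  by apply: measurable_sum => m; exact: measurable_funM.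
have mJ : measurable_fun setT J'.
  apply: measurable_funM; first exact: measurable_funM.
  apply: measurable_funB; first exact: measurable_funX.
  by apply: measurable_funM => //; apply: measurable_sum => m; exact: measurable_funX.
have mX j : measurable_fun setT (fun w => X tau j w 0 k).
  have sj : 0 <= j%:R * tau by rewrite mulr_ge0.
  exact: (sigma_measurable_fun hF sj (scheme_adapted hF hB cf Phi1 cPhi cx0 tau0 j k)).
have gXE m w : g m (X tau n w) 0 k = sigma (X tau n w 0 k) * fX m w by exact: gE (cX w).
have mg m : measurable_fun setT (fun w => g m (X tau n w) 0 k).
  under eq_fun do rewrite gXE; apply: measurable_funM => //.
  by apply: measurable_funM; [exact: measurable_funB|exact: measurable_funD].
have mD' : measurable_fun setT D'.
  apply: measurable_funB => //; apply: measurable_funB; last first.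
    by apply: measurable_sum => m; exact: measurable_funM.
  by apply: measurable_funB; [exact: measurable_funB|exact: measurable_funM].
pose U := step_size B s t.
pose W w := \sum_m `|D m s t w|.
have [i6 E6] := m6 s t s0 st tsT; have [i4 E4] := m4 s t s0 st tsT.
rewrite -/U in i6 E6 i4 E4; rewrite tsE in E6 E4.
have U0 w : 0 <= U w by exact: step_size_ge0.
have UE w : U w = Num.sqrt tau + W w by rewrite /U /step_size tsE.
clearbody U.
have aW w : `|a w| <= Kf * W w.
  rewrite (le_trans (ler_norm_sum _ _ _))// mulr_sumr; apply: ler_sum => m _.
  by rewrite normrM ler_wpM2r// hKf.
have W0 w : 0 <= W w by rewrite sumr_ge0.
have S0 w : 0 <= S w by rewrite mulr_ge0// sumr_ge0// => m _; exact: sqr_ge0.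
have r2 : Num.sqrt tau ^+ 2 = tau by rewrite sqr_sqrtr.
have Sc w : S w <= c2 * Num.sqrt tau ^+ 2.
  rewrite r2 ler_wpM2r// /c2 mulr_natl -[X in _ *+ X]card_ord -sumr_const; apply: ler_sum => m _.
  by rewrite -real_normK ?num_real// lerXn2r ?nnegrE// hKf.
have D'bnd w : `|D' w| <= C * (U w ^+ 3 * expR (c * U w)).
  have cXk := cX w k.
  have := expK (S w) (a w + fX ord0 w * tau) _ (S0 w) cXk.
  rewrite -/(q w) => h.
  have := hC (a w) (fX ord0 w) (S w) (Num.sqrt tau) (W w) (a w + fX ord0 w * tau) (q w) _
    (sqrtr_ge0 _) (ler_wsqrtr tauT) (W0 w) (aW w) (hKf _ _ _ (cX w)) (S0 w) (Sc w) _ (qK _ cXk) h.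
  rewrite r2 UE => /(_ erefl); apply: le_trans.
  rewrite le_eqVlt; apply/orP; left; apply/eqP; congr `| _ |.
  (* Here g = sigma f turns the first-order part of the expansion, written with f, into the
     coefficients of the equation. *)
  rewrite /D' schemeS -/s -/t gXE.
  under [X in _ - X - _]eq_bigr do rewrite gXE -mulrA.
  rewrite -mulr_sumr -/(a w) -/(fX ord0 w) /J'.
  by rewrite -/(S w); set ph := Phi _ _ _; field.
have J'bnd w : `|J' w| <= CJ * U w ^+ 2.
  rewrite /J' normrM /CJ -mulrA; apply: ler_pM => //.
    by rewrite normrM (@ger0_norm _ 2^-1) ?invr_ge0// ler_wpM2r ?invr_ge0// qK// cX.
  rewrite (le_trans (ler_normB _ _))// mulrDl; apply: lerD.
    rewrite normrX -exprMn lerXn2r ?nnegrE ?mulr_ge0//.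
    by rewrite (le_trans (aW w))// ler_wpM2l// UE lerDr sqrtr_ge0.
  rewrite ger0_norm// (le_trans (Sc w))// ler_wpM2l// lerXn2r ?nnegrE ?sqrtr_ge0//.
  by rewrite UE lerDl.
have D2bnd w : `|D' w ^+ 2| <= C ^+ 2 * (U w ^+ 6 * expR (2 * c * U w)).
  have -> : C ^+ 2 * (U w ^+ 6 * expR (2 * c * U w)) = (C * (U w ^+ 3 * expR (c * U w))) ^+ 2.
    have -> : 2 * c * U w = c * U w + c * U w by ring.
    by rewrite expRD; ring.
  have p0 := le_trans (normr_ge0 _) (D'bnd w).
  by rewrite normrX lerXn2r ?nnegrE.
have J2bnd w : `|J' w ^+ 2| <= CJ ^+ 2 * (U w ^+ 4 * expR (0 * U w)).
  have -> : CJ ^+ 2 * (U w ^+ 4 * expR (0 * U w)) = (CJ * U w ^+ 2) ^+ 2.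
    by rewrite mul0r expR0; ring.
  have p0 := le_trans (normr_ge0 _) (J'bnd w).
  by rewrite normrX lerXn2r ?nnegrE.
have D2 : L2 D'.
  by split => //; apply: int1_le D2bnd (int1Z _ i6); exact: measurable_funX.
have J2 : L2 J'.
  by split => //; apply: int1_le J2bnd (int1Z _ i4); exact: measurable_funX.
have hD : EP (fun w => D' w ^+ 2) <= C ^+ 2 * C6 * tau ^+ 3.
  have h1 : EP (fun w => D' w ^+ 2) <= C ^+ 2 * EP (fun w => U w ^+ 6 * expR (2 * c * U w)).
    rewrite -(ExZ _ i6); apply: le_Ex; [exact: (proj2 D2)|exact: (int1Z _ i6)|].
    by move=> w; exact: (le_trans (ler_norm _) (D2bnd w)).
  have := le_trans h1 (ler_wpM2l (sqr_ge0 C) E6).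
  by rewrite mulrA (_ : Num.sqrt tau ^+ 6 = tau ^+ 3)//; rewrite (exprM _ 2 3) r2.
have hJ : EP (fun w => J' w ^+ 2) <= CJ ^+ 2 * C4 * tau ^+ 2.
  have h1 : EP (fun w => J' w ^+ 2) <= CJ ^+ 2 * EP (fun w => U w ^+ 4 * expR (0 * U w)).
    rewrite -(ExZ _ i4); apply: le_Ex; [exact: (proj2 J2)|exact: (int1Z _ i4)|].
    by move=> w; exact: (le_trans (ler_norm _) (J2bnd w)).
  have := le_trans h1 (ler_wpM2l (sqr_ge0 CJ) E4).
  by rewrite mulrA (_ : Num.sqrt tau ^+ 4 = tau ^+ 2)//; rewrite (exprM _ 2 2) r2.
have hC1 : C ^+ 2 * C6 <= C ^+ 2 * C6 + CJ ^+ 2 * C4 by rewrite lerDl mulr_ge0// sqr_ge0.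
have hC2 : CJ ^+ 2 * C4 <= C ^+ 2 * C6 + CJ ^+ 2 * C4 by rewrite lerDr mulr_ge0// sqr_ge0.
exists D', J'; split => //.
- by move=> w; rewrite /D'; ring.
- exact: (le_trans hD (ler_wpM2r (exprn_ge0 3 tau0) hC1)).
- exact: (le_trans hJ (ler_wpM2r (exprn_ge0 2 tau0) hC2)).
move=> Z hZ.
(* [J'] is a quadratic form with coefficients (q/2) f_m f_m' in the centred products of increments,
   |f|^2 tau being the same form without q/2 in their means; each term is orthogonal to the past by
   [Ex_adm_incr2]. *)
pose zeta m m' w := Z w * (2^-1 * q w * (fX (lift ord0 m) w * fX (lift ord0 m') w)).
have hz m m' : adm F s (zeta m m').
  apply: (admM hF s0 hZ); apply: (admM hF s0); last exact: (admM hF s0).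
  apply: (admM hF s0 _ hq); split; first exact: (sigma_measurable_cst hF).
  by exists `|2^-1| => w.
have ZJ w : Z w * J' w = \sum_m \sum_m' zeta m m' w * (D m s t w * D m' s t w - (m == m')%:R * (t - s)).
  transitivity (\sum_m \sum_m' (Z w * (2^-1 * q w)) * ((fX (lift ord0 m) w * D m s t w) * (fX (lift ord0 m') w * D m' s t w)
       - (m == m')%:R * (fX (lift ord0 m) w * fX (lift ord0 m') w * tau))).
    under eq_bigr do rewrite -mulr_sumr sumrB -mulr_sumr.
    rewrite -mulr_sumr sumrB -mulr_suml -/(a w).
    have -> : \sum_(i < M) \sum_(j < M) (i == j)%:R * (fX (lift ord0 i) w * fX (lift ord0 j) w * tau) = S w.
      rewrite /S mulr_suml; apply: eq_bigr => m _; rewrite (bigD1 m)//= eqxx mul1r big1 ?addr0//.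
      by move=> j /negbTE jm; rewrite eq_sym jm mul0r.
    by rewrite /J'; field.
  apply: eq_bigr => m _; apply: eq_bigr => m' _; rewrite /zeta tsE; ring.
under eq_fun do rewrite ZJ.
rewrite Ex_sum => [|m _]; last first.
  by apply: int1_sum => m' _; have [] := Ex_adm_incr2 hF hB m m' s0 st (hz m m').
rewrite big1// => m _; rewrite Ex_sum => [|m' _]; last first.
  by have [] := Ex_adm_incr2 hF hB m m' s0 st (hz m m').
by rewrite big1// => m' _; have [] := Ex_adm_incr2 hF hB m m' s0 st (hz m m').
Qed.

End scheme_local_error.

(** * The stochastic differential equation *)

Section riemann_sum.
Variables (R : realType) (phi : R -> R).
Local Notation mu := (@lebesgue_measure R).

(** Heine's theorem by compactness in its near-covering form: the modulus [d] is the covering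
    parameter, so no finite subcover is extracted. *)
Lemma segment_unif_continuous (a b e : R) : {within `[a, b], continuous phi} -> 0 < e ->
  exists2 d, 0 < d & forall x y, a <= x <= b -> a <= y <= b -> `|x - y| < d ->
    `|phi x - phi y| < e.
Proof.
move=> /subspace_continuousP cphi e0.
have /compact_near_coveringP nc := @segment_compact R a b.
have [|d /= d0 hd] := @nc R 0^'+ (fun d x => `[a, b]%classic x -> forall y, `[a, b]%classic y -> `|x - y| < d -> `|phi x - phi y| < e).
  move=> x xab.
  have /cvgrPdist_lt /(_ (e / 2)) := cphi x xab.
  rewrite divr_gt0// => /(_ isT); rewrite /prop_near1 /= /within /= => /nbhs_ballP[r /= r0 hr].
  exists (ball x (r / 2), [set d | 0 < d < r / 2]); first split => /=.
  - by apply: nbhsx_ballx; rewrite divr_gt0.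
  - near=> d; apply/andP; split; near: d; [exact: nbhs_right_gt|apply: nbhs_right_lt; exact: divr_gt0].
  move=> [z d] /= [xz /andP[d0 dr]] zab y yab zy.
  have xz' : `|x - z| < r / 2 by exact: xz.
  have h1 : `|phi x - phi z| < e / 2.
    by apply: hr => //; rewrite /ball/=; move: xz'; lra.
  have h2 : `|phi x - phi y| < e / 2.
    apply: hr => //; rewrite /ball/=.
    have := ler_normD (x - z) (z - y); rewrite subrKA; move: xz'; lra.
  have := ler_normB (phi x - phi y) (phi x - phi z).
  rewrite (_ : phi x - phi y - _ = phi z - phi y); last by ring.
  lra.
have d2 : d / 2 < d by lra.
have d20 : 0 < d / 2 by lra.
exists (d / 2) => // x y xab yab xy.
by apply: (hd (d / 2)) => //=; rewrite ?in_itv//= sub0r normrN gtr0_norm.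
Unshelve. all: by end_near. Qed.

Lemma itv_integral_sub (a b u : R) : 0 <= a -> a <= b -> b <= u ->
  {within `[0, u], continuous phi} ->
  \int[mu]_(r in `[0, b]) phi r - \int[mu]_(r in `[0, a]) phi r = \int[mu]_(r in `]a, b]) phi r.
Proof.
move=> a0 ab bu cphi; apply: Rintegral_itvB; rewrite ?bnd_simp//.
apply: continuous_compact_integrable; first exact: segment_compact.
apply: continuous_subspaceW cphi => r /=; rewrite !in_itv/= => /andP[-> rb].
exact: le_trans bu.
Qed.

Lemma integral_near_left (a b u e : R) : 0 <= a -> a <= b -> b <= u ->
  {within `[0, u], continuous phi} ->
  (forall r, a <= r <= b -> `|phi a - phi r| <= e) ->
  `|\int[mu]_(r in `]a, b]) phi r - phi a * (b - a)| <= e * (b - a).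
Proof.
move=> a0 ab bu cphi he.
have mab : mu `]a, b] = (b - a)%:E.
  rewrite [LHS](lebesgue_measure_itv `]a, b])/= lte_fin; case: ltP => h; first by rewrite -EFinB.
  by congr EFin; apply/eqP; rewrite eq_sym subr_eq0 eq_le h ab.
have ic c : mu.-integrable `]a, b] (EFin \o (fun=> c)).
  apply: measurable_bounded_integrable => //; first by have := ltry (b - a); rewrite -mab.
  exact: bounded_cst.
have iphi : mu.-integrable `]a, b] (EFin \o phi).
  apply: (@integrableS _ _ _ mu `[0, u]) => //.
    by move=> r /=; rewrite !in_itv/= => /andP[ar rb]; rewrite (le_trans a0 (ltW ar)) (le_trans rb).
  by apply: continuous_compact_integrable => //; exact: segment_compact.
have Ec c : c * (b - a) = \int[mu]_(r in `]a, b]) c.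
  by rewrite Rintegral_cst// -[b - a]/(fine (b - a)%:E) -mab.
rewrite !Ec.
rewrite -RintegralB//.
have iB : mu.-integrable `]a, b] (EFin \o (fun r => phi r - phi a)).
  have mI : measurable (`]a, b] : set (measurableTypeR R)) by [].
  exact: (integrableB mI iphi (ic (phi a))).
apply: (le_trans (le_normr_Rintegral _ iB)) => //; apply: le_Rintegral => //.
  exact: (integrable_norm iB).
move=> r /=; rewrite in_itv/= => /andP[ar rb]; rewrite distrC; apply: he.
by rewrite (ltW ar).
Qed.

Definition riemann_sum (s t : R) (N : nat) : R :=
  \sum_(i < N.+1) phi (s + i%:R * ((t - s) / N.+1%:R)) * ((t - s) / N.+1%:R).

Lemma cvg_riemann_sum (s t : R) : 0 <= s -> s <= t -> {within `[0, t], continuous phi} ->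
  riemann_sum s t N @[N --> \oo] -->
    \int[mu]_(r in `[0, t]) phi r - \int[mu]_(r in `[0, s]) phi r.
Proof.
move=> s0 st cphi; apply/cvgrPdist_le => e e0.
pose G u := \int[mu]_(r in `[0, u]) phi r.
have L0 : 0 <= t - s by rewrite subr_ge0.
pose e1 := e / (t - s + 1).
have e10 : 0 < e1 by rewrite divr_gt0// ltr_wpDl.
have [d d0 hd] := segment_unif_continuous cphi e10.
have Lp : 0 < t - s + 1 by rewrite ltr_wpDl.
near=> N.
pose h := (t - s) / N.+1%:R.
have h0 : 0 <= h by rewrite divr_ge0.
have hN : N.+1%:R * h = t - s by rewrite /h mulrCA divff ?mulr1.
have hd' : h < d.
  apply: (@le_lt_trans _ _ ((t - s + 1) * N.+1%:R^-1)); first by rewrite ler_wpM2r// lerDl.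
  rewrite mulrC -ltr_pdivlMr//.
  by near: N; exact: (near_infty_natSinv_lt (PosNum (divr_gt0 d0 Lp))).
pose x i := s + i%:R * h.
have xS i : x i.+1 = x i + h by rewrite /x -natr1; ring.
have -> : \int[mu]_(r in `[0, t]) phi r - \int[mu]_(r in `[0, s]) phi r =
    \sum_(i < N.+1) (G (x i.+1) - G (x i)).
  rewrite -(big_mkord xpredT (fun i => G (x i.+1) - G (x i))) telescope_sumr//.
  have -> : x N.+1 = t by rewrite /x hN; ring.
  by have -> : x 0%N = s by rewrite /x mul0r addr0.
rewrite /riemann_sum -/h -sumrB (le_trans (ler_norm_sum _ _ _))//.
apply: (@le_trans _ _ (\sum_(i < N.+1) e1 * h)).
  apply: ler_sum => i _; rewrite -/(x i).
  have xi0 : 0 <= x i by rewrite addr_ge0// mulr_ge0.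
  have xx : x i <= x i.+1 by rewrite xS lerDl.
  have xt : x i.+1 <= t.
    have : i.+1%:R * h <= N.+1%:R * h by rewrite ler_wpM2r// ler_nat ltn_ord.
    by rewrite hN /x; lra.
  rewrite /G (itv_integral_sub xi0 xx xt cphi).
  have -> : h = x i.+1 - x i by rewrite xS addrC addKr.
  apply: (integral_near_left xi0 xx xt cphi) => r /andP[r1 r2]; apply/ltW/hd.
  - by rewrite xi0 (le_trans xx).
  - by rewrite (le_trans xi0)// (le_trans r2).
  - rewrite distrC ger0_norm ?subr_ge0//; move: r2; rewrite xS => r2.
    by move: hd'; lra.
rewrite sumr_const card_ord -mulrnAr -mulr_natl hN /e1 -mulrA.
have q1 : (t - s + 1)^-1 * (t - s) <= 1 by rewrite mulrC ler_pdivrMr// mul1r lerDl.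
by rewrite ler_piMr// ltW.
Unshelve. all: by end_near. Qed.

End riemann_sum.

Section limit.
Context d (T : measurableType d) (R : realType) (P : probability T R).

(** The uniform bound [K] supplies the domination; this carries estimates made on Riemann sums over
    to the drift part of the solution. *)
Lemma Ex_sqr_limit_le (Y : nat -> T -> R) (Z : T -> R) (K C : R) :
  (forall n, measurable_fun setT (Y n)) -> measurable_fun setT Z ->
  (forall n w, `|Y n w| <= K) -> {ae P, forall w, Y n w @[n --> \oo] --> Z w} ->
  (forall n, Ex P (fun w => Y n w ^+ 2) <= C) ->
  sq_int P Z /\ Ex P (fun w => Z w ^+ 2) <= C.
Proof.
move=> mY mZ YK YZ YC.
have iY n : int1 P (fun w => Y n w ^+ 2) by case: (sq_int_bnd P (mY n) (YK n)).
have [] := @dominated_convergence _ _ _ P setT measurableT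
  (fun n w => (Y n w ^+ 2)%:E) (fun w => (Z w ^+ 2)%:E) (fun w => (K ^+ 2)%:E).
- by move=> n; apply/measurable_EFinP; exact: measurable_funX.
- by apply/measurable_EFinP; exact: measurable_funX.
- apply: filterS YZ => w YZ _; apply: cvg_EFin; first exact: nearW.
  by rewrite /comp/= expr2; under eq_fun do rewrite expr2; exact: cvgM.
- exact: int1_cst.
- apply: aeW => w n _; rewrite /= lee_fin normrX lerXn2r ?nnegrE//.
  exact: le_trans (YK n w).
move=> iZ _ cv; split; first by split.
rewrite -lee_fin (EFin_Ex iZ); apply: (cvge_to_le cv).
by apply: nearW => n; have := YC n; rewrite -lee_fin (EFin_Ex (iY n)).
Qed.

End limit.

(* The clamped solution is a modification of the solution lying in the cube for
   every w, where the bounds on the coefficients hold. *)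
Definition clamp (R : realType) (d : nat) (x : 'rV[R]_d) : 'rV[R]_d :=
  \row_k Num.max (-1) (Num.min 1 (x 0 k)).

Lemma clamp_cube (R : realType) (d : nat) (x : 'rV[R]_d) : cube (clamp x).
Proof.
move=> k; rewrite mxE le_max lexx/= ge_max ge_min lexx/= andbT.
by rewrite (le_trans (lerN10 R) ler01).
Qed.

Lemma clamp_id (R : realType) (d : nat) (x : 'rV[R]_d) : cube x -> clamp x = x.
Proof.
by move=> cx; apply/rowP => k; rewrite mxE; have /andP[h1 h2] := cx k; rewrite min_r// max_r.
Qed.

Lemma Ex_sqr_lipschitz disp (Omega : measurableType disp) (R : realType) (P : probability Omega R)
    d (h : 'rV[R]_d -> R) (L : R) (Y Z : Omega -> 'rV[R]_d) :
  (forall x y, cube x -> cube y -> `|h x - h y| <= L * \sum_j `|x 0 j - y 0 j|) ->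
  0 <= L -> (forall w, cube (Y w)) -> (forall w, cube (Z w)) ->
  (forall j, sq_int P (fun w => Y w 0 j - Z w 0 j)) -> sq_int P (fun w => h (Y w) - h (Z w)) ->
  Ex P (fun w => (h (Y w) - h (Z w)) ^+ 2) <=
    L ^+ 2 * d%:R * \sum_j Ex P (fun w => (Y w 0 j - Z w 0 j) ^+ 2).
Proof.
move=> hL L0 cY cZ sB sG.
rewrite -Ex_sum => [|j _]; last by case: (sB j).
rewrite -ExZ; last by apply: int1_sum => j _; case: (sB j).
apply: le_Ex; first by case: sG.
  by apply: int1Z; apply: int1_sum => j _; case: (sB j).
move=> w; rewrite -[X in X <= _]real_normK ?num_real//.
apply: (@le_trans _ _ ((L * \sum_j `|Y w 0 j - Z w 0 j|) ^+ 2)).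
  rewrite lerXn2r ?nnegrE//; first by rewrite mulr_ge0// sumr_ge0.
  exact: hL.
rewrite exprMn -mulrA ler_wpM2l ?sqr_ge0//; apply: (le_trans (sqr_sum_le _)).
by rewrite ler_wpM2l//; apply: ler_sum => j _; rewrite real_normK ?num_real.
Qed.

Section sde.
Context disp (Omega : measurableType disp) (R : realType) (P : probability Omega R).
Variables (F : R -> set (set Omega)) (M d : nat) (B : 'I_M -> R -> Omega -> R).
Hypotheses (hF : filtration F) (hB : brownian_motion P F B).
Local Notation L2 := (sq_int P).
Variables (g : 'I_M.+1 -> 'rV[R]_d -> 'rV[R]_d) (x0 : 'rV[R]_d) (X : R -> Omega -> 'rV[R]_d).
Hypothesis Cg : forall m k, class_C 1 (@cube R d) (fun x => g m x 0 k).
Hypothesis hX : sde_solution P F B g x0 X.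
Local Notation Xh t w := (clamp (X t w)).
Local Notation gh m k t w := (g m (Xh t w) 0 k).

Let cg m k : {within @cube R d, continuous (fun x => g m x 0 k)} := proj1 (Cg m k).

Lemma clamp_adapted t k : 0 <= t -> sigma_measurable (F t) (fun w => Xh t w 0 k).
Proof.
move=> t0; have [mX _ _ _ _] := hX; have [sF _] := hF.1 t t0.
apply/(sigma_measurableE sF); under eq_fun do rewrite mxE.
apply: measurable_maxr => //; apply: measurable_minr => //.
exact/(sigma_measurableE sF)/mX.
Qed.

Lemma clamp_ae : {ae P, forall w, forall t, 0 <= t -> Xh t w = X t w}.
Proof.
have [_ _ cX _ _] := hX; apply: filterS cX => w cX t t0.
by rewrite clamp_id//; exact: cX.
Qed.

Lemma clamp_sq_int t k : 0 <= t -> L2 (fun w => Xh t w 0 k).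
Proof.
move=> t0; apply: (@sq_int_bnd _ _ _ _ _ 1).
  exact: (sigma_measurable_fun hF t0 (clamp_adapted k t0)).
by move=> w; rewrite ler_norml; exact: clamp_cube.
Qed.

Lemma coef_adm m k t : 0 <= t -> adm F t (fun w => gh m k t w).
Proof.
move=> t0; have [K K0 hK] := cube_bounded (@cg m k).
split; last by exists K => w; apply: hK; exact: clamp_cube.
apply: (@sigma_measurable_within_continuous _ _ _ _ hF d (@cube R d) (fun x => g m x 0 k) _
  (fun w => Xh t w) t0 (@cg m k)).
- by move=> N y; exact: cube_round_down.
- by move=> w; exact: clamp_cube.
- by move=> j; exact: clamp_adapted.
Qed.

Lemma coef_processE m k t w : Xh t w = X t w -> coef_process (g m) X k t w = gh m k t w.
Proof.
by move=> E; rewrite /coef_process indicE mem_set ?mul1r ?E// -E; exact: clamp_cube.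
Qed.

Lemma coef_path_continuous k t w : {within `[0, +oo[, continuous (fun r => X r w)} ->
  (forall r, 0 <= r -> Xh r w = X r w) ->
  {within `[0, t], continuous (fun r => gh ord0 k r w)}.
Proof.
move=> /subspace_continuousP cX E; apply/subspace_continuousP => r rt.
have r0 : 0 <= r by move: rt; rewrite /= in_itv/= => /andP[].
have cr : @cube R d (X r w) by rewrite -E//; exact: clamp_cube.
have /subspace_continuousP/(_ _ cr) cgr := @cg ord0 k.
have rX : `[0%R, +oo[%classic r by rewrite /= in_itv/= r0.
move=> Q hQ0; have /cgr hQ : nbhs (g ord0 (X r w) 0 k) Q by rewrite -E//; exact: hQ0.
have hQ' : nbhs (X r w) (fun y => cube y -> Q (g ord0 y 0 k)) by exact: hQ.
have h1 : nbhs r (fun u => `[0%R, +oo[%classic u -> cube (X u w) -> Q (g ord0 (X u w) 0 k)).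
  exact: (cX r rX _ hQ').
change (nbhs r (fun u => `[0%R, t]%classic u -> Q (gh ord0 k u w))).
apply: filterS h1 => u hu; rewrite /= in_itv/= => /andP[u0 ut].
rewrite E//; apply: hu; first by rewrite /= in_itv/= u0.
by rewrite -E//; exact: clamp_cube.
Qed.

(* A solution is not assumed jointly measurable, so Fubini does not apply to the
   drift integral: its moments are computed on Riemann sums instead. *)
Lemma sde_increment k s t : 0 <= s -> s <= t -> exists Is It : 'I_M -> Omega -> R,
  [/\ forall m, ito_integral P F (B m) s (coef_process (g (lift ord0 m)) X k) (Is m),
      forall m, ito_integral P F (B m) t (coef_process (g (lift ord0 m)) X k) (It m) &
      {ae P, forall w, riemann_sum (fun r => gh ord0 k r w) s t N @[N --> \oo] -->
        (Xh t w 0 k - Xh s w 0 k - \sum_(m < M) (It m w - Is m w) : R)}].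
Proof.
move=> s0 st; have t0 := le_trans s0 st; have [_ cX _ _ eqn] := hX.
have [Is [hIs es]] := eqn s k s0; have [It [hIt et]] := eqn t k t0.
exists Is, It; split => //.
have cl := clamp_ae.
have Ec u w : 0 <= u -> (forall r, 0 <= r -> Xh r w = X r w) ->
    \int[lebesgue_measure]_(r in `[0, u]) coef_process (g ord0) X k r w =
    \int[lebesgue_measure]_(r in `[0, u]) gh ord0 k r w.
  move=> u0 E; apply: eq_Rintegral => r; rewrite inE/= in_itv/= => /andP[r0 _].
  by apply: coef_processE; exact: E.
apply: filterS2 (filterI cl cX) (filterI es et) => w [Ew cw] [esw etw].
have := cvg_riemann_sum s0 st (@coef_path_continuous k t w cw Ew).
rewrite -!Ec// !Ew// etw esw sumrB.
set a := Rintegral _ _ _; set b := Rintegral _ _ _; set u := \sum_i _; set v := \sum_i _.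
by have -> : x0 0 k + a + u - (x0 0 k + b + v) - (u - v) = a - b by ring.
Qed.

End sde.

(** * Local error of the solution *)

Section sde_regularity.
Context disp (Omega : measurableType disp) (R : realType) (P : probability Omega R).
Variables (F : R -> set (set Omega)) (M d : nat) (B : 'I_M -> R -> Omega -> R).
Hypotheses (hF : filtration F) (hB : brownian_motion P F B).
Local Notation EP := (Ex P).
Local Notation L2 := (sq_int P).
Local Notation D := (incr B).
Variables (g : 'I_M.+1 -> 'rV[R]_d -> 'rV[R]_d) (x0 : 'rV[R]_d) (X : R -> Omega -> 'rV[R]_d).
Hypothesis Cg : forall m k, class_C 1 (@cube R d) (fun x => g m x 0 k).
Hypothesis hX : sde_solution P F B g x0 X.
Local Notation Xh t w := (clamp (X t w)).
Local Notation gh m k t w := (g m (Xh t w) 0 k).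

Lemma coef_process_int_le m k r (c : Omega -> R) (A : R) : 0 <= r ->
  measurable_fun setT (coef_process (g m) X k r) -> adm F r c ->
  EP (fun w => (gh m k r w - c w) ^+ 2) <= A ->
  (\int[P]_w ((coef_process (g m) X k r w - c w) ^+ 2)%:E <= A%:E)%E.
Proof.
move=> r0 mH hc hA; have mc := adm_measurable hF r0 hc.
have hg := coef_adm hF Cg hX m k r0; have mg := adm_measurable hF r0 hg.
have sB : L2 (fun w => gh m k r w - c w).
  by apply: sq_intB; [case: hg => _ [K hK]; exact: sq_int_bnd hK|case: hc => _ [K hK]; exact: sq_int_bnd hK].
apply: (@le_trans _ _ (\int[P]_w ((gh m k r w - c w) ^+ 2)%:E)%E); last first.
  by rewrite -EFin_Ex ?lee_fin//; case: sB.
rewrite le_eqVlt; apply/orP; left; apply/eqP; apply: ae_eq_integral => //.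
- by apply/measurable_EFinP/measurable_funX; exact: measurable_funB.
- by apply/measurable_EFinP/measurable_funX; exact: measurable_funB.
- apply: filterS (clamp_ae hX) => w E _; congr ((_ ^+ 2)%:E); congr (_ - _).
  by apply: coef_processE; exact: E.
Qed.

Lemma sde_decomposition k s t (c : 'I_M.+1 -> Omega -> R) (A : R) : 0 <= s -> s <= t -> 0 <= A ->
  (forall m, adm F s (c m)) ->
  (forall m r, s <= r <= t -> EP (fun w => (gh m k r w - c m w) ^+ 2) <= A) ->
  exists D' J' : Omega -> R,
  [/\ forall w, Xh t w 0 k - Xh s w 0 k = c ord0 w * (t - s)
        + \sum_(m < M) c (lift ord0 m) w * D m s t w + D' w + J' w,
      L2 D' /\ L2 J', EP (fun w => D' w ^+ 2) <= A * (t - s) ^+ 2,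
      EP (fun w => J' w ^+ 2) <= 4 * M%:R ^+ 2 * (A * (t - s)) &
      forall Z, adm F s Z -> EP (fun w => Z w * J' w) = 0].
Proof.
move=> s0 st A0 hc hA; have t0 := le_trans s0 st; have L0 : 0 <= t - s by rewrite subr_ge0.
have [Is [It [hIs hIt cv]]] := sde_increment Cg hX k s0 st.
pose J (m : 'I_M) w := It m w - Is m w - c (lift ord0 m) w * D m s t w.
have J2 m : L2 (J m) by exact: (ito_increment_sq_int hF hB s0 st (hIs m) (hIt m) (hc _)).
pose J' w := \sum_m J m w.
have J'2 : L2 J' by apply: sq_int_sum => m _; exact: J2.
pose D' w := Xh t w 0 k - Xh s w 0 k - \sum_(m < M) (It m w - Is m w) - c ord0 w * (t - s).
pose h N := (t - s) / N.+1%:R.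
have h0 N : 0 <= h N by rewrite divr_ge0.
have hN N : N.+1%:R * h N = t - s by rewrite /h mulrC mulfVK.
pose r N (i : nat) := s + i%:R * h N.
have rb N (i : 'I_N.+1) : s <= r N i <= t.
  rewrite lerDl mulr_ge0//= -lerBrDl -(hN N) ler_wpM2r//.
  by rewrite ler_nat ltnW.
have r0 N (i : 'I_N.+1) : 0 <= r N i by have /andP[+ _] := rb N i; exact: le_trans.
pose y N (i : 'I_N.+1) w := (gh ord0 k (r N i) w - c ord0 w) * h N.
pose Y N w := \sum_(i < N.+1) y N i w.
have [Kc hKc] := (hc ord0).2.
have [K K0 hK] := cube_bounded (proj1 (Cg ord0 k)).
have mc := adm_measurable hF s0 (hc ord0).
have mg N (i : 'I_N.+1) : measurable_fun setT (fun w => gh ord0 k (r N i) w - c ord0 w).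
  apply: measurable_funB => //.
  exact: (adm_measurable hF (r0 N i) (coef_adm hF Cg hX ord0 k (r0 N i))).
have bg N (i : 'I_N.+1) w : `|gh ord0 k (r N i) w - c ord0 w| <= K + Kc.
  apply: (le_trans (ler_normB _ _)); apply: lerD => //.
  by apply: hK; exact: clamp_cube.
have y2 N i : L2 (y N i).
  have := sq_intZ (h N) (sq_int_bnd P (mg N i) (bg N i)).
  by congr sq_int; apply/funext => w; rewrite /y mulrC.
have YE N w : Y N w = riemann_sum (fun u => gh ord0 k u w) s t N - c ord0 w * (t - s).
  rewrite /Y /riemann_sum -/(h N).
  rewrite (_ : c ord0 w * _ = \sum_(i < N.+1) c ord0 w * h N); last first.
    by rewrite sumr_const card_ord -[RHS]mulr_natl mulrCA hN.
  by rewrite -sumrB; apply: eq_bigr => i _; rewrite /y mulrBl.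
have mJs : measurable_fun setT (fun w => \sum_(m < M) (It m w - Is m w)).
  apply: measurable_sum => m; apply: measurable_funB; first by case: (hIt m).
  by case: (hIs m).
have mD' : measurable_fun setT D'.
  apply: measurable_funB; last by apply: measurable_funM.
  apply: measurable_funB => //; apply: measurable_funB.
    exact: sq_int_measurable (clamp_sq_int hF hX k t0).
  exact: sq_int_measurable (clamp_sq_int hF hX k s0).
have [D'2 D'A] : L2 D' /\ EP (fun w => D' w ^+ 2) <= A * (t - s) ^+ 2.
  apply: (@Ex_sqr_limit_le _ _ _ _ Y _ ((K + Kc) * (t - s))) => //.
  - by move=> N; apply: measurable_sum => i; exact: sq_int_measurable (y2 N i).
  - move=> N w; apply: (le_trans (ler_norm_sum _ _ _)).
    apply: (@le_trans _ _ (\sum_(i < N.+1) (K + Kc) * h N)).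
      by apply: ler_sum => i _; rewrite normrM (ger0_norm (h0 N)) ler_wpM2r.
    by rewrite sumr_const card_ord -mulr_natl mulrCA hN.
  - apply: filterS cv => w cv; under eq_fun do rewrite YE.
    by apply: cvgB => //; exact: cvg_cst.
  (* Cauchy-Schwarz over the nodes: [N.+1] terms of size [A * h N ^+ 2] and the factor [N.+1]
     multiply to [A * (t - s) ^+ 2], uniformly in [N]. *)
  - move=> N; apply: (le_trans (Ex_sqr_sum (y2 N))).
    apply: (@le_trans _ _ (N.+1%:R * \sum_(i < N.+1) A * h N ^+ 2)).
      apply: ler_wpM2l => //; apply: ler_sum => i _.
      rewrite (_ : (fun _ => _) = fun w => h N ^+ 2 * (gh ord0 k (r N i) w - c ord0 w) ^+ 2).
        rewrite ExZ; last by case: (sq_int_bnd P (mg N i) (bg N i)).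
        by rewrite mulrC ler_wpM2r ?sqr_ge0//; apply: hA; exact: rb.
      by apply/funext => w; rewrite /y exprMn mulrC.
    rewrite sumr_const card_ord -mulr_natl -(hN N).
    by rewrite le_eqVlt; apply/orP; left; apply/eqP; ring.
exists D', J'; split => //.
- move=> w; rewrite /D' (_ : J' w = \sum_(m < M) (It m w - Is m w)
      - \sum_(m < M) c (lift ord0 m) w * D m s t w); last by rewrite -sumrB.
  by set a := \sum_(m < M) (It m w - _); set b := \sum_(m < M) _ * _; ring.
- apply: (le_trans (Ex_sqr_sum J2)).
  apply: (@le_trans _ _ (M%:R * \sum_(m < M) 4 * (A * (t - s)))).
    apply: ler_wpM2l => //; apply: ler_sum => m _.
    apply: (ito_increment_bound hF hB s0 st (hIs m) (hIt m) (hc _) A0) => u /andP[su ut].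
    have u0 : 0 <= u by exact: le_trans (ltW su).
    have cu := adm_le hF s0 (ltW su) (hc (lift ord0 m)).
    apply: (coef_process_int_le u0 _ cu).
      have [[_ mH _] _ _] := hIt m.
      by apply: (sigma_measurable_fun hF u0); apply: mH; rewrite u0.
    by apply: hA; rewrite (ltW su).
  rewrite sumr_const card_ord -mulr_natl.
  by rewrite le_eqVlt; apply/orP; left; apply/eqP; ring.
- move=> Z hZ; have Z2 : L2 Z.
    by case: (hZ) => _ [Kz hKz]; exact: sq_int_bnd (adm_measurable hF s0 hZ) hKz.
  rewrite (_ : (fun _ => _) = fun w => \sum_m Z w * J m w); last first.
    by apply/funext => w; rewrite mulr_sumr.
  rewrite Ex_sum => [|m _]; last exact: sq_intM.
  by rewrite big1// => m _; exact: (ito_increment_orth hF hB s0 st (hIs m) (hIt m) (hc _) hZ).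
Qed.

(** With coefficients frozen at 0, their boundedness alone provides the constant of
    [sde_decomposition]; the drift part, of order (t - s)^2, is absorbed by a factor T. *)
Lemma sde_mean_square_increment (T : R) : 0 <= T -> exists2 C, 0 <= C &
  forall s t k, 0 <= s -> s <= t -> t <= T ->
    EP (fun w => (Xh t w 0 k - Xh s w 0 k) ^+ 2) <= C * (t - s).
Proof.
move=> T0.
have [K K0 hK] := cube_uniform_bound (fun m k => proj1 (Cg m k)).
exists (2 * (K ^+ 2 * T) + 2 * (4 * M%:R ^+ 2 * K ^+ 2)).
  by rewrite addr_ge0// !mulr_ge0// ?sqr_ge0.
move=> s t k s0 st tT; have L0 : 0 <= t - s by rewrite subr_ge0.
have h0 (m : 'I_M.+1) : adm F s (fun=> 0 : R).
  split; first exact: sigma_measurable_cst hF _ _ s0.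
  by exists 0 => w; rewrite normr0.
have [|D' [J' [E [D2 J2] hD hJ _]]] :=
  @sde_decomposition k s t (fun _ _ => 0) (K ^+ 2) s0 st (sqr_ge0 K) h0.
  move=> m r /andP[sr rt]; have r0 := le_trans s0 sr.
  rewrite -[leRHS](Ex_cst P); apply: le_Ex; last first.
  - move=> w; rewrite subr0 -real_normK ?num_real// lerXn2r ?nnegrE//.
    by apply: hK; exact: clamp_cube.
  - exact: int1_cst.
  - under eq_fun do rewrite subr0; have [sg [K' hK']] := coef_adm hF Cg hX m k r0.
    by case: (sq_int_bnd P (sigma_measurable_fun hF r0 sg) hK').
rewrite (_ : (fun _ => _) = fun w => (D' w + J' w) ^+ 2); last first.
  by apply/funext => w; rewrite E mul0r big1 ?add0r// => m _; rewrite mul0r.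
apply: (le_trans (Ex_sqrD D2 J2)).
rewrite [leRHS]mulrDl -!mulrA; apply: lerD; apply: ler_wpM2l => //; last first.
  by apply: (le_trans hJ); rewrite le_eqVlt; apply/orP; left; apply/eqP; ring.
apply: (le_trans hD); rewrite [K * (K * _)]mulrA -expr2; apply: ler_wpM2l; first exact: sqr_ge0.
rewrite expr2; apply: ler_wpM2r => //.
by rewrite lerBlDr (le_trans tT)// lerDl.
Qed.

(** Coefficients frozen at s are off by a Lipschitz function of the increment of the solution, whose
    second moment is already of order t - s: both errors gain one power of t - s over the a priori
    estimate. *)
Lemma sde_local_error (T : R) : 0 <= T -> exists2 C, 0 <= C &
  forall s t k, 0 <= s -> s <= t -> t <= T -> exists D' J' : Omega -> R,
  [/\ forall w, Xh t w 0 k - Xh s w 0 k = gh ord0 k s w * (t - s)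
        + \sum_(m < M) gh (lift ord0 m) k s w * D m s t w + D' w + J' w,
      L2 D' /\ L2 J', EP (fun w => D' w ^+ 2) <= C * (t - s) ^+ 3,
      EP (fun w => J' w ^+ 2) <= C * (t - s) ^+ 2 &
      forall Z, adm F s Z -> EP (fun w => Z w * J' w) = 0].
Proof.
move=> T0; have [C C0 hC] := sde_mean_square_increment T0.
have [L L0 hL] := cube_uniform_lipschitz Cg.
(* One factor [d%:R] comes from Cauchy-Schwarz in [Ex_sqr_lipschitz], the other from the sum over
   coordinates. *)
pose A := L ^+ 2 * (d%:R * (d%:R * C)).
have A0 : 0 <= A by rewrite !mulr_ge0 ?sqr_ge0.
exists (A + 4 * M%:R ^+ 2 * A); first by rewrite addr_ge0// !mulr_ge0// ?sqr_ge0.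
move=> s t k s0 st tT; have ts0 : 0 <= t - s by rewrite subr_ge0.
have X2 u j : 0 <= u -> L2 (fun w => Xh u w 0 j) by move=> u0; exact: (clamp_sq_int hF hX j u0).
have [|||D' [J' [E [D2 J2] hD hJ hZ]]] := @sde_decomposition k s t (fun m w => gh m k s w) (A * (t - s)) s0 st.
- exact: mulr_ge0.
- by move=> m; exact: (coef_adm hF Cg hX m k s0).
- move=> m r /andP[sr rt]; have r0 := le_trans s0 sr.
  have sB j : L2 (fun w => Xh r w 0 j - Xh s w 0 j) by apply: sq_intB; exact: X2.
  have [sr' [Kr hKr]] := coef_adm hF Cg hX m k r0.
  have [ss' [Ks hKs]] := coef_adm hF Cg hX m k s0.
  have sG : L2 (fun w => gh m k r w - gh m k s w).
    apply: sq_intB; first exact: (sq_int_bnd P (sigma_measurable_fun hF r0 sr') hKr).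
    exact: (sq_int_bnd P (sigma_measurable_fun hF s0 ss') hKs).
  apply: (le_trans (Ex_sqr_lipschitz (hL m k) L0 (fun w => clamp_cube (X r w))
    (fun w => clamp_cube (X s w)) sB sG)).
  have -> : A * (t - s) = L ^+ 2 * d%:R * (d%:R * (C * (t - s))) by rewrite /A; ring.
  apply: ler_wpM2l; first by rewrite mulr_ge0 ?sqr_ge0.
  apply: (@le_trans _ _ (\sum_(j < d) C * (t - s))).
    apply: ler_sum => j _; apply: (le_trans (hC s r j s0 sr (le_trans rt tT))).
    by apply: ler_wpM2l => //; rewrite lerD2r.
  by rewrite sumr_const card_ord mulr_natl.
exists D', J'; split => //.
- apply: (le_trans hD); have -> : A * (t - s) * (t - s) ^+ 2 = A * (t - s) ^+ 3 by ring.
  apply: ler_wpM2r; first exact: exprn_ge0.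
  by rewrite lerDl !mulr_ge0// ?sqr_ge0.
- apply: (le_trans hJ); have -> : 4 * M%:R ^+ 2 * (A * (t - s) * (t - s)) = 4 * M%:R ^+ 2 * A * (t - s) ^+ 2 by ring.
  by apply: ler_wpM2r; rewrite ?sqr_ge0// lerDr.
Qed.

End sde_regularity.

(** * Convergence *)

Section one_step.
Context disp (Omega : measurableType disp) (R : realType) (P : probability Omega R).
Variables (F : R -> set (set Omega)) (M d : nat) (B : 'I_M -> R -> Omega -> R).
Hypotheses (hF : filtration F) (hB : brownian_motion P F B).
Local Notation EP := (Ex P).
Local Notation L2 := (sq_int P).
Local Notation D := (incr B).
Variable g : 'I_M.+1 -> 'rV[R]_d -> 'rV[R]_d.

Definition local_expansion (C s t : R) (Y Y' : Omega -> 'rV[R]_d) : Prop :=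
  forall k, exists D' J' : Omega -> R,
  [/\ forall w, Y' w 0 k - Y w 0 k = g ord0 (Y w) 0 k * (t - s)
        + \sum_(m < M) g (lift ord0 m) (Y w) 0 k * D m s t w + D' w + J' w,
      L2 D' /\ L2 J', EP (fun w => D' w ^+ 2) <= C * (t - s) ^+ 3,
      EP (fun w => J' w ^+ 2) <= C * (t - s) ^+ 2 &
      forall Z, adm F s Z -> EP (fun w => Z w * J' w) = 0].

(** Orthogonality removes the cross term of e and V, so V may have a second moment of order tau
    only; W is not orthogonal, but its second moment is one order smaller and can afford the factor
    1/tau. *)
Lemma Ex_sqr_orthD (tau : R) (e V W : Omega -> R) : 0 < tau -> L2 e -> L2 V -> L2 W ->
  EP (fun w => e w * V w) = 0 ->
  EP (fun w => (e w + V w + W w) ^+ 2) <=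
    (1 + tau) * (EP (fun w => e w ^+ 2) + EP (fun w => V w ^+ 2))
    + (1 + tau^-1) * EP (fun w => W w ^+ 2).
Proof.
move=> tau0 e2 V2 W2 eV; have eV2 := sq_intD e2 V2.
have -> : EP (fun w => e w ^+ 2) + EP (fun w => V w ^+ 2) = EP (fun w => (e w + V w) ^+ 2).
  rewrite (_ : (fun w => (e w + V w) ^+ 2) = fun w => e w ^+ 2 + V w ^+ 2 + 2 * (e w * V w)).
    rewrite ExD; [|by apply: int1D; [case: e2|case: V2]|by apply/int1Z/sq_intM].
    by rewrite ExD ?ExZ ?eV ?mulr0 ?addr0//; [exact: sq_intM|case: e2|case: V2].
  by apply/funext => w; ring.
rewrite -ExZ; last by case: eV2.
rewrite -ExZ; last by case: W2.
rewrite -ExD; [|by apply: int1Z; case: eV2|by apply: int1Z; case: W2].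
apply: le_Ex; first by case: (sq_intD eV2 W2).
  by apply: int1D; apply: int1Z; [case: eV2|case: W2].
move=> w; set x := e w + V w; set y := W w.
have ti := ltW (divr_gt0 ltr01 tau0); rewrite div1r in ti.
have h : 0 <= tau^-1 * (tau * x - y) ^+ 2 by rewrite mulr_ge0 ?sqr_ge0.
have E : tau^-1 * (tau * x - y) ^+ 2 = tau * x ^+ 2 - 2 * (x * y) + tau^-1 * y ^+ 2.
  by field; rewrite gt_eqF.
by move: h; rewrite E; lra.
Qed.

Lemma mean_square_step (L C T : R) : 0 <= L -> 0 <= C -> 0 <= T ->
  (forall m k x y, cube x -> cube y ->
    `|g m x 0 k - g m y 0 k| <= L * \sum_j `|x 0 j - y 0 j|) ->
  exists2 K, 0 <= K & forall s t Y Y' Z Z', 0 <= s -> s < t -> t - s <= T ->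
    (forall w, cube (Y w)) -> (forall w, cube (Z w)) ->
    (forall k, adm F s (fun w => Y w 0 k - Z w 0 k)) ->
    (forall m k, adm F s (fun w => g m (Y w) 0 k - g m (Z w) 0 k)) ->
    local_expansion C s t Y Y' -> local_expansion C s t Z Z' ->
    \sum_k EP (fun w => (Y' w 0 k - Z' w 0 k) ^+ 2) <=
      (1 + K * (t - s)) * (\sum_k EP (fun w => (Y w 0 k - Z w 0 k) ^+ 2)) + K * (t - s) ^+ 2.
Proof.
move=> L0 C0 T0 hL; pose Lam := L ^+ 2 * d%:R.
have Lam0 : 0 <= Lam by rewrite mulr_ge0// sqr_ge0.
(* The 1 comes from the term tau E e^2, 1 + T bounds 1 + tau, and the bracket adds the coefficients
   of [V_le] and [W_le], with 8C from each. The factor [d%:R] appears on summing over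
   coordinates. *)
pose K := 1 + (1 + T) * (2 * M%:R ^+ 2 * Lam + 2 * Lam + 16 * C).
have K0 : 0 <= K by rewrite addr_ge0// mulr_ge0// !addr_ge0// !mulr_ge0// sqr_ge0.
exists (d%:R * K); first exact: mulr_ge0.
move=> s t Y Y' Z Z' s0 st tT cY cZ he hg hY hZ; pose tau := t - s; rewrite -/tau.
have tau0 : 0 < tau by rewrite subr_gt0.
have st' := ltW st; have D2 m := incr_sq_int hF hB m s0 st'.
pose eps := \sum_k EP (fun w => (Y w 0 k - Z w 0 k) ^+ 2); rewrite -/eps.
have eps0 : 0 <= eps by apply: sumr_ge0 => k _; apply: Ex_ge0 => w; exact: sqr_ge0.
have ad2 xi : adm F s xi -> L2 xi.
  by move=> h; case: (h) => _ [Kx hKx]; exact: sq_int_bnd (adm_measurable hF s0 h) hKx.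
have dg m k : EP (fun w => (g m (Y w) 0 k - g m (Z w) 0 k) ^+ 2) <= Lam * eps.
  exact: (Ex_sqr_lipschitz (hL m k) L0 cY cZ (fun j => ad2 _ (he j)) (ad2 _ (hg m k))).
suff step k : EP (fun w => (Y' w 0 k - Z' w 0 k) ^+ 2) <=
    EP (fun w => (Y w 0 k - Z w 0 k) ^+ 2) + (K * tau * eps + K * tau ^+ 2).
  apply: (le_trans (ler_sum _ (fun k _ => step k))).
  rewrite big_split/= sumr_const card_ord -mulr_natl -/eps.
  by rewrite le_eqVlt; apply/orP; left; apply/eqP; ring.
have [D1 [J1 [E1 [D12 J12] hD1 hJ1 o1]]] := hY k.
have [D3 [J3 [E3 [D32 J32] hD3 hJ3 o3]]] := hZ k.
pose e w := Y w 0 k - Z w 0 k.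
pose G (m : 'I_M) w := (g (lift ord0 m) (Y w) 0 k - g (lift ord0 m) (Z w) 0 k) * D m s t w.
(* [V] gathers the martingale terms, of second moment O(tau eps + tau^2); [W] below gathers the
   drift difference and the D parts, of second moment O(tau^2 eps + tau^3). *)
pose V w := \sum_m G m w + (J1 w - J3 w).
pose a w := g ord0 (Y w) 0 k - g ord0 (Z w) 0 k.
pose W w := tau * a w + (D1 w - D3 w).
have e2 : L2 e := ad2 _ (he k).
have G2 m : L2 (G m) by exact: (adm_sq_int hF s0 (hg _ _) (D2 m)).
have SG2 : L2 (fun w => \sum_m G m w) by apply: sq_int_sum => m _.
have J2 := sq_intB J12 J32.
have DD2 := sq_intB D12 D32.
have V2 : L2 V by exact: sq_intD.
have a2 : L2 a := ad2 _ (hg ord0 k).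
have ta2 := sq_intZ tau a2.
have W2 : L2 W by exact: sq_intD.
have eV : EP (fun w => e w * V w) = 0.
  rewrite (_ : (fun _ => _) = fun w => \sum_m e w * G m w + (e w * J1 w - e w * J3 w)); last first.
    by apply/funext => w; rewrite /V mulrDr mulr_sumr mulrBr.
  rewrite ExD; first last.
  - by apply: int1B; exact: sq_intM.
  - by apply: int1_sum => m _; exact: sq_intM.
  rewrite ExB; [|exact: sq_intM..]; rewrite (o1 e (he k)) (o3 e (he k)) subrr addr0.
  rewrite Ex_sum => [|m _]; last exact: sq_intM.
  rewrite big1// => m _; have heg := admM hF s0 (he k) (hg (lift ord0 m) k).
  rewrite -[RHS](Ex_sigma_incr hF hB m s0 st' heg.1 (ad2 _ heg)).
  by congr EP; apply/funext => w; rewrite mulrA.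
have -> : (fun w => (Y' w 0 k - Z' w 0 k) ^+ 2) = fun w => (e w + V w + W w) ^+ 2.
  apply/funext => w; congr (_ ^+ 2); rewrite /e /V /W /G /a.
  have -> : \sum_m (g (lift ord0 m) (Y w) 0 k - g (lift ord0 m) (Z w) 0 k) * D m s t w =
      \sum_m g (lift ord0 m) (Y w) 0 k * D m s t w - \sum_m g (lift ord0 m) (Z w) 0 k * D m s t w.
    by rewrite -sumrB; apply: eq_bigr => m _; rewrite mulrBl.
  move: (E1 w) (E3 w); rewrite -/tau.
  set u := \sum_m _; set v := \sum_m _ => h1 h3.
  rewrite -[Y' w 0 k](subrK (Y w 0 k)) h1 -[Z' w 0 k](subrK (Z w 0 k)) h3; ring.
apply: (le_trans (Ex_sqr_orthD tau0 e2 V2 W2 eV)).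
have V_le : EP (fun w => V w ^+ 2) <= 2 * M%:R ^+ 2 * Lam * eps * tau + 8 * C * tau ^+ 2.
  have h1 := Ex_sqrD SG2 J2.
  have h2 := Ex_sqrB J12 J32.
  have h3 : EP (fun w => (\sum_m G m w) ^+ 2) <= M%:R * \sum_(m < M) (Lam * eps * tau).
    apply: (le_trans (Ex_sqr_sum G2)); apply: ler_wpM2l => //; apply: ler_sum => m _.
    have hgg := admM hF s0 (hg (lift ord0 m) k) (hg (lift ord0 m) k).
    have [_ [Kg hKg]] := hgg.
    rewrite (_ : (fun _ => _) = fun w => ((g (lift ord0 m) (Y w) 0 k - g (lift ord0 m) (Z w) 0 k)
      * (g (lift ord0 m) (Y w) 0 k - g (lift ord0 m) (Z w) 0 k)) * D m s t w ^+ 2).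
      rewrite (Ex_sigma_incr_sqr hF hB m s0 st' hgg.1 hKg); apply: ler_wpM2r; first exact: ltW.
      by under eq_fun do rewrite -expr2; exact: dg.
    by apply/funext => w; rewrite /G; ring.
  move: h3; rewrite sumr_const card_ord -[(Lam * eps * tau) *+ M]mulr_natl => h3.
  move: h1 h2 h3 hJ1 hJ3; rewrite -/tau.
  set x1 := EP _; set x2 := EP _; set x3 := EP _; set x4 := EP _; set x5 := EP _.
  set q := tau ^+ 2; set l := Lam * eps * tau => h1 h2 h3 h4 h5.
  have -> : 2 * M%:R ^+ 2 * Lam * eps * tau = 2 * (M%:R * (M%:R * l)) by rewrite /l; ring.
  by move: (M%:R * (M%:R * l)) h3 => z h3; move: (C * q) h4 h5 (mulrA 8 C q) => cq h4 h5 E; lra.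
have W_le : EP (fun w => W w ^+ 2) <= 2 * tau ^+ 2 * (Lam * eps) + 8 * C * tau ^+ 3.
  have h1 := Ex_sqrD ta2 DD2.
  have h2 := Ex_sqrB D12 D32.
  have h3 : EP (fun w => (tau * a w) ^+ 2) <= tau ^+ 2 * (Lam * eps).
    under eq_fun do rewrite exprMn.
    rewrite ExZ; last by case: a2.
    by apply: ler_wpM2l; [exact: sqr_ge0|exact: dg].
  move: h1 h2 h3 hD1 hD3; rewrite -/tau.
  set x1 := EP _; set x2 := EP _; set x3 := EP _; set x4 := EP _; set x5 := EP _.
  set q := tau ^+ 3; set l := tau ^+ 2 * (Lam * eps) => h1 h2 h3 h4 h5.
  have -> : 2 * tau ^+ 2 * (Lam * eps) = 2 * l by rewrite /l; ring.
  by move: (C * q) h4 h5 (mulrA 8 C q) => cq h4 h5 E; lra.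
have e_le : EP (fun w => e w ^+ 2) <= eps.
  rewrite /eps (bigD1 k)//= lerDl sumr_ge0// => j _; apply: Ex_ge0 => w; exact: sqr_ge0.
have e0 : 0 <= EP (fun w => e w ^+ 2) by apply: Ex_ge0 => w; exact: sqr_ge0.
rewrite -/(e _).
move: e_le e0 V_le W_le; set x := EP _; set v := EP _; set y := EP _ => e_le e0 V_le W_le.
pose Q1 := 2 * M%:R ^+ 2 * Lam * eps + 8 * C * tau.
pose Q2 := 2 * (Lam * eps) + 8 * C * tau.
have Q10 : 0 <= Q1 by rewrite addr_ge0// !mulr_ge0// ?sqr_ge0// ltW.
have Q20 : 0 <= Q2 by rewrite addr_ge0// !mulr_ge0// ltW.
have hV : (1 + tau) * v <= (1 + T) * (Q1 * tau).
  apply: ler_pM; rewrite ?lerD2l//; first by rewrite addr_ge0// ltW.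
    by apply: Ex_ge0 => w; exact: sqr_ge0.
  by apply: (le_trans V_le); rewrite le_eqVlt; apply/orP; left; apply/eqP; rewrite /Q1; ring.
have hW : (1 + tau^-1) * y <= (1 + T) * (Q2 * tau).
  apply: (@le_trans _ _ ((1 + tau^-1) * (tau ^+ 2 * Q2))).
    apply: ler_wpM2l; first by rewrite addr_ge0// invr_ge0 ltW.
    by apply: (le_trans W_le); rewrite le_eqVlt; apply/orP; left; apply/eqP; rewrite /Q2; ring.
  have -> : (1 + tau^-1) * (tau ^+ 2 * Q2) = (1 + tau) * (Q2 * tau) by field; rewrite gt_eqF.
  by apply: ler_wpM2r; [rewrite mulr_ge0// ltW|rewrite lerD2l].
rewrite [(1 + tau) * (x + v)]mulrDr.
apply: (@le_trans _ _ (x + tau * eps + (1 + T) * (Q1 * tau) + (1 + T) * (Q2 * tau))).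
  apply: lerD => //; apply: lerD => //.
  by rewrite mulrDl mul1r lerD2l ler_wpM2l// ltW.
rewrite -!addrA lerD2l addrA.
have -> : K * tau * eps + K * tau ^+ 2 = tau * eps + (1 + T) * (Q1 * tau) + (1 + T) * (Q2 * tau)
   + ((1 + T) * (16 * C) * (tau * eps) + tau ^+ 2 * (1 + (1 + T) * (2 * M%:R ^+ 2 * Lam + 2 * Lam))).
  by rewrite /K /Q1 /Q2; ring.
rewrite lerDl addr_ge0//.
  by apply: mulr_ge0; apply: mulr_ge0; [exact: addr_ge0|exact: mulr_ge0|exact: ltW|].
apply: mulr_ge0; first exact: sqr_ge0.
by rewrite addr_ge0// mulr_ge0// ?addr_ge0// !mulr_ge0// sqr_ge0.
Qed.

End one_step.

(** Each of the n source terms is charged the largest growth factor, (1 + x)^n. *)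
Lemma discrete_gronwall (R : realType) (x y : R) (u : nat -> R) (N : nat) :
  0 <= x -> 0 <= y -> u 0%N = 0 ->
  (forall n, (n < N)%N -> u n.+1 <= (1 + x) * u n + y) ->
  forall n, (n <= N)%N -> u n <= expR (n%:R * x) * (n%:R * y).
Proof.
move=> x0 y0 u0 uS n nN.
have h1 i : (1 + x) ^+ i <= expR (i%:R * x).
  by rewrite expRM_natl lerXn2r ?nnegrE ?expR_ge0 ?expR_ge1Dx// addr_ge0.
apply: (@le_trans _ _ ((1 + x) ^+ n * (n%:R * y))); last first.
  by apply: ler_wpM2r => //; exact: mulr_ge0.
elim: n nN => [|n IH] nN; first by rewrite u0 mul0r mulr0.
apply: (le_trans (uS n nN)).
have p1 : 1 <= (1 + x) ^+ n.+1 by rewrite exprn_ege1// lerDl.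
apply: (@le_trans _ _ ((1 + x) * ((1 + x) ^+ n * (n%:R * y)) + (1 + x) ^+ n.+1 * y)).
  apply: lerD; last by rewrite -[leLHS]mul1r ler_wpM2r.
  by apply: ler_wpM2l; [rewrite addr_ge0|exact: IH (ltnW nN)].
rewrite le_eqVlt; apply/orP; left; apply/eqP; rewrite exprS -natr1; ring.
Qed.

Section convergence.
Context disp (Omega : measurableType disp) (R : realType) (P : probability Omega R).
Variables (F : R -> set (set Omega)) (M d : nat) (B : 'I_M -> R -> Omega -> R).
Hypotheses (hF : filtration F) (hB : brownian_motion P F B).
Local Notation EP := (Ex P).
Local Notation L2 := (sq_int P).
Variables (g f : 'I_M.+1 -> 'rV[R]_d -> 'rV[R]_d) (x0 : 'rV[R]_d) (X : R -> Omega -> 'rV[R]_d).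
Variables (Phi : R -> R -> R -> R) (beta T : R).
Hypothesis Cg : forall m k, class_C 1 (@cube R d) (fun x => g m x 0 k).
Hypothesis hX : sde_solution P F B g x0 X.
Hypothesis cf : forall m k, {within @cube R d, continuous (fun x => f m x 0 k)}.
Hypothesis gE : forall m k x, @cube R d x -> g m x 0 k = sigma (x 0 k) * f m x 0 k.
Hypothesis Phi1 : forall s gamma y, 0 <= s -> -1 <= y <= 1 -> -1 <= Phi s gamma y <= 1.
Hypothesis Phi3 : class_C 3 (@int_dom R) (uncurry3 Phi).
Hypothesis Phi0 : forall y, -1 <= y <= 1 ->
  [/\ Phi 0 0 y = y, dPhi Phi 0 1 0 0 0 y = sigma y &
      dPhi Phi 1 0 0 0 0 y + 2^-1 * dPhi Phi 0 2 0 0 0 y = 0].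
Hypotheses (beta0 : 0 < beta) (Phi_norm : (norm_p_beta 3 beta Phi < +oo)%E).
Hypothesis cx0 : cube x0.
Hypothesis T0 : 0 < T.
Local Notation Xh t w := (clamp (X t w)).
Local Notation S := (scheme Phi f B x0).

Let cPhi : {within @int_dom R, continuous (uncurry3 Phi)} := proj1 Phi3.

Lemma scheme_error_adm tau n k : 0 <= tau ->
  adm F (n%:R * tau) (fun w => S tau n w 0 k - Xh (n%:R * tau) w 0 k).
Proof.
move=> tau0; have t0 : 0 <= n%:R * tau by rewrite mulr_ge0.
apply: (admB hF) => //; split.
- exact: (scheme_adapted hF hB cf Phi1 cPhi cx0 tau0 n k).
- by exists 1 => w; rewrite ler_norml; exact: (scheme_cube B f Phi1 cx0 tau0 n w).
- exact: (clamp_adapted hF hX k t0).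
- by exists 1 => w; rewrite ler_norml; exact: clamp_cube.
Qed.

Lemma local_expansion_le C C' s t Y Y' : C <= C' -> 0 <= t - s ->
  local_expansion P F B g C s t Y Y' -> local_expansion P F B g C' s t Y Y'.
Proof.
move=> CC' ts hY k; have [D' [J' [E L hD hJ o]]] := hY k.
exists D', J'; split => //.
- by apply: (le_trans hD); apply: ler_wpM2r => //; exact: exprn_ge0.
- by apply: (le_trans hJ); apply: ler_wpM2r => //; exact: exprn_ge0.
Qed.

Lemma scheme_mean_square_error : exists2 A, 0 <= A & forall N n, (0 < N)%N -> (n <= N)%N ->
  \sum_k EP (fun w => (S (T / N%:R) n w 0 k - Xh (n%:R * (T / N%:R)) w 0 k) ^+ 2)
    <= A * (T / N%:R).
Proof.
have T0' := ltW T0.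
have [C1 C10 hC1] := scheme_local_error hF hB T cf gE Phi1 Phi3 Phi0 beta0 Phi_norm cx0.
have [C2 C20 hC2] := sde_local_error hF hB Cg hX T0'.
have [L L0 hL] := cube_uniform_lipschitz Cg.
have [K K0 hK] := mean_square_step hF hB L0 (addr_ge0 C10 C20) T0' hL.
(* As n tau <= T, the growth factor is at most exp(KT) and the accumulated source n K tau^2 at most
   KT tau. *)
exists (expR (K * T) * (K * T)); first by rewrite mulr_ge0 ?expR_ge0// mulr_ge0.
move=> N n N0 nN; set tau := T / N%:R.
have tau0 : 0 < tau by rewrite divr_gt0// ltr0n.
have tau0' := ltW tau0.
have NT : N%:R * tau = T by rewrite /tau mulrC mulfVK// pnatr_eq0 -lt0n.
have tauT : tau <= T by rewrite ler_pdivrMr ?ltr0n// ler_peMr// ler1n.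
have nt i : (i <= N)%N -> i%:R * tau <= T by move=> iN; rewrite -NT ler_wpM2r// ler_nat.
have dt i : i.+1%:R * tau - i%:R * tau = tau by rewrite -natr1; ring.
pose u i := \sum_k EP (fun w => (S tau i w 0 k - Xh (i%:R * tau) w 0 k) ^+ 2).
have u0 : u 0%N = 0.
  rewrite /u big1// => k _; rewrite -[RHS](Ex_cst P 0); apply: Ex_ae => //.
    apply: measurable_funX; have h := scheme_error_adm 0 k tau0'.
    by apply: (adm_measurable hF _ h); rewrite mul0r.
  have [_ _ _ X0 _] := hX.
  apply: filterS2 X0 (clamp_ae hX) => w E1 E2.
  by rewrite mul0r E2//= E1 subrr expr0n.
have uS i : (i < N)%N -> u i.+1 <= (1 + K * tau) * u i + K * tau ^+ 2.
  move=> iN; have t0 : 0 <= i%:R * tau by rewrite mulr_ge0.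
  have st : i%:R * tau < i.+1%:R * tau by rewrite ltr_pM2r// ltr_nat.
  have := hK (i%:R * tau) (i.+1%:R * tau) (S tau i) (S tau i.+1)
    (fun w => Xh (i%:R * tau) w) (fun w => Xh (i.+1%:R * tau) w) t0 st.
  rewrite dt; apply => //.
  - exact: (scheme_cube B f Phi1 cx0 tau0' i).
  - by move=> w; exact: clamp_cube.
  - by move=> k; exact: scheme_error_adm.
  - move=> m k; apply: (admB hF) => //; last exact: (coef_adm hF Cg hX m k t0).
    exact: (scheme_fun_adm hF hB cf Phi1 Phi3 cx0 i tau0' (proj1 (Cg m k))).
  - apply: (@local_expansion_le C1); rewrite ?dt ?lerDl// => k.
    by have := hC1 tau i k tau0' tauT; rewrite dt.
  - apply: (@local_expansion_le C2); rewrite ?dt ?lerDr// => k.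
    exact: (hC2 _ _ k t0 (ltW st) (nt _ iN)).
have := discrete_gronwall (mulr_ge0 K0 tau0') (mulr_ge0 K0 (sqr_ge0 tau)) u0 uS nN.
rewrite -/(u n) => /le_trans; apply.
have -> : n%:R * (K * tau ^+ 2) = K * (n%:R * tau) * tau by ring.
rewrite mulrA ler_wpM2r// ler_pM ?expR_ge0 ?mulr_ge0//.
  by rewrite ler_expR (_ : n%:R * _ = K * (n%:R * tau)) ?ler_wpM2l ?nt//; ring.
by rewrite ler_wpM2l ?nt.
Qed.

(** The solution and its clamped version agree almost surely, so the error of the statement is the
    one estimated above; its finiteness comes from the boundedness of the scheme and of the clamped
    solution. *)
Lemma expectation_error tau n : 0 <= tau ->
  ('E_P[fun w => (enorm (S tau n w - X (n%:R * tau)%R w) ^+ 2)%R] =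
  (\sum_k EP (fun w => (S tau n w 0 k - Xh (n%:R * tau) w 0 k) ^+ 2))%R%:E)%E.
Proof.
move=> tau0; have t0 : 0 <= n%:R * tau by rewrite mulr_ge0.
have e2 k : L2 (fun w => S tau n w 0 k - Xh (n%:R * tau) w 0 k).
  have h := scheme_error_adm n k tau0.
  by case: (h) => _ [K hK]; exact: sq_int_bnd (adm_measurable hF t0 h) hK.
rewrite -Ex_sum => [|k _]; last by case: (e2 k).
rewrite EFin_Ex; last by apply: int1_sum => k _; case: (e2 k).
rewrite unlock; under eq_integral do rewrite enorm_sqr.
apply: ae_eq_integral => //.
- apply/measurable_EFinP; apply: measurable_sum => k; apply: measurable_funX.
  under eq_fun do rewrite !mxE; apply: measurable_funB.
    exact: (sigma_measurable_fun hF t0 (scheme_adapted hF hB cf Phi1 cPhi cx0 tau0 n k)).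
  by have [mX _ _ _ _] := hX; exact: (sigma_measurable_fun hF t0 (mX k _ t0)).
- apply/measurable_EFinP; apply: measurable_sum => k; apply: measurable_funX.
  exact: sq_int_measurable (e2 k).
- apply: filterS (clamp_ae hX) => w E _; congr EFin; apply: eq_bigr => k _.
  by rewrite (E _ t0) !mxE.
Qed.

End convergence.

Theorem theorem7 (R : realType) (disp : measure_display)
    (Omega : measurableType disp) (P : probability Omega R)
    (F : R -> set (set Omega)) (d M : nat)
    (B : 'I_M -> R -> Omega -> R)
    (g : 'I_M.+1 -> 'rV[R]_d -> 'rV[R]_d)
    (f : 'I_M.+1 -> 'rV[R]_d -> 'rV[R]_d)
    (x0 : 'rV[R]_d) (X : R -> Omega -> 'rV[R]_d)
    (Phi : R -> R -> R -> R) :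
  (0 < d)%N -> (0 < M)%N ->
  filtration F -> brownian_motion P F B ->
  (forall m k, class_C 2 (@cube R d) (fun x => g m x 0 k)) ->
  (forall m k x, @cube R d x -> (x 0 k = -1 \/ x 0 k = 1) -> g m x 0 k = 0) ->
  @cube R d x0 ->
  sde_solution P F B g x0 X ->
  (forall m k, {within @cube R d, continuous (fun x => f m x 0 k)}) ->
  (forall m k x, @cube R d x -> g m x 0 k = sigma (x 0 k) * f m x 0 k) ->
  (forall s gamma y, 0 <= s -> -1 <= y <= 1 -> -1 <= Phi s gamma y <= 1) ->
  (forall y, -1 <= y <= 1 ->
    [/\ Phi 0 0 y = y,
        dPhi Phi 0 1 0 0 0 y = sigma y &
        dPhi Phi 1 0 0 0 0 y + 2^-1 * dPhi Phi 0 2 0 0 0 y = 0]) ->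
  class_C 3 (@int_dom R) (uncurry3 Phi) ->
  (exists2 beta : R, 0 < beta & (norm_p_beta 3 beta Phi < +oo)%E) ->
  forall T : R, 0 < T ->
  exists2 C : R, 0 < C &
  forall N : nat, (0 < N)%N ->
  let tau := T / N%:R in
  (ereal_sup [set ('E_P[fun w =>
       (enorm (scheme Phi f B x0 tau n w - X (n%:R * tau)%R w) ^+ 2)%R]
     `^ 2^-1) | n in [set n : nat | (n <= N)%N]]
   <= (C * tau `^ 2^-1)%:E)%E.
Proof.
move=> d0 M0 hF hB Cg g0 cx0 hX cf gE Phi1 Phi0 Phi3 [beta beta0 Phi_norm] T T0.
have Cg1 m k := class_C1 (Cg m k).
have [A A0 hA] := scheme_mean_square_error hF hB Cg1 hX cf gE Phi1 Phi3 Phi0 beta0 Phi_norm cx0 T0.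
(* The added 1 makes the constant positive, since [A] may be 0. *)
exists (A `^ 2^-1 + 1); first by rewrite ltr_wpDl ?powR_ge0.
move=> N N0; cbv zeta; set tau := T / N%:R; have tau0 : 0 <= tau by rewrite divr_ge0// ltW.
apply: ge_ereal_sup => _ [n /= nN <-].
rewrite (expectation_error hF hB hX cf Phi1 Phi3 cx0 n tau0) poweR_EFin lee_fin.
apply: (@le_trans _ _ ((A * tau) `^ 2^-1)).
  apply: ge0_ler_powR; rewrite ?nnegrE ?invr_ge0//; last exact: hA.
  - by apply: sumr_ge0 => k _; apply: Ex_ge0 => w; exact: sqr_ge0.
  - exact: mulr_ge0.
by rewrite powRM// mulrDl lerDl mul1r powR_ge0.
Qed.
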